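(* Let $m\ge2$ and $n\ge 1$ be integers, let $B\subset\mathbb{R}^m$ be the open unit ball, and let $1<p<\frac{m}{m-1}$. There exists $\epsilon_{m,p}>0$ such that for any $\Omega\in L^p(B,\mathrm{M}(n)\otimes\wedge^1\mathbb{R}^m)$ satisfying $$\operatorname{div}\Omega=0\quad\text{in }\mathcal{D}'(B)$$ and for any weak solution $u\in W^{1,2}(B,\mathbb{R}^n)$ of the elliptic system $$-\operatorname{div}(\nabla u+\Omega\,u)=0\quad\text{in }\mathcal{D}'(B)$$ satisfying $$\|\nabla u\|_{M^p_p(B)}+\|\Omega\|_{M^p_p(B)}<\epsilon_{m,p},$$ $u$ is (locally) Hölder continuous in $B$.
   Context: $\mathrm{M}(n)$ is the space of real $n\times n$ matrices; $\Omega=(\Omega^{ij})$ is a matrix of vector fields $\Omega^{ij}$ on $B\subset\mathbb{R}^m$, with $\operatorname{div}$ taken entrywise and $(\Omega u)^i=\sum_j\Omega^{ij}u^j$. For $1\le s<\infty$ the Morrey norm of $f\in L^s_{\mathrm{loc}}(B)$ is $$\|f\|_{M^s_s(B)}=\sup_{B_R(x)\subset B}\Big(R^{s-m}\int_{B_R(x)}|f|^s\Big)^{1/s}.$$ Hölder continuous in $B$: $u$ has a representative which on each compact subset of $B$ is Hölder continuous with some exponent in $(0,1)$. *)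

(* Defs.v *)
From HB Require Import structures.
From mathcomp Require Import all_boot all_order all_algebra.
From mathcomp Require Import all_classical all_reals all_analysis.

Set Implicit Arguments.
Unset Strict Implicit.
Unset Printing Implicit Defensive.

Import Order.TTheory GRing.Theory Num.Theory.
Import numFieldNormedType.Exports.

Local Open Scope classical_set_scope.
Local Open Scope ring_scope.

(* The product sigma-algebra on row vectors, as the library does for n.-tuple;
   on 'rV[R]_n it is the Borel sigma-algebra. *)
Section measurable_rV.
Context {d : measure_display} {T : sigmaRingType d}.
Variable n : nat.

Let coor : 'I_n -> 'rV[T]_n -> T := fun i x => x ord0 i.

Let rV_set0 : g_sigma_preimage coor set0.
Proof. exact: sigma_algebra0. Qed.

Let rV_setC A : g_sigma_preimage coor A -> g_sigma_preimage coor (~` A).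
Proof. exact: sigma_algebraC. Qed.

Let rV_bigcup (F : (set 'rV[T]_n)^nat) :
  (forall i, g_sigma_preimage coor (F i)) ->
  g_sigma_preimage coor (\bigcup_i (F i)).
Proof. exact: sigma_algebra_bigcup. Qed.

HB.instance Definition _ := @isMeasurable.Build (measure_tuple_display d)
  'rV[T]_n (g_sigma_preimage coor) rV_set0 rV_setC rV_bigcup.

End measurable_rV.

Lemma measurable_coord d (T : sigmaRingType d) n (i : 'I_n) :
  measurable_fun [set: 'rV[T]_n] (fun x : 'rV[T]_n => x ord0 i).
Proof.
move=> _ Y mY; rewrite setTI; apply: sub_sigma_algebra => /=.
rewrite -bigcup_seq/=; exists i => /=; first by rewrite mem_index_enum.
by exists Y => //; rewrite setTI.
Qed.

Lemma measurable_fun_rVP d1 d2 (T1 : measurableType d1)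
    (T2 : measurableType d2) n (f : T1 -> 'rV[T2]_n) :
  measurable_fun [set: T1] f <->
  forall i, measurable_fun [set: T1] (fun x => f x ord0 i).
Proof.
apply: (@iff_trans _ (g_sigma_preimage
    (fun i => (fun x : 'rV[T2]_n => x ord0 i) \o f) `<=` measurable)).
  rewrite g_sigma_preimage_comp; split=> [mf A [/= C preC <-]|prefS].
    exact: mf.
  by move=> _ A mA; apply: prefS; exists A.
split=> [fS i|mf].
- move=> _ A mA.
  apply: fS; apply: sub_sigma_algebra.
  rewrite -bigcup_seq/=; exists i => /=; first by rewrite mem_index_enum.
  by exists A.
- apply: smallest_sub; first exact: sigma_algebra_measurable.
  rewrite -bigcup_seq/=; apply: bigcup_sub => i _.
  by move=> A [B mB <-]; exact: mf.
Qed.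

Definition cons_rV (R : realType) (n : nat) (x : R * 'rV[R]_n) :
  'rV[R]_n.+1 := row_mx (x.1%:M : 'rV[R]_1) x.2.

Lemma cons_rV0 (R : realType) n (x : R * 'rV[R]_n) :
  cons_rV x ord0 ord0 = x.1.
Proof.
have -> : (ord0 : 'I_n.+1) = lshift n (ord0 : 'I_1) by exact/val_inj.
by apply: etrans (row_mxEl _ _ _ _) _; rewrite mxE eqxx.
Qed.

Lemma cons_rVS (R : realType) n (x : R * 'rV[R]_n) (i : 'I_n) :
  cons_rV x ord0 (lift ord0 i) = x.2 ord0 i.
Proof.
have -> : lift ord0 i = rshift 1 i by exact/val_inj.
exact: row_mxEr.
Qed.

Lemma measurable_cons_rV (R : realType) n :
  measurable_fun [set: R * 'rV[R]_n] (@cons_rV R n).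
Proof.
apply/measurable_fun_rVP => i.
have [j ->|->] := unliftP ord0 i; last first.
- by under eq_fun do rewrite cons_rV0; exact: measurable_fst.
- under eq_fun do rewrite cons_rVS.
  apply: (@measurableT_comp _ _ _ _ _ _ (fun v : 'rV[R]_n => v ord0 j)) => //.
  exact: measurable_coord.
Qed.

HB.instance Definition _ (R : realType) n := isMeasurableFun.Build _ _ _ _
  (@cons_rV R n) (@measurable_cons_rV R n).

Definition uncons_rV (R : realType) (n : nat) (v : 'rV[R]_n.+1) :
  R * 'rV[R]_n := (v ord0 ord0, \row_j v ord0 (lift ord0 j)).

Lemma cons_rVK (R : realType) n : cancel (@cons_rV R n) (@uncons_rV R n).
Proof.
case=> a v; rewrite /uncons_rV cons_rV0; congr pair.
by apply/rowP => j; rewrite mxE cons_rVS.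
Qed.

Lemma uncons_rVK (R : realType) n : cancel (@uncons_rV R n) (@cons_rV R n).
Proof.
move=> v; apply/rowP => i; have [j ->|->] := unliftP ord0 i; last first.
- by rewrite cons_rV0.
- by rewrite cons_rVS mxE.
Qed.

Lemma measurable_uncons_rV (R : realType) n :
  measurable_fun [set: 'rV[R]_n.+1] (@uncons_rV R n).
Proof.
apply/measurable_fun_pair => /=; first exact: measurable_coord.
apply/measurable_fun_rVP => j.
by under eq_fun do rewrite mxE; exact: measurable_coord.
Qed.

Section lebesgue_rV_step.
Local Open Scope ereal_scope.
Context {R : realType} {n : nat}.
Variable mu : {sigma_finite_measure set 'rV[R]_n -> \bar R}.

Definition lebesgue_rV_step : set 'rV[R]_n.+1 -> \bar R :=
  pushforward (@lebesgue_measure R \x mu) (@cons_rV R n).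

Let step0 : lebesgue_rV_step set0 = 0.
Proof. apply: measure0; exact: measurable_cons_rV. Qed.

Let step_ge0 A : 0 <= lebesgue_rV_step A.
Proof. apply: measure_ge0; exact: measurable_cons_rV. Qed.

Let step_sigma_additive : semi_sigma_additive lebesgue_rV_step.
Proof. apply: measure_semi_sigma_additive; exact: measurable_cons_rV. Qed.

HB.instance Definition _ := isMeasure.Build _ _ _ lebesgue_rV_step
  step0 step_ge0 step_sigma_additive.

Let step_sigma_finite : sigma_finite setT lebesgue_rV_step.
Proof.
have /sigma_finiteP[F [TF ndF Foo]] := sigma_finiteT (@lebesgue_measure R).
have /sigma_finiteP[G [TG ndG Goo]] := sigma_finiteT mu.
exists (fun k => @uncons_rV R n @^-1` (F k `*` G k)).
  rewrite -preimage_bigcup (_ : \bigcup_k _ = setT) ?preimage_setT//.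
  rewrite -subTset => -[a v] _.
  have [k _ Fka] : (\bigcup_k F k) a by rewrite -TF.
  have [l _ Glv] : (\bigcup_k G k) v by rewrite -TG.
  exists (maxn k l) => //; split.
  - by move: a Fka; exact/subsetPset/ndF/leq_maxl.
  - by move: v Glv; exact/subsetPset/ndG/leq_maxr.
move=> k; have [mFk Fk] := Foo k; have [mGk Gk] := Goo k; split.
  rewrite -[X in measurable X]setTI; apply: measurable_uncons_rV => //.
  exact: measurableX.
rewrite /lebesgue_rV_step /pushforward -comp_preimage.
rewrite (_ : _ \o _ = id); last by apply/funext => x /=; rewrite cons_rVK.
by rewrite preimage_id product_measure1E// lte_mul_pinfty// ge0_fin_numE.
Qed.

HB.instance Definition _ := Measure_isSigmaFinite.Build _ _ _ lebesgue_rV_step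
  step_sigma_finite.

End lebesgue_rV_step.

(* Lebesgue measure on R^m: the point mass on R^0, and on R^(m+1) the image of
   the product of Lebesgue measures on R and R^m under (a, v) |-> a :: v. *)
Fixpoint lebesgue_rV (R : realType) (m : nat) :
    {sigma_finite_measure set 'rV[R]_m -> \bar R} :=
  match m with
  | 0 => \d_(0 : 'rV[R]_0)
  | m'.+1 => lebesgue_rV_step (lebesgue_rV R m')
  end.

Lemma measurable_box (R : realType) (m : nat) (A : 'I_m -> set R) :
  (forall i, measurable (A i)) ->
  measurable [set x : 'rV[R]_m | forall i, A i (x ord0 i)].
Proof.
move=> mA; rewrite [X in measurable X](_ : _ = \bigcap_(i in [set: 'I_m])
    ((fun x : 'rV[R]_m => x ord0 i) @^-1` A i)).
  apply: fin_bigcap_measurable => // i _; rewrite -[X in measurable X]setTI.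
  exact: measurable_coord.
by apply/seteqP; split => x /= Ax i *; exact: Ax.
Qed.

Lemma lebesgue_rV_box (R : realType) (m : nat) (A : 'I_m -> set R) :
  (forall i, measurable (A i)) ->
  lebesgue_rV R m [set x | forall i, A i (x ord0 i)] =
  (\prod_(i < m) lebesgue_measure (A i))%E.
Proof.
elim: m A => [|m IH] A mA /=.
  by rewrite big_ord0 diracE mem_set// => -[].
rewrite big_ord_recl -IH// /lebesgue_rV_step /pushforward.
rewrite -product_measure1E; [|exact: mA|].
  2: by apply: (@measurable_box R m (A \o lift ord0)) => i; exact: mA.
congr product_measure1; apply/seteqP; split => -[a v] /=.
- by move=> Aav; split=> [|i]; [have := Aav ord0|have := Aav (lift ord0 i)];
    rewrite ?cons_rV0 ?cons_rVS.
- move=> [/= Aa Av] i; have [j ->|->] := unliftP ord0 i; last first.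
  + by rewrite cons_rV0.
  + by rewrite cons_rVS.
Qed.

(* The library norm `|x| on 'rV[R]_n is the sup norm, hence these. *)
Definition enorm (R : realType) (n : nat) (v : 'rV[R]_n) : R :=
  Num.sqrt (\sum_(i < n) v ord0 i ^+ 2).

Definition eball (R : realType) (m : nat) (x : 'rV[R]_m) (r : R) :
  set 'rV[R]_m := [set y | enorm (y - x) < r].

Definition unit_ball (R : realType) (m : nat) : set 'rV[R]_m := eball 0 1.
Arguments unit_ball : clear implicits.

Definition partial (R : realType) (m : nat) (k : 'I_m) (f : 'rV[R]_m -> R) :
  'rV[R]_m -> R := fun x => 'D_(delta_mx ord0 k) f x.

Definition smooth (R : realType) (m : nat) (f : 'rV[R]_m -> R) : Prop :=
  forall (s : seq 'I_m) (x : 'rV[R]_m),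
    differentiable (foldr (@partial R m) f s) x.

(* C_c^oo(U), each test function being extended by 0 to R^m. *)
Definition test_function (R : realType) (m : nat) (U : set 'rV[R]_m)
    (phi : 'rV[R]_m -> R) : Prop :=
  smooth phi /\
  exists K : set 'rV[R]_m,
    [/\ compact K, K `<=` U & forall x, ~ K x -> phi x = 0].

(* Functions on an open set U are represented by functions on R^m whose values
   outside U are irrelevant. *)
Definition loc_integrable (R : realType) (m : nat) (U : set 'rV[R]_m)
    (f : 'rV[R]_m -> R) : Prop :=
  measurable_fun U f /\
  forall K : set 'rV[R]_m, compact K -> K `<=` U ->
    (lebesgue_rV R m).-integrable K (EFin \o f).

Definition in_Lp (R : realType) (m : nat) (U : set 'rV[R]_m) (s : R)
    (f : 'rV[R]_m -> R) : Prop :=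
  measurable_fun U f /\ finite_norm (lebesgue_rV R m) s%:E (f \_ U).

Definition is_weak_gradient (R : realType) (m : nat) (U : set 'rV[R]_m)
    (f : 'rV[R]_m -> R) (G : 'rV[R]_m -> 'rV[R]_m) : Prop :=
  [/\ loc_integrable U f,
      forall k : 'I_m, loc_integrable U (fun x => G x ord0 k) &
      forall (phi : 'rV[R]_m -> R) (k : 'I_m), test_function U phi ->
        (\int[lebesgue_rV R m]_(x in U) (f x * partial k phi x)%:E =
         - \int[lebesgue_rV R m]_(x in U) (G x ord0 k * phi x)%:E)%E].

(* u is in W^{1,s}(U, R^n), with Du i the weak gradient of the component u^i. *)
Definition is_sobolev1 (R : realType) (m n : nat) (U : set 'rV[R]_m) (s : R)
    (u : 'rV[R]_m -> 'rV[R]_n) (Du : 'I_n -> 'rV[R]_m -> 'rV[R]_m) : Prop :=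
  forall i : 'I_n,
    [/\ in_Lp U s (fun x => u x ord0 i),
        forall k : 'I_m, in_Lp U s (fun x => Du i x ord0 k) &
        is_weak_gradient U (fun x => u x ord0 i) (Du i)].

(* div X = 0 in D'(U). Local integrability is what makes the vector field X a
   distribution. *)
Definition div_free (R : realType) (m : nat) (U : set 'rV[R]_m)
    (X : 'rV[R]_m -> 'rV[R]_m) : Prop :=
  (forall k : 'I_m, loc_integrable U (fun x => X x ord0 k)) /\
  forall phi : 'rV[R]_m -> R, test_function U phi ->
    (\int[lebesgue_rV R m]_(x in U)
      (\sum_(k < m) X x ord0 k * partial k phi x)%:E = 0)%E.

(* (Omega u)^i = \sum_j Omega^{ij} u^j *)
Definition potential_mul (R : realType) (m n : nat)
    (Omega : 'I_n -> 'I_n -> 'rV[R]_m -> 'rV[R]_m) (u : 'rV[R]_m -> 'rV[R]_n)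
    (i : 'I_n) (x : 'rV[R]_m) : 'rV[R]_m :=
  \sum_(j < n) u x ord0 j *: Omega i j x.

(* -div (Du + Omega u) = 0 in D'(U), row by row. *)
Definition weak_solution (R : realType) (m n : nat) (U : set 'rV[R]_m)
    (Omega : 'I_n -> 'I_n -> 'rV[R]_m -> 'rV[R]_m) (u : 'rV[R]_m -> 'rV[R]_n)
    (Du : 'I_n -> 'rV[R]_m -> 'rV[R]_m) : Prop :=
  forall i : 'I_n, div_free U (fun x => Du i x + potential_mul Omega u i x).

(* Pointwise Euclidean (Hilbert-Schmidt) norms |Du| and |Omega|. *)
Definition grad_norm (R : realType) (m n : nat)
    (Du : 'I_n -> 'rV[R]_m -> 'rV[R]_m) (x : 'rV[R]_m) : R :=
  Num.sqrt (\sum_(i < n) enorm (Du i x) ^+ 2).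

Definition potential_norm (R : realType) (m n : nat)
    (Omega : 'I_n -> 'I_n -> 'rV[R]_m -> 'rV[R]_m) (x : 'rV[R]_m) : R :=
  Num.sqrt (\sum_(i < n) \sum_(j < n) enorm (Omega i j x) ^+ 2).

(* The norm of M^s_s(U), applied to the pointwise norm of a field. *)
Definition morrey_norm (R : realType) (m : nat) (U : set 'rV[R]_m) (s : R)
    (f : 'rV[R]_m -> R) : \bar R :=
  ereal_sup [set e | exists (x : 'rV[R]_m) (r : R),
    [/\ 0 < r, eball x r `<=` U &
        e = (((r `^ (s - m%:R))%:E *
              \int[lebesgue_rV R m]_(y in eball x r) (`|f y| `^ s)%:E)
             `^ s^-1)%E]].

Definition holder_on (R : realType) (m n : nat) (K : set 'rV[R]_m) (a : R)
    (v : 'rV[R]_m -> 'rV[R]_n) : Prop :=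
  exists C : R, forall x y, K x -> K y ->
    enorm (v x - v y) <= C * enorm (x - y) `^ a.

Definition locally_holder (R : realType) (m n : nat) (U : set 'rV[R]_m)
    (u : 'rV[R]_m -> 'rV[R]_n) : Prop :=
  exists v : 'rV[R]_m -> 'rV[R]_n,
    {ae lebesgue_rV R m, forall x, U x -> u x = v x} /\
    forall K : set 'rV[R]_m, compact K -> K `<=` U ->
      exists a : R, [/\ 0 < a, a < 1 & holder_on K a v].

(* Main.v *)
Require Import Defs.
From mathcomp Require Import all_boot all_order all_algebra.
From mathcomp Require Import all_classical all_reals all_analysis.
From mathcomp Require Import measurable_realfun ring lra.
Set Implicit Arguments.
Unset Strict Implicit.
Unset Printing Implicit Defensive.
Import Order.TTheory GRing.Theory Num.Theory.
Import numFieldNormedType.Exports.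
Local Open Scope classical_set_scope.
Local Open Scope ring_scope.

(** By Campanato's characterisation ([campanato], [ae_repr]) it suffices that the
    mean oscillation [osc x r u] of the solution over the cube of centre [x] and
    half-side [r] is bounded by a power of [r], uniformly for [x] in a compact
    part of the ball.

    The basic estimate is [osc_decay]: if [Laplacian u = div G] weakly on a cube
    of half-side [rho], then

      [osc a (th * rho) u <= C th (osc a rho u)
                             + C th^(-m) rho^(1 - m) (integral of |G|)],

    so that only the [L^1] norm of [G] matters. It is obtained without solving any
    equation. Let [M_s u] be the average of [u] against a radial kernel of width
    [s]. The derivative of the kernel in [s] is [s^(1 - m)] times the Laplacian of
    a compactly supported function ([is_derive_kern]); hence [M_t u - M_(t/2) u]
    is bounded by [t^(1 - m)] times an integral of [|G|] ([moll_step]). Telescoping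
    over the dyadic scales controls [u - M_t u] in the mean ([moll_approx]), while
    [M_t u] itself is Lipschitz at scale [t].

    This is used twice. With [G = Du], the Morrey bound on [Du] makes the last
    term bounded, and iterating with [C th <= 1/2] shows that [u] has bounded mean
    oscillation at interior points ([gradient_bmo]). On the other hand, because
    [Omega] is divergence free, the system can be written with
    [G = - Omega (u - c)] for any constant vector [c] ([div_test_system]). Take
    for [c] the average of [u] over the cube, and let [b] bound the oscillation on
    all its subcubes. A function of bounded mean oscillation has moments of all
    orders (John-Nirenberg), so that Young's inequality for [p] and its conjugate
    exponent bounds the integral of [|Omega| |u - c|] by
    [C b rho^(m - 1)] times the Morrey norm of [Omega] ([jn_weighted],
    [system_osc_decay]). Choosing first [th] and then the smallness constant, the
    supremum of the oscillation over subcubes is halved each time the size is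
    multiplied by [th / 2] ([decay_iter]), which is decay like a power of the size
    ([powR_decay]). *)

(** * Cubes *)
Section cubes.
Context {R : realType} {m : nat}.
Implicit Types (a x y : 'rV[R]_m) (r s : R).
Local Notation mu := (lebesgue_rV R m).

(** Half-open, so that a cube is the disjoint union of its dyadic children. *)
Definition cube a r : set 'rV[R]_m :=
  [set y | forall i, `[a ord0 i - r, a ord0 i + r[%classic (y ord0 i)].

Lemma cubeP a r y :
  cube a r y <-> forall i, a ord0 i - r <= y ord0 i < a ord0 i + r.
Proof. by split=> H i; have := H i; rewrite /= in_itv. Qed.

Lemma measurable_cube a r : measurable (cube a r).
Proof. by apply: (@measurable_box R m (fun i => `[a ord0 i - r, a ord0 i + r[%classic)) => i; exact: measurable_itv. Qed.

Lemma lebesgue_cube a r : 0 < r -> mu (cube a r) = ((r *+ 2) ^+ m)%:E.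
Proof.
move=> r0; rewrite (@lebesgue_rV_box R m (fun i => `[a ord0 i - r, a ord0 i + r[%classic)); last by move=> i; exact: measurable_itv.
rewrite (eq_bigr (fun=> (r *+ 2)%:E)).
  by rewrite prodEFin prodr_const card_ord.
move=> i _; rewrite lebesgue_measure_itv /= lte_fin ifT; last by lra.
by rewrite -EFinB; congr EFin; lra.
Qed.

Lemma lebesgue_cube_lty a r : 0 < r -> (mu (cube a r) < +oo)%E.
Proof. by move=> r0; rewrite lebesgue_cube// ltry. Qed.

(** The roles of the centre and of the point are not symmetric: the centres of the
    cubes containing [y] form a product of intervals closed on the other side. *)
Lemma cube_centresE y s : [set x | cube x s y] =
  [set x | forall i, `]y ord0 i - s, y ord0 i + s]%classic (x ord0 i)].
Proof.
apply/seteqP; split => x /=.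
  by move=> /cubeP yx i; rewrite /= in_itv/=; have := yx i; lra.
by move=> yx; apply/cubeP => i; have := yx i; rewrite /= in_itv/=; lra.
Qed.

Lemma measurable_cube_centres y s : measurable [set x | cube x s y].
Proof.
rewrite cube_centresE.
by apply: (@measurable_box R m (fun i => `]y ord0 i - s, y ord0 i + s]%classic)) => i; exact: measurable_itv.
Qed.

Lemma lebesgue_cube_centres y s : 0 < s ->
  mu [set x | cube x s y] = ((s *+ 2) ^+ m)%:E.
Proof.
move=> s0; rewrite cube_centresE.
rewrite (@lebesgue_rV_box R m (fun i => `]y ord0 i - s, y ord0 i + s]%classic)); last by move=> i; exact: measurable_itv.
rewrite (eq_bigr (fun=> (s *+ 2)%:E)).
  by rewrite prodEFin prodr_const card_ord.
move=> i _; rewrite lebesgue_measure_itv /= lte_fin ifT; last by lra.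
by rewrite -EFinB; congr EFin; lra.
Qed.

(** Inclusion of cubes, as a system of inequalities open to linear arithmetic. *)
Definition subcube a' r' a r :=
  forall i : 'I_m, `|a ord0 i - a' ord0 i| + r' <= r.

Lemma subcube_sub a' r' a r : subcube a' r' a r -> cube a' r' `<=` cube a r.
Proof.
move=> s y /cubeP y1; apply/cubeP => i; have := s i; have := y1 i.
by have := ler_norm (a ord0 i - a' ord0 i); have := ler_norm (- (a ord0 i - a' ord0 i)); rewrite normrN; lra.
Qed.

Lemma subcube_trans a2 r2 a1 r1 a0 r0 :
  subcube a2 r2 a1 r1 -> subcube a1 r1 a0 r0 -> subcube a2 r2 a0 r0.
Proof.
move=> s1 s0 i; have := s1 i; have := s0 i.
have := ler_distD (a1 ord0 i) (a0 ord0 i) (a2 ord0 i); lra.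
Qed.

Lemma subcube_same a r' r : r' <= r -> subcube a r' a r.
Proof. by move=> h i; rewrite subrr normr0 add0r. Qed.

Lemma cube_subcube x a r s : cube a r x -> subcube x s a (r + s).
Proof.
move=> /cubeP xa i; have := xa i; rewrite lerD2r ler_norml; lra.
Qed.

(** * Dyadic children *)
Definition child a r (s : {ffun 'I_m -> bool}) : 'rV[R]_m :=
  \row_i (a ord0 i + (if s i then r / 2 else - (r / 2))).

Lemma subcube_child a r b : 0 < r -> subcube (child a r b) (r / 2) a r.
Proof.
move=> r0 i; rewrite mxE opprD addrA subrr add0r normrN.
by case: (b i); rewrite ?normrN ger0_norm; lra.
Qed.

Lemma cube_children a r : 0 < r -> cube a r =
  \big[setU/set0]_(b : {ffun 'I_m -> bool}) cube (child a r b) (r / 2).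
Proof.
move=> r0; rewrite -bigcup_seq; apply/seteqP; split => y.
  move=> /cubeP ya; exists [ffun i => a ord0 i <= y ord0 i].
    by rewrite /= mem_index_enum.
  apply/cubeP => i; rewrite mxE ffunE; have := ya i.
  by case: ifPn; rewrite -?ltNge; lra.
by move=> [b _]; apply: subcube_sub; exact: subcube_child.
Qed.

Lemma trivIset_children a r : 0 < r ->
  trivIset [set` index_enum {ffun 'I_m -> bool}]
    (fun b => cube (child a r b) (r / 2)).
Proof.
move=> r0 b c _ _ [y [/cubeP yb /cubeP yc]]; apply/ffunP => i.
have := yb i; have := yc i; rewrite !mxE.
by case: (b i); case: (c i) => //; lra.
Qed.

Lemma integral_children a r (f : 'rV[R]_m -> \bar R) : 0 < r ->
  measurable_fun (cube a r) f -> (forall x, cube a r x -> (0 <= f x)%E) ->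
  (\int[mu]_(x in cube a r) f x =
   \sum_(b : {ffun 'I_m -> bool}) \int[mu]_(x in cube (child a r b) (r / 2)) f x)%E.
Proof.
move=> r0 mf f0; rewrite cube_children//.
apply: (@ge0_integral_bigsetU _ _ _ mu _ (fun b => cube (child a r b) (r / 2))).
- by move=> b; exact: measurable_cube.
- exact: index_enum_uniq.
- exact: trivIset_children.
- by rewrite -cube_children.
- by rewrite -cube_children.
Qed.

Lemma Rintegral_children a r (f : 'rV[R]_m -> R) : 0 < r ->
  mu.-integrable (cube a r) (EFin \o f) ->
  \int[mu]_(x in cube a r) f x =
   \sum_(b : {ffun 'I_m -> bool}) \int[mu]_(x in cube (child a r b) (r / 2)) f x.
Proof.
move=> r0 intf; rewrite /Rintegral.
rewrite [X in fine X](_ : _ =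
  (\sum_(b : {ffun 'I_m -> bool}) \int[mu]_(x in cube (child a r b) (r / 2)) (f x)%:E)%E).
  rewrite sum_fine// => b _; apply: integrable_fin_num => //.
    exact: measurable_cube.
  apply: integrableS intf => //; try exact: measurable_cube.
  by apply: subcube_sub; exact: subcube_child.
rewrite {1}cube_children//.
apply: (@integral_bigsetU_EFin _ _ _ mu _ (fun b => cube (child a r b) (r / 2))).
- by move=> b; exact: measurable_cube.
- exact: index_enum_uniq.
- exact: trivIset_children.
- by rewrite -cube_children//; exact: measurable_int intf.
Qed.

End cubes.

(** * Affine invariance *)
Section affine_map.
Context {R : realType}.

Definition affine1 (t x : R) (y : measurableTypeR R) : measurableTypeR R := (y - x) / t.

Lemma measurable_affine1 t x : measurable_fun setT (affine1 t x).
Proof. by apply: measurable_funM => //; exact: measurable_funB. Qed.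

Variable m : nat.
Definition affine (t : R) (x y : 'rV[R]_m) : 'rV[R]_m := t^-1 *: (y - x).

Lemma measurable_affine t x : measurable_fun setT (affine t x).
Proof.
apply/measurable_fun_rVP => i; rewrite /affine; under eq_fun do rewrite !mxE.
by apply: measurable_funM => //; apply: measurable_funB => //; exact: measurable_coord.
Qed.

End affine_map.

Section affine.
Context {R : realType}.

Lemma lebesgue_measure_affine (t x : R) (A : set R) : 0 < t -> measurable A ->
  (lebesgue_measure (affine1 t x @^-1` A) = t%:E * lebesgue_measure A)%E.
Proof.
move=> t0 mA.
have t0' : 0 <= t^-1 by rewrite invr_ge0 ltW.
have lt0 u v : (x + t * u < x + t * v) = (u < v) by rewrite ltrD2l ltr_pM2l.
pose nu0 := mscale (NngNum t0') (pushforward (@lebesgue_measure R) (affine1 t x)).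
pose nu := nu0 (measurable_affine1 t x).
have -> : lebesgue_measure A = nu A.
  apply: (@lebesgue_measure_unique R nu) => // X [[u v] /= uv <-].
  rewrite /nu /nu0 /mscale /pushforward/=.
  transitivity ((t^-1)%:E * lebesgue_measure (`](x + t * u)%R, (x + t * v)%R]%classic : set R))%E; last first.
    congr (_ * lebesgue_measure _)%E.
    apply/seteqP; split => y; rewrite /affine1/= !in_itv/= ltr_pdivlMr// ler_pdivrMr//; lra.
  rewrite !lebesgue_measure_itv/= !lte_fin lt0; case: ifPn => _; last by rewrite mule0.
  by rewrite -!EFinD -EFinM; congr EFin; field; exact: lt0r_neq0.
rewrite /nu /nu0 /mscale /pushforward/= muleA -EFinM divff ?mul1e//.
exact: lt0r_neq0.
Qed.

Variable m : nat.
Local Notation V := 'rV[R]_m.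
Local Notation mu := (lebesgue_rV R m).

Definition boxes : set (set V) := [set B : set V | exists A : 'I_m -> set R,
  (forall i, measurable (A i)) /\ B = [set x : V | forall i, A i (x ord0 i)]].

Lemma measurable_boxes (A : set V) : measurable A -> <<s boxes >> A.
Proof.
apply: smallest_sub; first exact: smallest_sigma_algebra.
rewrite -bigcup_seq => _ /= [i _ [B mB <-]]; rewrite setTI.
apply: sub_sigma_algebra; exists (fun j => if j == i then B else setT); split.
  by move=> j; case: ifPn.
apply/seteqP; split => x /=; last by move/(_ i); rewrite eqxx.
by move=> Bx j; case: ifPn => // /eqP ->.
Qed.

(** As functions of [A] both sides are measures. They agree on boxes, by the
    one-dimensional case, and the boxes generate the sigma-algebra. *)
Lemma lebesgue_affine (t : R) (x : V) (A : set V) : 0 < t -> measurable A ->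
  (mu (affine t x @^-1` A) = (t ^+ m)%:E * mu A)%E.
Proof.
move=> t0 mA.
have t0' : 0 <= t ^- m by rewrite invr_ge0 exprn_ge0// ltW.
pose nu0 := mscale (NngNum t0') (pushforward mu (affine t x)).
pose nu := nu0 (measurable_affine t x).
suff -> : mu A = nu A.
  rewrite /nu /nu0 /mscale /pushforward/= muleA -EFinM divff ?mul1e//.
  by rewrite expf_neq0// lt0r_neq0.
apply: (@g_sigma_algebra_measure_unique _ R _ boxes _ (fun k => cube 0 k.+1%:R) _ _ mu nu).
- by move=> _ [B [mB ->]]; exact: measurable_box.
- move=> k; exists (fun i => `[(0:V) ord0 i - k.+1%:R, (0:V) ord0 i + k.+1%:R[%classic).
  by split => // i; exact: measurable_itv.
- rewrite -subTset => y _.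
  have [k yk] : exists k : nat, forall i, `|y ord0 i| < k%:R.
    exists (Num.truncn (\sum_i `|y ord0 i|)).+1 => i.
    apply: le_lt_trans (truncnS_gt _).
    by rewrite (bigD1 i)//= lerDl sumr_ge0.
  exists k => //; apply/cubeP => i; rewrite mxE.
  have := yk i; rewrite ltr_norml -natr1; lra.
- move=> _ _ [A1 [mA1 ->]] [A2 [mA2 ->]]; exists (fun i => A1 i `&` A2 i); split.
    by move=> i; exact: measurableI.
  apply/seteqP; split => y /=; last by move=> h; split => i; case: (h i).
  by move=> [h1 h2] i; split.
- move=> _ [B [mB ->]]; apply: etrans (lebesgue_rV_box mB) _.
  have mB' i : measurable (affine1 t (x ord0 i) @^-1` B i).
    rewrite -[X in measurable X]setTI.
    exact: (@measurable_affine1 R t (x ord0 i) measurableT (B i) (mB i)).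
  have E : affine t x @^-1` [set y : V | forall i, B i (y ord0 i)] =
      [set y : V | forall i, (affine1 t (x ord0 i) @^-1` B i) (y ord0 i)].
    by apply/seteqP; split => y /= h i; have := h i; rewrite /affine /affine1 !mxE mulrC.
  transitivity ((t ^- m)%:E * mu (affine t x @^-1` [set y : V | forall i, B i (y ord0 i)]))%E; last by [].
  rewrite E; apply: esym; apply: etrans (congr1 (mule _) (lebesgue_rV_box mB')) _.
  apply: esym.
  under [in RHS]eq_bigr do rewrite lebesgue_measure_affine//.
  rewrite big_split/= prodEFin prodr_const card_ord muleA -EFinM.
  by rewrite mulVf ?mul1e// expf_neq0// lt0r_neq0.
- by move=> k; rewrite lebesgue_cube_lty.
- exact: measurable_boxes.
Qed.

Lemma integral_affine (t : R) (x : V) (f : V -> \bar R) : 0 < t ->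
  measurable_fun setT f -> (forall y, 0 <= f y)%E ->
  (\int[mu]_y f (affine t x y) = (t ^+ m)%:E * \int[mu]_y f y)%E.
Proof.
move=> t0 mf f0.
have t0' : 0 <= t ^+ m by rewrite exprn_ge0// ltW.
transitivity (\int[pushforward mu (affine t x)]_y f y)%E.
  by rewrite ge0_integral_pushforward//; exact: measurable_affine.
rewrite -(@ge0_integral_mscale _ _ _ mu _ measurableT (NngNum t0'))//.
apply: eq_measure_integral => [|mA A mA' _]; first exact: measurable_affine.
exact: (lebesgue_affine x t0 mA').
Qed.

End affine.

(** * Euclidean norm *)
Section enorm_theory.
Context {R : realType}.

(** With [A], [B], [C] the sums of the [a_i^2], [b_i^2] and [a_i b_i], the number
    [B (A B - C^2)] is the sum of the squares of the [a_i B - b_i C]. *)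
Lemma cauchy_schwarz (I : finType) (a b : I -> R) :
  \sum_i a i * b i <= Num.sqrt (\sum_i a i ^+ 2) * Num.sqrt (\sum_i b i ^+ 2).
Proof.
set A := \sum_i a i ^+ 2; set B := \sum_i b i ^+ 2; set C := \sum_i _.
have A0 : 0 <= A by apply: sumr_ge0 => i _; exact: sqr_ge0.
have B0 : 0 <= B by apply: sumr_ge0 => i _; exact: sqr_ge0.
rewrite -sqrtrM//; apply: le_trans (ler_norm _) _.
rewrite -sqrtr_sqr ler_sqrt ?mulr_ge0//.
have [B00|Bn0] := eqVneq B 0.
  have b0 i : b i = 0.
    apply/eqP; rewrite -sqrf_eq0; apply/eqP.
    by apply: (psumr_eq0P _ B00) => // j _; exact: sqr_ge0.
  rewrite (_ : C = 0) ?expr0n/= ?mulr_ge0//.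
  by apply: big1 => i _; rewrite b0 mulr0.
have Bp : 0 < B by rewrite lt_def Bn0.
have : 0 <= \sum_i (a i * B - b i * C) ^+ 2 by apply: sumr_ge0 => i _; exact: sqr_ge0.
have -> : \sum_i (a i * B - b i * C) ^+ 2 = B * (A * B - C ^+ 2).
  transitivity (A * B ^+ 2 + B * C ^+ 2 - C * (2 * B * C)); last by ring.
  rewrite [A * _]mulr_suml [B * C ^+ 2]mulr_suml [C * _]mulr_suml -big_split/= -sumrB.
  by apply: eq_bigr => i _; ring.
by rewrite pmulr_rge0// subr_ge0.
Qed.

Context {n : nat}.
Implicit Types x y z : 'rV[R]_n.

Lemma enorm_ge0 x : 0 <= enorm x. Proof. exact: sqrtr_ge0. Qed.

Lemma enorm_sqr x : enorm x ^+ 2 = \sum_i x ord0 i ^+ 2.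
Proof. by rewrite sqr_sqrtr// sumr_ge0// => i _; exact: sqr_ge0. Qed.

Lemma dot_le x y : \sum_i x ord0 i * y ord0 i <= enorm x * enorm y.
Proof. exact: cauchy_schwarz. Qed.

Lemma enormN x : enorm (- x) = enorm x.
Proof. by rewrite /enorm; congr Num.sqrt; apply: eq_bigr => i _; rewrite mxE sqrrN. Qed.

Lemma enormB x y : enorm (x - y) = enorm (y - x).
Proof. by rewrite -enormN opprB. Qed.

Lemma enorm0 : enorm (0 : 'rV[R]_n) = 0.
Proof. by rewrite /enorm big1 ?sqrtr0// => i _; rewrite mxE expr0n. Qed.

Lemma enormZ c x : enorm (c *: x) = `|c| * enorm x.
Proof.
rewrite /enorm -sqrtr_sqr -sqrtrM ?sqr_ge0//; congr Num.sqrt.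
by rewrite mulr_sumr; apply: eq_bigr => i _; rewrite mxE exprMn.
Qed.

Lemma enormD x y : enorm (x + y) <= enorm x + enorm y.
Proof.
rewrite -(@ler_pXn2r _ 2)// ?nnegrE ?addr_ge0 ?enorm_ge0//.
have -> : enorm (x + y) ^+ 2 =
    enorm x ^+ 2 + 2 * (\sum_i x ord0 i * y ord0 i) + enorm y ^+ 2.
  rewrite !enorm_sqr mulr_sumr -!big_split/=.
  by apply: eq_bigr => i _; rewrite mxE; ring.
by have := dot_le x y; rewrite sqrrD -mulr_natl; lra.
Qed.

Lemma enorm_distD y x z : enorm (x - z) <= enorm (x - y) + enorm (y - z).
Proof. by apply: le_trans (enormD _ _); rewrite addrA subrK. Qed.

Lemma coord_le_enorm x i : `|x ord0 i| <= enorm x.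
Proof.
rewrite /enorm -sqrtr_sqr ler_sqrt; last by apply: sumr_ge0 => j _; exact: sqr_ge0.
by rewrite (bigD1 i)//= lerDl; apply: sumr_ge0 => j _; exact: sqr_ge0.
Qed.

Lemma enorm_le_sum x : enorm x <= \sum_i `|x ord0 i|.
Proof.
have s0 : 0 <= \sum_i `|x ord0 i| by apply: sumr_ge0.
rewrite -(@ler_pXn2r _ 2)// ?nnegrE ?enorm_ge0// enorm_sqr expr2 mulr_suml.
apply: ler_sum => i _; rewrite -real_normK ?num_real// expr2 ler_wpM2l//.
by rewrite (bigD1 i)//= lerDl; apply: sumr_ge0.
Qed.

Lemma measurable_enorm d (T : measurableType d) (D : set T) (f : T -> 'rV[R]_n) :
  (forall i, measurable_fun D (fun w => f w ord0 i)) ->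
  measurable_fun D (fun w => enorm (f w)).
Proof.
move=> mf.
have ms : measurable_fun [set: R] (@Num.sqrt R).
  by apply: continuous_measurable_fun; exact: sqrt_continuous.
have mg : measurable_fun D (fun w => \sum_i f w ord0 i ^+ 2).
  by apply: measurable_sum => i; exact: measurable_funX.
exact: (measurableT_comp ms mg).
Qed.

End enorm_theory.

(** * Averaging over moving cubes *)
Section moving_cubes.
Context {R : realType} {m : nat}.
Local Notation V := 'rV[R]_m.
Local Notation mu := (lebesgue_rV R m).
Local Open Scope ereal_scope.

Lemma measurable_cube_pairs (s : R) : measurable [set z : V * V | cube z.1 s z.2].
Proof.
rewrite (_ : [set z : V * V | cube z.1 s z.2] = \bigcap_(i in [set: 'I_m])
  [set z : V * V | `[(- s)%R, s[%classic (z.2 ord0 i - z.1 ord0 i)%R]).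
  apply: fin_bigcap_measurable => // i _; rewrite -[X in measurable X]setTI.
  have mc : measurable_fun [set: V * V] (fun z : V * V => z.2 ord0 i - z.1 ord0 i)%R.
    apply: measurable_funB.
      exact: (measurableT_comp (measurable_coord i) measurable_snd).
    exact: (measurableT_comp (measurable_coord i) measurable_fst).
  exact: (mc measurableT _ (measurable_itv _)).
apply/seteqP; split => z /=.
  by move=> /cubeP zc i _; rewrite /= in_itv/=; have := zc i; lra.
by move=> zc; apply/cubeP => i; have := zc i I; rewrite /= in_itv/=; lra.
Qed.

Lemma integral_cube_pairs (s : R) (f : V * V -> \bar R) (x : V) :
  \int[mu]_(y in cube x s) f (x, y) =
  \int[mu]_y (f \_ [set z : V * V | cube z.1 s z.2]) (x, y).
Proof.
rewrite integral_mkcond; apply: eq_integral => y _.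
by rewrite /patch; congr (if _ then _ else _); apply/idP/idP; rewrite !inE.
Qed.

Lemma measurable_integral_cube (s : R) (f : V * V -> \bar R) :
  measurable_fun setT f -> (forall z, 0 <= f z) ->
  measurable_fun setT (fun x => \int[mu]_(y in cube x s) f (x, y)).
Proof.
move=> mf f0; under eq_fun do rewrite integral_cube_pairs.
apply: (@measurable_fun_fubini_tonelli_F _ _ _ _ _ mu
  (f \_ [set z : V * V | cube z.1 s z.2])).
  exact: ((measurable_restrictT _ (measurable_cube_pairs s)).1 (measurable_funTS mf)).
by move=> z; rewrite /patch; case: ifP.
Qed.

(** Tonelli's theorem: the centres whose cube of half-side [s] contains a given [y]
    form a set of measure [(2 s)^m]. *)
Lemma integral_moving_cube (s : R) (A B : set V) (g : V -> \bar R) :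
  (0 < s)%R -> measurable A -> measurable B ->
  (forall x, A x -> cube x s `<=` B) ->
  measurable_fun setT g -> (forall y, 0 <= g y) ->
  \int[mu]_(x in A) \int[mu]_(y in cube x s) g y <=
  ((s *+ 2) ^+ m)%:E * \int[mu]_(y in B) g y.
Proof.
move=> s0 mA mB AB mg g0.
pose P := [set z : V * V | cube z.1 s z.2].
have mP : measurable P := measurable_cube_pairs s.
pose h (z : V * V) := ((fun z => g z.2) \_ ((A `*` setT) `&` P)) z.
have mAP : measurable ((A `*` setT) `&` P).
  by apply: measurableI => //; exact: measurableX.
have mg2 : measurable_fun [set: V * V] (fun z => g z.2).
  exact: (measurableT_comp mg measurable_snd).
have mh : measurable_fun setT h.
  exact: ((measurable_restrictT _ mAP).1 (measurable_funTS mg2)).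
have h0 z : 0 <= h z by rewrite /h /patch; case: ifP.
have -> : \int[mu]_(x in A) \int[mu]_(y in cube x s) g y =
    \int[mu]_x \int[mu]_y h (x, y).
  rewrite integral_mkcond; apply: eq_integral => x _.
  rewrite /patch; case: ifPn => [|] xA.
    rewrite integral_mkcond; apply: eq_integral => y _; rewrite /h /patch.
    congr (if _ then _ else _); apply/idP/idP; rewrite !inE.
      by move=> ?; split=> //; split => //; rewrite inE in xA.
    by move=> [].
  rewrite integral0_eq// => y _; rewrite /h /patch ifF//; apply/negP.
  by rewrite inE => -[[/= Ax _] _]; move: xA; rewrite notin_setE; apply.
rewrite (@fubini_tonelli _ _ _ _ _ mu mu)//.
rewrite (integral_mkcond B) -ge0_integralZl//; last 3 first.
- exact: ((measurable_restrictT _ mB).1 (measurable_funTS mg)).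
- by move=> y _; rewrite /patch; case: ifP.
- by rewrite lee_fin exprn_ge0// mulrn_wge0// ltW.
apply: ge0_le_integral => //.
- by move=> y _; exact: integral_ge0.
- exact: (@measurable_fun_fubini_tonelli_G _ _ _ _ _ mu).
- apply: measurable_funeM.
  exact: ((measurable_restrictT _ mB).1 (measurable_funTS mg)).
move=> y _.
have cP : measurable [set x | cube x s y] := measurable_cube_centres y s.
have -> : \int[mu]_x h (x, y) = \int[mu]_(x in A `&` [set x | cube x s y]) g y.
  rewrite [RHS]integral_mkcond; apply: eq_integral => x _; rewrite /h /patch.
  congr (if _ then _ else _); apply/idP/idP; rewrite !inE.
    by move=> [[/= ? _] ?].
  by move=> [? ?].
have [By|nBy] := pselect (B y); last first.
  rewrite (_ : _ `&` _ = set0) ?integral_set0; last first.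
    by apply/seteqP; split => // x [/= Ax xy]; apply: nBy; exact: AB xy.
  by rewrite mule_ge0// /patch; [rewrite lee_fin exprn_ge0// mulrn_wge0// ltW|case: ifP].
rewrite /patch mem_set//.
rewrite integral_cst; last exact: measurableI.
rewrite muleC lee_wpmul2r// -(lebesgue_cube_centres y s0).
by apply: le_measure; rewrite ?inE//; exact: measurableI.
Qed.

Lemma integral_cube_cst (x : V) (s : R) (c : \bar R) : (0 < s)%R ->
  \int[mu]_(y in cube x s) c = c * ((s *+ 2) ^+ m)%:E.
Proof.
move=> s0; rewrite integral_cst; last exact: measurable_cube.
exact: (congr1 (mule _) (lebesgue_cube x s0)).
Qed.
End moving_cubes.

(** * Continuity of the mean in L^1 *)
Section pair_oscillation.
Context {R : realType} {m : nat}.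
Local Notation V := 'rV[R]_m.
Local Notation mu := (lebesgue_rV R m).
Implicit Types (D : V -> V -> R) (f g : V -> R) (A : set V).

Definition pairint D (s : R) A : \bar R :=
  (\int[mu]_(x in A) \int[mu]_(y in cube x s) (D x y)%:E)%E.

Definition pair_weight D : Prop :=
  measurable_fun [set: V * V] (fun z => D z.1 z.2) /\ forall x y, 0 <= D x y.

(** The mean of [D x y] over the [y] at distance at most [s] from [x] tends to [0]
    in local [L^1] as [s] tends to [0]. *)
Definition vanishing D : Prop := forall (a : V) (r e : R), 0 < r -> 0 < e ->
  exists d : R, 0 < d /\ forall s, 0 < s -> s < d ->
    (pairint D s (cube a r) <= (e * (s *+ 2) ^+ m)%:E)%E.

Definition adist f : V -> V -> R := fun x y => `|f x - f y|.

Lemma adist_weight f : measurable_fun setT f -> pair_weight (adist f).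
Proof.
move=> mf; split=> [|x y]; last exact: normr_ge0.
apply: measurableT_comp => //; apply: measurable_funB.
  exact: (measurableT_comp mf measurable_fst).
exact: (measurableT_comp mf measurable_snd).
Qed.

Lemma weightD D1 D2 : pair_weight D1 -> pair_weight D2 ->
  pair_weight (fun x y => D1 x y + D2 x y).
Proof.
by move=> [m1 p1] [m2 p2]; split=> [|x y]; [exact: measurable_funD|rewrite addr_ge0].
Qed.

Lemma weightZ (c : R) D : 0 <= c -> pair_weight D -> pair_weight (fun x y => c * D x y).
Proof.
by move=> c0 [m1 p1]; split=> [|x y]; [exact: measurable_funM|rewrite mulr_ge0].
Qed.

Lemma weight_xm D x : pair_weight D -> measurable_fun setT (fun y => (D x y)%:E).
Proof.
move=> [mD _]; apply/measurable_EFinP.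
exact: (measurableT_comp mD (pair1_measurable x)).
Qed.

Lemma measurable_inner D s : pair_weight D ->
  measurable_fun setT (fun x => \int[mu]_(y in cube x s) (D x y)%:E)%E.
Proof.
move=> [mD D0]; apply: (@measurable_integral_cube _ _ s (fun z => (D z.1 z.2)%:E)).
  exact/measurable_EFinP.
by move=> z; rewrite lee_fin.
Qed.

Lemma pairint_ge0 D s A : pair_weight D -> (0 <= pairint D s A)%E.
Proof.
by move=> [_ D0]; apply: integral_ge0 => x _; apply: integral_ge0 => y _; rewrite lee_fin.
Qed.

Lemma le_pairint D1 D2 s A : measurable A -> pair_weight D1 -> pair_weight D2 ->
  (forall x y, D1 x y <= D2 x y) -> (pairint D1 s A <= pairint D2 s A)%E.
Proof.
move=> mA w1 w2 D12; apply: ge0_le_integral => //.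
- by move=> x _; apply: integral_ge0 => y _; rewrite lee_fin; case: w1.
- by apply: measurable_funTS; exact: measurable_inner.
- by apply: measurable_funTS; exact: measurable_inner.
move=> x _; apply: ge0_le_integral => //.
- exact: measurable_cube.
- by move=> y _; rewrite lee_fin; case: w1.
- by apply: measurable_funTS; exact: weight_xm.
- by apply: measurable_funTS; exact: weight_xm.
- by move=> y _; rewrite lee_fin.
Qed.

Lemma pairintD D1 D2 s A : measurable A -> pair_weight D1 -> pair_weight D2 ->
  (pairint (fun x y => D1 x y + D2 x y)%R s A = pairint D1 s A + pairint D2 s A)%E.
Proof.
move=> mA w1 w2; rewrite /pairint -ge0_integralD//; last 4 first.
- by move=> x _; apply: integral_ge0 => y _; rewrite lee_fin; case: w1.
- by apply: measurable_funTS; exact: measurable_inner.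
- by move=> x _; apply: integral_ge0 => y _; rewrite lee_fin; case: w2.
- by apply: measurable_funTS; exact: measurable_inner.
apply: eq_integral => x _; rewrite -ge0_integralD//.
- exact: measurable_cube.
- by move=> y _; rewrite lee_fin; case: w1.
- by apply: measurable_funTS; exact: weight_xm.
- by move=> y _; rewrite lee_fin; case: w2.
- by apply: measurable_funTS; exact: weight_xm.
Qed.

Lemma pairintZ (c : R) D s A : 0 <= c -> measurable A -> pair_weight D ->
  (pairint (fun x y => c * D x y)%R s A = c%:E * pairint D s A)%E.
Proof.
move=> c0 mA w1; rewrite /pairint -ge0_integralZl//; last 2 first.
- by apply: measurable_funTS; exact: measurable_inner.
- by move=> x _; apply: integral_ge0 => y _; rewrite lee_fin; case: w1.
apply: eq_integral => x _; rewrite -ge0_integralZl//.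
- exact: measurable_cube.
- by apply: measurable_funTS; exact: weight_xm.
- by move=> y _; rewrite lee_fin; case: w1.
Qed.

Lemma vanishingS D1 D2 : pair_weight D1 -> pair_weight D2 ->
  (forall x y, D1 x y <= D2 x y) -> vanishing D2 -> vanishing D1.
Proof.
move=> w1 w2 D12 v a r e r0 e0; have [d [d0 h]] := v a r e r0 e0.
exists d; split=> // s s0 sd; apply: le_trans (h s s0 sd).
by apply: le_pairint => //; exact: measurable_cube.
Qed.

Lemma vanishingD D1 D2 : pair_weight D1 -> pair_weight D2 ->
  vanishing D1 -> vanishing D2 -> vanishing (fun x y => D1 x y + D2 x y).
Proof.
move=> w1 w2 v1 v2 a r e r0 e0; have e20 : 0 < e / 2 by rewrite divr_gt0.
have [d1 [d10 h1]] := v1 a r _ r0 e20; have [d2 [d20 h2]] := v2 a r _ r0 e20.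
exists (Num.min d1 d2); split=> [|s s0]; first by rewrite lt_min d10.
rewrite lt_min => /andP[sd1 sd2].
rewrite pairintD//; last exact: measurable_cube.
apply: le_trans (leeD (h1 s s0 sd1) (h2 s s0 sd2)) _.
by rewrite -EFinD lee_fin -mulrDl -splitr.
Qed.

Lemma vanishingZ (c : R) D : 0 <= c -> pair_weight D ->
  vanishing D -> vanishing (fun x y => c * D x y).
Proof.
move=> c0 w v a r e r0 e0.
have c1 : 0 < c + 1 by lra.
have ec0 : 0 < e / (c + 1) by rewrite divr_gt0.
have [d [d0 h]] := v a r _ r0 ec0; exists d; split=> // s s0 sd.
rewrite pairintZ//; last exact: measurable_cube.
apply: le_trans (lee_pmul _ _ (lexx _) (h s s0 sd)) _ => //; rewrite ?lee_fin//.
  exact: pairint_ge0.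
rewrite mulrA ler_wpM2r ?exprn_ge0 ?mulrn_wge0 ?(ltW s0)//.
by rewrite mulrCA ger_pMr// ler_pdivrMr//; lra.
Qed.

Lemma vanishing0 : vanishing (fun _ _ => 0).
Proof.
move=> a r e r0 e0; exists 1; split=> // s s0 _.
rewrite /pairint integral0_eq; last by move=> x _; rewrite integral0_eq.
by rewrite lee_fin mulr_ge0 ?exprn_ge0 ?mulrn_wge0 ?(ltW s0) ?(ltW e0).
Qed.

Lemma vanishing_sum (I : Type) (l : seq I) (D : I -> V -> V -> R) :
  (forall i, pair_weight (D i)) -> (forall i, vanishing (D i)) ->
  pair_weight (fun x y => \sum_(i <- l) D i x y) /\
  vanishing (fun x y => \sum_(i <- l) D i x y).
Proof.
move=> w v; elim: l => [|i l [IHw IHv]].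
  have -> : (fun x y => \sum_(i <- [::]) D i x y) = (fun _ _ => 0).
    by apply/funext => x; apply/funext => y; rewrite big_nil.
  by split; [split|exact: vanishing0].
have -> : (fun x y => \sum_(i <- i :: l) D i x y) =
    (fun x y => D i x y + \sum_(i <- l) D i x y).
  by apply/funext => x; apply/funext => y; rewrite big_cons.
by split; [exact: weightD|exact: vanishingD].
Qed.

(** Averaging contracts [L^1]; functions of small norm therefore have a small
    contribution at every scale. *)
Lemma pairint_le_norm (h : V -> R) s a r : measurable_fun setT h -> 0 < s ->
  (pairint (adist h) s (cube a r) <=
   ((s *+ 2) ^+ m)%:E * (2%:E * \int[mu]_(x in cube a (r + s)) `|h x|%:E))%E.
Proof.
move=> mh s0.
have mn : measurable_fun setT (fun y => `|h y|).
  by apply: measurableT_comp.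
have w1 : pair_weight (fun x (_ : V) => `|h x|).
  by split=> [|x _]; [exact: (measurableT_comp mn measurable_fst)|].
have w2 : pair_weight (fun (_ : V) y => `|h y|).
  by split=> [|_ x]; [exact: (measurableT_comp mn measurable_snd)|].
have sub : cube a r `<=` cube a (r + s).
  by apply/subcube_sub/subcube_same; lra.
have s20 : 0 <= (s *+ 2) ^+ m by rewrite exprn_ge0// mulrn_wge0// ltW.
apply: (@le_trans _ _ (pairint (fun x y => `|h x| + `|h y|)%R s (cube a r))).
  apply: le_pairint => //; [exact: measurable_cube|exact: adist_weight|exact: weightD|].
  by move=> x y; exact: ler_normB.
rewrite pairintD//; last exact: measurable_cube.
have -> : (2%:E * \int[mu]_(x in cube a (r + s)%R) `|h x|%:E =
  \int[mu]_(x in cube a (r + s)%R) `|h x|%:E + \int[mu]_(x in cube a (r + s)%R) `|h x|%:E)%E.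
  by rewrite mule_natl mule2n.
rewrite ge0_muleDr ?integral_ge0//; apply: leeD; last first.
  apply: integral_moving_cube => //; try exact: measurable_cube.
    by move=> x /cube_subcube h1; apply: subcube_sub.
  exact/measurable_EFinP.
rewrite /pairint; under eq_integral do rewrite integral_cube_cst// muleC.
rewrite ge0_integralZl//; last 2 first.
- exact: measurable_cube.
- by apply/measurable_EFinP; exact: measurable_funTS.
rewrite lee_wpmul2l// ge0_subset_integral//; try exact: measurable_cube.
by apply/measurable_EFinP; exact: measurable_funTS.
Qed.

(** Closure under local [L^1] approximation, by [pairint_le_norm]. *)
Lemma vanishing_approx f : measurable_fun setT f ->
  (forall a r e, 0 < r -> 0 < e -> exists g, [/\ measurable_fun setT g,
    vanishing (adist g) & (\int[mu]_(x in cube a r) `|f x - g x|%:E <= e%:E)%E]) ->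
  vanishing (adist f).
Proof.
move=> mf H a r e r0 e0.
have r10 : 0 < r + 1 by lra.
have e40 : 0 < e / 4 by lra.
have e20 : 0 < e / 2 by lra.
have [g [mg vg fg]] := H a (r + 1) (e / 4) r10 e40.
have [d [d0 h]] := vg a r (e / 2) r0 e20.
exists (Num.min d 1); split=> [|s s0]; first by rewrite lt_min d0 /=.
rewrite lt_min => /andP[sd s1].
have mfg : measurable_fun setT (fun x => f x - g x) by exact: measurable_funB.
apply: (@le_trans _ _ (pairint (fun x y => adist g x y + adist (fun x => f x - g x) x y)%R s (cube a r))).
  apply: le_pairint; [exact: measurable_cube|exact: adist_weight| |].
    by apply: weightD; exact: adist_weight.
  move=> x y; rewrite /adist; apply: le_trans (ler_normD _ _).
  by rewrite le_eqVlt (_ : f x - f y = g x - g y + (f x - g x - (f y - g y))) ?eqxx//; ring.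
rewrite pairintD; [|exact: measurable_cube|exact: adist_weight|exact: adist_weight].
apply: (@le_trans _ _ ((e / 2 * (s *+ 2) ^+ m)%:E + ((s *+ 2) ^+ m)%:E * (2%:E * (e / 4)%:E))%E); last first.
  by rewrite -!EFinM -EFinD lee_fin; lra.
apply: leeD; first exact: h.
apply: le_trans (pairint_le_norm _ _ mfg s0) _.
rewrite lee_wpmul2l ?lee_fin ?exprn_ge0 ?mulrn_wge0 ?(ltW s0)// lee_wpmul2l ?lee_fin//.
apply: le_trans fg; apply: ge0_subset_integral; try exact: measurable_cube.
- by apply/measurable_EFinP/measurable_funTS; exact: measurableT_comp.
- by [].
by apply/subcube_sub/subcube_same; lra.
Qed.

End pair_oscillation.

Section L1_vanishing.
Context {R : realType} {m : nat}.
Local Notation V := 'rV[R]_m.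
Local Notation mu := (lebesgue_rV R m).
Implicit Types (f g : V -> R) (A : set V).

Definition vanishing_set A := measurable A /\ vanishing (adist (\1_A : V -> R)).

Lemma indic_dist01 A (x y : V) : `|\1_A x - \1_A y : R| <= 1.
Proof.
rewrite !indicE; case: (x \in A); case: (y \in A); rewrite ?subrr ?subr0 ?sub0r ?normrN ?normr0 ?normr1 //.
Qed.

Lemma vanishing_setC A : vanishing_set A -> vanishing_set (~` A).
Proof.
move=> [mA vA]; split; first exact: measurableC.
rewrite (_ : adist _ = adist (\1_A : V -> R))//.
apply/funext => x; apply/funext => y; rewrite /adist !indicE !in_setC.
by case: (x \in A); case: (y \in A) => //=; rewrite ?subrr ?subr0 ?sub0r ?normrN ?normr0 ?normr1.
Qed.

Lemma vanishing_setU A B : vanishing_set A -> vanishing_set B -> vanishing_set (A `|` B).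
Proof.
move=> [mA vA] [mB vB]; split; first exact: measurableU.
have w C : measurable C -> pair_weight (adist (\1_C : V -> R)).
  by move=> mC; apply: adist_weight; exact: measurable_indic.
apply: (vanishingS _ _ _ (vanishingD (w _ mA) (w _ mB) vA vB)).
- by apply: w; exact: measurableU.
- by apply: weightD; exact: w.
move=> x y; rewrite /adist !indicE !in_setU.
by case: (x \in A); case: (y \in A); case: (x \in B); case: (y \in B) => //=;
  rewrite ?subr0 ?sub0r ?subrr ?normrN ?normr0 ?normr1 ?addr0 ?add0r ?ler01 ?lexx ?lerDl.
Qed.

(** A cube of half-side [s] meets both sides of the hyperplane only if its centre is
    at distance at most [s] from it, and this slab has measure of order [s]. *)
Lemma vanishing_set_halfspace (i : 'I_m) (c : R) :
  vanishing_set [set x : V | c < x ord0 i].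
Proof.
have mH : measurable [set x : V | c < x ord0 i].
  rewrite -[X in measurable X]setTI (_ : [set x : V | _] =
    (fun x : V => x ord0 i) @^-1` `]c, +oo[%classic).
    by apply: (measurable_coord i) => //; exact: measurable_itv.
  by apply/seteqP; split => x /=; rewrite in_itv/= andbT.
split=> // a r e r0 e0.
pose P := \prod_(j < m | j != i) (r *+ 2).
have P0 : 0 <= P by apply: prodr_ge0 => j _; rewrite mulrn_wge0 ?ltW.
exists (e / (2 * (P + 1))); split=> [|s s0 sd]; first by rewrite divr_gt0//; lra.
(* The part of the cube within [s] of the hyperplane is enclosed in the box [S]. *)
pose B j := if j == i then `[c - s, c + s]%classic else `[a ord0 j - r, a ord0 j + r[%classic.
have mB j : measurable (B j) by rewrite /B; case: ifPn => _; exact: measurable_itv.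
pose S := [set x : V | forall j, B j (x ord0 j)].
have mS : measurable S by exact: measurable_box.
have muS : (mu S = (s *+ 2 * P)%:E)%E.
  apply: etrans (lebesgue_rV_box mB) _.
  rewrite (bigD1 i)//= /B eqxx lebesgue_measure_itv/= lte_fin ifT; last by lra.
  rewrite (eq_bigr (fun=> (r *+ 2)%:E)); last first.
    move=> j /negPf ->; rewrite lebesgue_measure_itv/= lte_fin ifT; last by lra.
    by rewrite -EFinB; congr EFin; lra.
  by rewrite prodEFin -EFinB -EFinM; congr EFin; congr (_ * _); lra.
have D0 : pair_weight (fun (x _ : V) => \1_S x : R).
  split=> [|x _]; last by rewrite indicE.
  by apply: (@measurableT_comp _ _ _ _ _ _ (\1_S : V -> R)) => //; exact: measurable_indic.
have w1 : pair_weight (adist (\1_[set x : V | c < x ord0 i] : V -> R)).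
  by apply: adist_weight; exact: measurable_indic.
have s20 : 0 <= (s *+ 2) ^+ m by rewrite exprn_ge0// mulrn_wge0// ltW.
apply: (@le_trans _ _ (\int[mu]_(x in cube a r) (((s *+ 2) ^+ m)%:E * (\1_S x)%:E))%E).
  apply: ge0_le_integral => //.
  - exact: measurable_cube.
  - by move=> x _; apply: integral_ge0 => y _; rewrite lee_fin; case: w1.
  - by apply: measurable_funTS; exact: measurable_inner.
  - apply/measurable_EFinP/measurable_funTS.
    by apply: measurable_funM => //; exact: measurable_indic.
  move=> x xa.
  apply: (@le_trans _ _ (\int[mu]_(y in cube x s) (\1_S x)%:E)%E); last first.
    by rewrite integral_cube_cst// muleC.
  apply: ge0_le_integral; first exact: measurable_cube.
  - by move=> y _; rewrite lee_fin; case: w1.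
  - by apply: measurable_funTS; exact: weight_xm.
  - exact: measurable_cst.
  move=> y xy; rewrite lee_fin; have [Sx|Sx] := boolP (x \in S).
    by rewrite indicE Sx; exact: indic_dist01.
  suff cc : (c < x ord0 i) = (c < y ord0 i).
    have cc' : (x \in [set x : V | c < x ord0 i]) = (y \in [set x : V | c < x ord0 i]).
      by apply/idP/idP; rewrite !inE /= cc.
    by rewrite /adist !indicE cc' subrr normr0.
  have {}Sx : ~ `[c - s, c + s]%classic (x ord0 i).
    move=> xi; move: Sx; rewrite notin_setE; apply => j; rewrite /B.
    by case: eqP => [->//|_]; exact: xa.
  have := Sx; rewrite /= in_itv/= => /negP; rewrite negb_and -!ltNge.
  move: xy => /cubeP/(_ i) xy.
  by case/orP => h; apply/idP/idP => h1; lra.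
rewrite ge0_integralZl//; last 2 first.
- exact: measurable_cube.
- by apply/measurable_EFinP/measurable_funTS; exact: measurable_indic.
rewrite integral_indic//; last exact: measurable_cube.
rewrite muleC EFinM; apply: lee_wpmul2r; first by rewrite lee_fin.
apply: (@le_trans _ _ (mu S)).
  by apply: le_measure; rewrite ?inE//; apply: measurableI => //; exact: measurable_cube.
apply: (@le_trans _ _ (s *+ 2 * P)%:E); first by rewrite -muS.
rewrite lee_fin; move: sd; rewrite ltr_pdivlMr; last by lra.
by have : s * P <= s * (P + 1); [rewrite ler_wpM2l// ?(ltW s0)//; lra|lra].
Qed.

Lemma vanishing_set_bigcup (F : nat -> set V) :
  (forall n, vanishing_set (F n)) -> vanishing_set (\bigcup_n F n).
Proof.
move=> vF; have mF n : measurable (F n) by case: (vF n).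
pose G n := \big[setU/set0]_(k < n.+1) F k.
have vG n : vanishing_set (G n).
  rewrite /G; elim: {n}n.+1 => [|n IH]; last by rewrite big_ord_recr; exact: vanishing_setU.
  rewrite big_ord0; split=> //.
  rewrite (_ : adist _ = (fun _ _ => 0)); first exact: vanishing0.
  by apply/funext => x; apply/funext => y; rewrite /adist indic0/= subrr normr0.
have mG n : measurable (G n) by case: (vG n).
have GU : \bigcup_n G n = \bigcup_n F n.
  by rewrite (bigcup_bigsetU_bigcup F).
have GS n : G n `<=` \bigcup_n F n by rewrite -GU; exact: bigcup_sup.
have mU : measurable (\bigcup_n F n) by exact: bigcupT_measurable.
split=> //; apply: vanishing_approx; first exact: measurable_indic.
move=> a r e r0 e0.
pose C := cube a r; have mC : measurable C := measurable_cube a r.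
have Cfin : (mu C < +oo)%E by exact: lebesgue_cube_lty.
have fin A : measurable A -> mu (C `&` A) \is a fin_num.
  move=> mA; rewrite ge0_fin_numE//; apply: le_lt_trans Cfin.
  by apply: le_measure; rewrite ?inE//; exact: measurableI.
have : (fun n => mu (C `&` G n)) @ \oo --> mu (C `&` \bigcup_n F n).
  rewrite -GU setI_bigcupr; apply: nondecreasing_cvg_mu.
  - by move=> n; exact: measurableI.
  - by rewrite -setI_bigcupr GU; exact: measurableI.
  - move=> n k nk; apply/subsetPset; apply: setIS.
    exact: (@subset_bigsetU _ F n.+1 k.+1 nk).
rewrite -(fineK (fin _ mU)) => /fine_cvg/cvgrPdist_lt/(_ e e0)[N _ /(_ N (leqnn N))] /= HN.
exists \1_(G N); split; [exact: measurable_indic|by case: (vG N)|].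
rewrite (_ : (fun x => _) = (fun x => (\1_((\bigcup_n F n) `\` G N) x)%:E)); last first.
  apply/funext => x; rewrite !indicE in_setD; congr EFin.
  case: (boolP (x \in G N)) => xG /=; last by rewrite andbT subr0; case: (_ \in _); rewrite /= ?normr1 ?normr0.
  by rewrite (_ : x \in _) ?subrr ?normr0//; rewrite inE; rewrite inE in xG; exact: GS xG.
rewrite integral_indic//; last exact: measurableD.
rewrite setIC setIDA measureD//; [|exact: measurableI|by rewrite ltey_eq fin].
have -> : C `&` \bigcup_n F n `&` G N = C `&` G N.
  by rewrite -setIA; congr (_ `&` _); rewrite setIC; apply/setIidPl; exact: GS.
change (mu (C `&` \bigcup_n F n) - mu (C `&` G N) <= e%:E)%E.
rewrite -(fineK (fin _ mU)) -(fineK (fin _ (mG N))) -EFinB lee_fin ltW//.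
exact: le_lt_trans (ler_norm _) HN.
Qed.

(** The sets with this property form a sigma-algebra that contains the half-spaces. *)
Lemma vanishing_measurable A : measurable A -> vanishing_set A.
Proof.
have sa : sigma_algebra setT vanishing_set.
  split=> [|B vB|F vF]; last exact: vanishing_set_bigcup.
  - rewrite -setCT; apply: vanishing_setC; split=> //.
    rewrite (_ : adist _ = (fun _ _ => 0)); first exact: vanishing0.
    by apply/funext => x; apply/funext => y; rewrite /adist indicT/= subrr normr0.
  - by rewrite setTD; exact: vanishing_setC.
apply: smallest_sub => //.
rewrite -bigcup_seq => _ /= [i _ [B mB <-]]; rewrite setTI.
have : <<s @RGenOInfty.G R >> B.
  by move: (mB); rewrite -[X in X B -> _]/(R.-ocitv.-measurable.-sigma.-measurable) RGenOInfty.measurableE.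
apply: (@smallest_sub _ _ _ [set B | vanishing_set ((fun x : V => x ord0 i) @^-1` B)]).
  split=> [|C|F] /=.
  - by rewrite preimage_set0; case: sa.
  - by move=> vC; rewrite setTD -preimage_setC; exact: vanishing_setC.
  - by move=> vF; rewrite preimage_bigcup; exact: vanishing_set_bigcup.
move=> _ [c ->] /=.
rewrite (_ : _ @^-1` _ = [set x : V | c < x ord0 i]); first exact: vanishing_set_halfspace.
by apply/seteqP; split => x /=; rewrite in_itv/= andbT.
Qed.

Import HBNNSimple.

Lemma vanishing_nnsfun (g : {nnsfun V >-> R}) : vanishing (adist g).
Proof.
have w A : measurable A -> pair_weight (adist (\1_A : V -> R)).
  by move=> mA; apply: adist_weight; exact: measurable_indic.
pose D (c : R) := (fun x y : V => `|c| * adist \1_(g @^-1` [set c]) x y).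
have mg c : measurable (g @^-1` [set c]) by exact: measurable_funPTI.
have [wS vS] := @vanishing_sum _ _ _ (finmap.enum_fset (fset_set (range g))) D
  (fun c => weightZ (normr_ge0 c) (w _ (mg c)))
  (fun c => vanishingZ (normr_ge0 c) (w _ (mg c)) (proj2 (vanishing_measurable (mg c)))).
apply: vanishingS wS _ vS; first exact: adist_weight.
move=> x y; rewrite /adist !fimfunE !fsbig_finite//= -sumrB.
apply: le_trans (ler_norm_sum _ _ _) _.
by apply: ler_sum => c _; rewrite -mulrBr normrM.
Qed.

Lemma ecvg0_le (u : nat -> \bar R) (e : R) : u @ \oo --> 0%E -> 0 < e ->
  exists n, (u n <= e%:E)%E.
Proof.
move=> /fine_cvgP[[N1 _ h1] /cvgrPdist_lt h2] e0.
have [N2 _ {}h2] := h2 e e0.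
exists (maxn N1 N2); rewrite -(fineK (h1 _ (leq_maxl _ _))) lee_fin.
have := h2 _ (leq_maxr N1 N2) => /=; rewrite sub0r normrN => /ltW.
exact: le_trans (ler_norm _).
Qed.

Lemma vanishing_ge0 f : (forall x, 0 <= f x) -> measurable_fun setT f ->
  (forall a r, 0 < r -> mu.-integrable (cube a r) (EFin \o f)) ->
  vanishing (adist f).
Proof.
move=> f0 mf intf; apply: vanishing_approx => // a r e r0 e0.
have mf' : measurable_fun setT (EFin \o f) by exact/measurable_EFinP.
pose g := nnsfun_approx measurableT mf'.
have mC := measurable_cube a r.
have gf x : (g n x)%:E @[n --> \oo] --> (f x)%:E.
  by apply: cvg_nnsfun_approx => // y _; rewrite lee_fin.
have gf' x : g n x @[n --> \oo] --> f x by apply: (fine_cvg (gf x)).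
have ndg x : nondecreasing_seq (fun n => g n x).
  by move=> i j ij; exact/lefP/nd_nnsfun_approx.
have lgf n x : g n x <= f x.
  rewrite -(cvg_lim _ (gf' x))//; apply: nondecreasing_cvgn_le => //.
  by apply: cvgP (gf' x).
have h : {ae mu, forall x n, cube a r x -> (`|(EFin \o g n) x| <= (EFin \o f) x)%E}.
  by apply: aeW => x n _; rewrite /= lee_fin ger0_norm.
have mg n : measurable_fun (cube a r) (EFin \o g n).
  by apply: measurable_funTS; apply/measurable_EFinP; exact: measurable_funPT.
have gfae : {ae mu, forall x, cube a r x -> (g n x)%:E @[n --> \oo] --> (f x)%:E}.
  by apply: aeW => x _; exact: gf.
have [_ cv _] := @dominated_convergence _ _ _ mu _ mC (fun n => EFin \o g n) (EFin \o f) (EFin \o f)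
  mg (measurable_funTS mf') gfae (intf a r r0) h.
have [n hn] := ecvg0_le cv e0.
exists (g n); split; [exact: measurable_funPT|exact: vanishing_nnsfun|].
apply: le_trans hn; rewrite le_eqVlt; apply/orP; left; apply/eqP.
by apply: eq_integral => x _ /=; rewrite distrC.
Qed.

(** A substitute for the density of continuous functions: indicators of measurable
    sets, then simple functions, then monotone limits. *)
Lemma vanishing_integrable f : measurable_fun setT f ->
  (forall a r, 0 < r -> mu.-integrable (cube a r) (EFin \o f)) ->
  vanishing (adist f).
Proof.
move=> mf intf.
have mp : measurable_fun setT (f ^\+) by exact: measurable_funrpos.
have mn : measurable_fun setT (f ^\-) by exact: measurable_funrneg.
have le_p x : f^\+ x <= `|f x| by rewrite /funrpos ge_max ler_norm normr_ge0.
have le_n x : f^\- x <= `|f x| by rewrite /funrneg ge_max -normrN ler_norm normr_ge0.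
have intp a r : 0 < r -> mu.-integrable (cube a r) (EFin \o f^\+).
  move=> r0; apply: le_integrable (intf a r r0); first exact: measurable_cube.
    exact/measurable_EFinP/measurable_funTS.
  by move=> x _ /=; rewrite lee_fin ger0_norm ?funrpos_ge0.
have intn a r : 0 < r -> mu.-integrable (cube a r) (EFin \o f^\-).
  move=> r0; apply: le_integrable (intf a r r0); first exact: measurable_cube.
    exact/measurable_EFinP/measurable_funTS.
  by move=> x _ /=; rewrite lee_fin ger0_norm ?funrneg_ge0.
have vp := vanishing_ge0 (funrpos_ge0 f) mp intp.
have vn := vanishing_ge0 (funrneg_ge0 f) mn intn.
apply: (vanishingS _ _ _ (vanishingD (adist_weight mp) (adist_weight mn) vp vn)).
- exact: adist_weight.
- by apply: weightD; exact: adist_weight.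
move=> x y; rewrite /adist.
have E z : f z = f^\+ z - f^\- z by rewrite -[in LHS](funrposBneg f).
rewrite !E (_ : _ - _ - _ = f^\+ x - f^\+ y - (f^\- x - f^\- y)); last by ring.
exact: ler_normB.
Qed.

End L1_vanishing.

(** * A family of bump functions *)
Section bump.
Context {R : realType}.

(** The functions [P(w) exp(- w)] of [w = 1 / (1 - s)], extended by zero to [s >= 1].
    Keeping the polynomial [P] general makes the class stable under derivation. *)
Definition bump (P : {poly R}) (s : R) : R :=
  if s < 1 then P.[(1 - s)^-1] * expR (- (1 - s)^-1) else 0.

(** As [w' = w^2], this is the polynomial of the derivative. *)
Definition dbump (P : {poly R}) : {poly R} := 'X^2 * (P^`() - P).

Lemma bump_ge1 P s : 1 <= s -> bump P s = 0.
Proof. by move=> s1; rewrite /bump ltNge s1. Qed.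

(** From [1 + w / k <= exp (w / k)]. *)
Lemma pow_le_exp (w : R) (k : nat) : 0 <= w -> w ^+ k <= k%:R ^+ k * expR w.
Proof.
move=> w0; case: k => [|k]; first by rewrite !expr0 mul1r; apply: le_trans (expR_ge1Dx _); lra.
have kp : 0 < k.+1%:R :> R by [].
rewrite -[X in expR X](_ : k.+1%:R * (w / k.+1%:R) = w); last first.
  by rewrite mulrC divfK// lt0r_neq0.
rewrite expRM_natl -exprMn lerXn2r// ?nnegrE ?mulr_ge0 ?expR_ge0//.
rewrite -ler_pdivrMl// [_^-1 * _]mulrC; apply: le_trans (expR_ge1Dx _).
by rewrite lerDr.
Qed.

Lemma poly_exp_decay (P : {poly R}) (k : nat) :
  exists C : R, 0 <= C /\ forall w, 1 <= w -> `|P.[w]| * expR (- w) * w ^+ k <= C.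
Proof.
pose N := (size P + k)%N.
exists ((\sum_(i < size P) `|P`_i|) * N%:R ^+ N); split.
  by rewrite mulr_ge0 ?exprn_ge0 ?sumr_ge0.
move=> w w1; have w0 : 0 <= w by lra.
have h : `|P.[w]| <= (\sum_(i < size P) `|P`_i|) * w ^+ size P.
  rewrite horner_coef mulr_suml; apply: le_trans (ler_norm_sum _ _ _) _.
  apply: ler_sum => i _; rewrite normrM ler_wpM2l// normrX ger0_norm//.
  by rewrite ler_weXn2l// ltnW.
apply: (@le_trans _ _ ((\sum_(i < size P) `|P`_i|) * w ^+ N * expR (- w))).
  rewrite mulrAC exprD mulrA ler_wpM2r ?expR_ge0// ler_wpM2r ?exprn_ge0//.
rewrite -mulrA ler_wpM2l ?sumr_ge0// expRN ler_pdivrMr ?expR_gt0//.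
exact: pow_le_exp.
Qed.

(** The exponential beats every power of [w]. Quadratic flatness at [s = 1] is what
    makes the derivative vanish there. *)
Lemma bump_flat (P : {poly R}) :
  exists C : R, 0 <= C /\ forall h, `|h| <= 1 -> `|bump P (1 + h)| <= C * h ^+ 2.
Proof.
have [C [C0 HC]] := poly_exp_decay P 2; exists C; split=> // h h1.
have [h0|h0] := ltP h 0; last first.
  by rewrite bump_ge1 ?normr0 ?mulr_ge0 ?sqr_ge0//; lra.
have hn : h != 0 by rewrite lt_eqF.
rewrite /bump ifT; last by lra.
rewrite (_ : 1 - (1 + h) = - h); last by ring.
have nh : 0 < - h by lra.
have nh1 : - h <= 1 by rewrite -(ltr0_norm h0).
have w1 : 1 <= (- h)^-1 by rewrite invf_ge1.
rewrite normrM (ger0_norm (expR_ge0 _)).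
have := HC _ w1; rewrite exprVn sqrrN.
by rewrite ler_pdivrMr// exprn_even_gt0.
Qed.

Lemma is_derive_invB (s : R) : s < 1 ->
  is_derive s 1 (fun s : R => (1 - s)^-1) ((1 - s)^-1 ^+ 2).
Proof.
move=> s1; have n0 : 1 - s != 0 by rewrite subr_eq0 gt_eqF.
have d1 : is_derive s (1 : R) (fun s : R => 1 - s) (- 1).
  by apply: is_derive_eq (is_deriveB (is_derive_cst (1 : R) s (1 : R)) (is_derive_id s (1 : R))) _; rewrite sub0r.
have dv := @is_deriveV R (fun s : R => 1 - s) s (- 1) 1 n0 d1.
apply: (is_derive_eq dv).
by rewrite scaleNr scalerN opprK -exprVn /GRing.scale/= mulr1.
Qed.

Lemma is_derive_bump (P : {poly R}) (s : R) :
  is_derive s 1 (bump P) (bump (dbump P) s).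
Proof.
have [s1|s1|->] := ltgtP s 1.
- pose f (s : R) := P.[(1 - s)^-1] * expR (- (1 - s)^-1).
  have dw := is_derive_invB s1; set w := (1 - s)^-1 in dw.
  have dP : is_derive s 1 (fun s : R => P.[(1 - s)^-1]) (P^`().[w] * w ^+ 2).
    have hP := is_derive_poly P w.
    exact: (@is_derive1_comp R (horner P) (fun s : R => (1 - s)^-1) s _ _ hP dw).
  have dN : is_derive s 1 (fun s : R => - (1 - s)^-1) (- w ^+ 2).
    exact: is_deriveN.
  have dE : is_derive s 1 (fun s : R => expR (- (1 - s)^-1)) (expR (- w) * - w ^+ 2).
    have hE := is_derive_expR (- w).
    exact: (@is_derive1_comp R expR (fun s : R => - (1 - s)^-1) s _ _ hE dN).
  have df : is_derive s 1 f (bump (dbump P) s).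
    have dM := @is_deriveM R R (fun s : R => P.[(1 - s)^-1]) (fun s : R => expR (- (1 - s)^-1)) s 1 _ _ dP dE.
    apply: (is_derive_eq dM).
    rewrite /bump s1 /dbump hornerM hornerXn hornerD hornerN -/w /GRing.scale/=.
    by ring.
  apply: near_eq_is_derive df.
  near=> z; rewrite /f /bump ifT//.
  by near: z; exact: lt_nbhsl.
- apply: (@near_eq_is_derive _ _ _ (cst 0)); last first.
    by rewrite bump_ge1 ?ltW//; exact: is_derive_cst.
  near=> z; rewrite /= bump_ge1// ltW//.
  by near: z; exact: lt_nbhsr.
rewrite bump_ge1//; have [C [C0 HC]] := bump_flat P.
have cv : h^-1 *: (bump P (h *: 1 + 1) - bump P 1) @[h --> 0^'] --> (0 : R).
  rewrite (@bump_ge1 _ 1)// ; apply/cvgrPdist_le => e e0.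
  near=> h; rewrite sub0r normrN subr0 /GRing.scale/= mulr1 addrC normrM normfV.
  have hn : h != 0 by near: h; exact: nbhs_dnbhs_neq.
  have hC : (C + 1) * `|h| <= e.
    rewrite mulrC -ler_pdivlMr; last by lra.
    near: h; apply: dnbhs0_le; rewrite divr_gt0//; lra.
  have h1 : `|h| <= 1 by near: h; exact: dnbhs0_le.
  rewrite mulrC ler_pdivrMr ?normr_gt0//; apply: le_trans (HC _ h1) _.
  rewrite -real_normK ?num_real// expr2 mulrA ler_wpM2r//.
  by apply: le_trans hC; rewrite ler_wpM2r//; lra.
apply: DeriveDef; first by apply: cvgP cv.
exact: (cvg_lim _ cv).
Unshelve. all: by end_near. Qed.

End bump.

(** * Radial test functions *)
Section smooth_class.
Context {R : realType} {m : nat}.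
Local Notation V := 'rV[R]_m.
Implicit Types (f g q : V -> R).

(** An algebra generated by bumps and coordinates, closed under partial derivatives:
    differentiability of its members is therefore smoothness. *)
Inductive bump_alg : (V -> R) -> Prop :=
| bump_cst c : bump_alg (fun=> c)
| bump_coord i : bump_alg (fun x => x ord0 i)
| bump_comp P q : bump_alg q -> bump_alg (fun x => bump P (q x))
| bump_add f g : bump_alg f -> bump_alg g -> bump_alg (fun x => f x + g x)
| bump_mul f g : bump_alg f -> bump_alg g -> bump_alg (fun x => f x * g x).

Lemma differentiable_bump (P : {poly R}) (s : R) : differentiable (bump P) s.
Proof. by apply/derivable1_diffP; case: (is_derive_bump P s). Qed.

Lemma is_derive_comp_bump (P : {poly R}) q (x v : V) (d : R) :
  differentiable q x -> is_derive x v q d ->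
  is_derive x v (fun y => bump P (q y)) (bump (dbump P) (q x) * d).
Proof.
move=> dq iq.
have db := differentiable_bump P (q x).
have dc : differentiable (bump P \o q) x by exact: differentiable_comp.
apply: DeriveDef; first exact: (diff_derivable dc).
rewrite (deriveE v dc) (diff_comp dq db) /= -(deriveE v dq) diff1E//.
have ib := is_derive_bump P (q x).
by rewrite derive1E !derive_val /GRing.scale/= mulrC.
Qed.

Lemma bump_alg_differentiable f : bump_alg f -> forall x, differentiable f x.
Proof.
elim=> [c|i|P q _ IH|{}f g _ IHf _ IHg|{}f g _ IHf _ IHg] x.
- exact: differentiable_cst.
- exact: differentiable_coord.
- exact: (differentiable_comp (IH x) (differentiable_bump P (q x))).
- exact: differentiableD.
- exact: differentiableM.
Qed.

Lemma is_derive_coord (i k : 'I_m) (x : V) :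
  is_derive x (delta_mx ord0 k : V) (fun y : V => y ord0 i) ((k == i)%:R).
Proof.
have dc := @differentiable_coord R 1 m x ord0 i.
have cv : h^-1 *: (((fun y : V => y ord0 i) \o shift x) (h *: delta_mx ord0 k) - x ord0 i)
    @[h --> 0^'] --> ((k == i)%:R : R).
  apply/cvgrPdist_le => e e0; near=> h.
  have hn : h != 0 by near: h; exact: nbhs_dnbhs_neq.
  by rewrite /= !mxE eqxx /= addrK eq_sym /GRing.scale/= mulKf// subrr normr0 ltW.
apply: DeriveDef; first exact: (diff_derivable dc).
exact: (cvg_lim _ cv).
Unshelve. all: by end_near. Qed.

Lemma bump_alg_partial f k : bump_alg f -> bump_alg (partial k f).
Proof.
have D1 q x : bump_alg q -> is_derive x (delta_mx ord0 k : V) q (partial k q x).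
  move=> bq; apply: DeriveDef => //.
  exact: (diff_derivable (bump_alg_differentiable bq x)).
elim=> [c|i|P q bq IH|{}f g bf IHf bg IHg|{}f g bf IHf bg IHg].
- rewrite (_ : partial _ _ = fun=> 0); first exact: bump_cst.
  by apply/funext => x; exact: derive_cst.
- rewrite (_ : partial _ _ = fun=> (k == i)%:R); first exact: bump_cst.
  by apply/funext => x; have h := is_derive_coord i k x; rewrite /partial derive_val.
- rewrite (_ : partial _ _ = fun x => bump (dbump P) (q x) * partial k q x).
    by apply: bump_mul => //; exact: bump_comp.
  apply/funext => x.
  have h := is_derive_comp_bump P (bump_alg_differentiable bq x) (D1 q x bq).
  by rewrite {1}/partial derive_val.
- rewrite (_ : partial _ _ = fun x => partial k f x + partial k g x).
    exact: bump_add.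
  by apply/funext => x; have h := is_deriveD (D1 f x bf) (D1 g x bg); rewrite {1}/partial derive_val.
- rewrite (_ : partial _ _ = fun x => f x * partial k g x + g x * partial k f x).
    by apply: bump_add; exact: bump_mul.
  by apply/funext => x; have h := is_deriveM (D1 f x bf) (D1 g x bg); rewrite {1}/partial derive_val.
Qed.

Lemma bump_alg_smooth f : bump_alg f -> smooth f.
Proof.
move=> bf s x; apply: bump_alg_differentiable.
by elim: s => //= k s IH; exact: bump_alg_partial.
Qed.

Lemma bump_alg_sum (I : Type) (l : seq I) (F : I -> V -> R) :
  (forall i, bump_alg (F i)) -> bump_alg (fun x => \sum_(i <- l) F i x).
Proof.
move=> bF; elim: l => [|i l IH].
  rewrite (_ : (fun _ => _) = fun=> 0); first exact: bump_cst.
  by apply/funext => x; rewrite big_nil.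
rewrite (_ : (fun _ => _) = fun x => F i x + \sum_(j <- l) F j x); first exact: bump_add.
by apply/funext => x; rewrite big_cons.
Qed.

End smooth_class.

Section profiles.
Context {R : realType}.

Definition prof0 : R -> R := bump 1.
Definition prof1 : R -> R := bump (dbump 1).
Definition prof2 : R -> R := bump (dbump (dbump 1)).

Lemma bump_bounded (P : {poly R}) : exists C : R, 0 <= C /\ forall s, 0 <= s -> `|bump P s| <= C.
Proof.
have [C [C0 HC]] := poly_exp_decay P 0; exists C; split=> // s s0.
rewrite /bump; case: ifPn => s1; last by rewrite normr0.
rewrite normrM (ger0_norm (expR_ge0 _)) -[leLHS]mulr1 -(expr0 (1 - s)^-1).
by apply: HC; rewrite invf_ge1; lra.
Qed.

Lemma bump_lipschitz (P : {poly R}) :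
  exists C : R, 0 <= C /\ forall s t, 0 <= s -> 0 <= t -> `|bump P s - bump P t| <= C * `|s - t|.
Proof.
have [C [C0 HC]] := bump_bounded (dbump P); exists C; split=> //.
have main s t : 0 <= s -> s <= t -> `|bump P s - bump P t| <= C * `|s - t|.
  move=> s0; rewrite le_eqVlt => /predU1P[->|st]; first by rewrite !subrr normr0 mulr0.
  have [c cst E] := @MVT R (bump P) (bump (dbump P)) s t st (fun x _ => is_derive_bump P x)
    (continuous_subspaceT (fun x => differentiable_continuous (differentiable_bump P x))).
  rewrite distrC E normrM (distrC s) ler_wpM2r// HC//.
  by move: cst; rewrite in_itv/= => /andP[]; lra.
move=> s t s0 t0; have [st|ts] := leP s t; first exact: main.
by rewrite distrC (distrC s); apply: main => //; exact: ltW.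
Qed.

Lemma prof1_le0 s : prof1 s <= 0.
Proof.
rewrite /prof1 /bump /dbump; case: ifP => // _.
rewrite derivC sub0r mulrN mulr1 hornerN hornerXn mulNr oppr_le0.
by rewrite mulr_ge0 ?expR_ge0 ?sqr_ge0.
Qed.

(** It gives the kernel a positive mass. *)
Lemma prof1_neg : exists c : R, 0 < c /\ forall s, 0 <= s -> s <= 2^-1 -> prof1 s <= - c.
Proof.
exists (expR (- 2)); split; first exact: expR_gt0.
move=> s s0 s1; rewrite /prof1 /bump /dbump ifT; last by lra.
rewrite derivC sub0r mulrN mulr1 hornerN hornerXn mulNr lerN2.
have h1 : 1 <= (1 - s)^-1 by rewrite invf_ge1; lra.
have h2 : (1 - s)^-1 <= 2.
  by rewrite -[leRHS]invrK lef_pV2 ?posrE; lra.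
apply: (@le_trans _ _ (expR (- (1 - s)^-1))); first by rewrite ler_expR; lra.
rewrite -[leLHS]mul1r ler_wpM2r ?expR_ge0//; exact: exprn_ege1.
Qed.

End profiles.

Section radial.
Context {R : realType} {m : nat}.
Local Notation V := 'rV[R]_m.
Local Notation mu := (lebesgue_rV R m).
Implicit Types (x y : V) (t : R).

(** A polynomial in the coordinates, whereas [enorm (y - x)] is not smooth at [x]. *)
Definition sqd x y : R := \sum_i (y ord0 i - x ord0 i) ^+ 2.

Definition Psi t x y : R := prof0 (sqd x y * t^-1 ^+ 2).

(** The factor [- 2 prof1] is the one for which the derivative in [t] is a multiple of
    [Lap t x]; see [is_derive_kern]. *)
Definition kern t x y : R := t^-1 ^+ m * (- 2 * prof1 (sqd x y * t^-1 ^+ 2)).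

Definition Lap t x y : R := \sum_k partial k (partial k (Psi t x)) y.

Lemma sqdE x y : sqd x y = enorm (y - x) ^+ 2.
Proof. by rewrite enorm_sqr; apply: eq_bigr => i _; rewrite !mxE. Qed.

Lemma sqd_ge0 x y : 0 <= sqd x y.
Proof. by rewrite sqdE sqr_ge0. Qed.

Lemma scaled_sqd_ge0 t x y : 0 <= sqd x y * t^-1 ^+ 2.
Proof. by rewrite mulr_ge0 ?sqd_ge0 ?sqr_ge0. Qed.

Lemma enorm_lt_cube t x y : enorm (y - x) < t -> cube x t y.
Proof.
move=> h; apply/cubeP => i.
have : `|(y - x) ord0 i| < t by exact: le_lt_trans (coord_le_enorm _ _) h.
by rewrite !mxE ltr_norml; lra.
Qed.

Lemma outside_profile (P : {poly R}) t x y : 0 < t ->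
  t <= enorm (y - x) -> bump P (sqd x y * t^-1 ^+ 2) = 0.
Proof.
move=> t0 h; apply: bump_ge1; rewrite sqdE -exprMn exprn_ege1//.
by rewrite ler_pdivlMr// mul1r.
Qed.

Lemma outside_cube (P : {poly R}) t x y : 0 < t ->
  ~ cube x t y -> bump P (sqd x y * t^-1 ^+ 2) = 0.
Proof.
move=> t0 h; apply: outside_profile => //; rewrite leNgt; apply/negP => h'.
by apply: h; exact: enorm_lt_cube.
Qed.

Lemma is_derive_sqd x y k :
  is_derive y (delta_mx ord0 k : V) (sqd x) (2 * (y ord0 k - x ord0 k)).
Proof.
have h (i : 'I_m) : is_derive y (delta_mx ord0 k : V)
    (fun y : V => (y ord0 i - x ord0 i) ^+ 2) (2 * (y ord0 i - x ord0 i) * (k == i)%:R).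
  have d1 : is_derive y (delta_mx ord0 k : V) (fun y : V => y ord0 i - x ord0 i) (k == i)%:R.
    have := is_deriveB (is_derive_coord i k y) (is_derive_cst (x ord0 i) y (delta_mx ord0 k : V)).
    by rewrite subr0.
  apply: (is_derive_eq (is_deriveM d1 d1)).
  by rewrite /GRing.scale/=; ring.
have := is_derive_sum h.
rewrite (_ : \sum_(i < m) _ = sqd x); last by apply/funext => z; rewrite fct_sumE.
move=> hs; apply: (is_derive_eq hs).
rewrite (bigD1 k)//= eqxx mulr1 big1 ?addr0// => i /negPf ik.
by rewrite eq_sym ik mulr0.
Qed.

Lemma is_derive_profile (P : {poly R}) t x y k :
  is_derive y (delta_mx ord0 k : V) (fun y => bump P (sqd x y * t^-1 ^+ 2))
   (bump (dbump P) (sqd x y * t^-1 ^+ 2) * (2 * (y ord0 k - x ord0 k) * t^-1 ^+ 2)).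
Proof.
have hs : is_derive y (delta_mx ord0 k : V) (fun y => sqd x y * t^-1 ^+ 2)
    (2 * (y ord0 k - x ord0 k) * t^-1 ^+ 2).
  have := is_deriveM (is_derive_sqd x y k) (is_derive_cst (t^-1 ^+ 2) y (delta_mx ord0 k : V)).
  by move=> h; apply: (is_derive_eq h); rewrite scaler0 add0r /GRing.scale/= mulrC.
apply: is_derive_comp_bump => //.
suff : bump_alg (fun y => sqd x y * t^-1 ^+ 2) by move/bump_alg_differentiable.
apply: bump_mul; last exact: bump_cst.
apply: bump_alg_sum => i.
by apply: bump_mul; apply: bump_add; [exact: bump_coord|exact: bump_cst|exact: bump_coord|exact: bump_cst].
Qed.

Lemma partial_Psi t x k : partial k (Psi t x) =
  fun y => prof1 (sqd x y * t^-1 ^+ 2) * (2 * (y ord0 k - x ord0 k) * t^-1 ^+ 2).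
Proof.
apply/funext => y; have h := is_derive_profile 1 t x y k.
by rewrite /partial /Psi /prof0 derive_val.
Qed.

Lemma partial2_Psi t x k : partial k (partial k (Psi t x)) =
  fun y => prof2 (sqd x y * t^-1 ^+ 2) * (2 * (y ord0 k - x ord0 k) * t^-1 ^+ 2) ^+ 2
    + prof1 (sqd x y * t^-1 ^+ 2) * (2 * t^-1 ^+ 2).
Proof.
rewrite partial_Psi; apply/funext => y.
have h1 := is_derive_profile (dbump 1) t x y k.
have d1 : is_derive y (delta_mx ord0 k : V) (fun y : V => y ord0 k - x ord0 k) 1.
  have := is_deriveB (is_derive_coord k k y) (is_derive_cst (x ord0 k) y (delta_mx ord0 k : V)).
  by rewrite subr0 eqxx.
have h2 : is_derive y (delta_mx ord0 k : V)
    (fun y => 2 * (y ord0 k - x ord0 k) * t^-1 ^+ 2) (2 * t^-1 ^+ 2).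
  have h := is_deriveM (is_deriveM (is_derive_cst (2 : R) y (delta_mx ord0 k : V)) d1)
    (is_derive_cst (t^-1 ^+ 2) y (delta_mx ord0 k : V)).
  by apply: (is_derive_eq h); rewrite !scaler0 add0r addr0 /GRing.scale/=; ring.
have h := is_deriveM h1 h2.
rewrite /partial /prof1 derive_val /GRing.scale/= /prof2; ring.
Qed.

Lemma LapE t x y : Lap t x y =
  t^-1 ^+ 2 * (4 * (sqd x y * t^-1 ^+ 2) * prof2 (sqd x y * t^-1 ^+ 2)
               + 2 * m%:R * prof1 (sqd x y * t^-1 ^+ 2)).
Proof.
rewrite /Lap; set q := sqd x y * _; under eq_bigr do rewrite partial2_Psi -/q.
rewrite big_split/= sumr_const card_ord -mulr_natl.
rewrite (eq_bigr (fun k => (prof2 q * 4 * t^-1 ^+ 4) * (y ord0 k - x ord0 k) ^+ 2)); last first.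
  by move=> k _; ring.
by rewrite -mulr_sumr -/(sqd x y) /q; ring.
Qed.

(** With [q = |y - x|^2 / t^2], both sides equal a multiple of [2 q prof2(q) + m prof1(q)].
    This is why averages at two scales differ only by what the Laplacian sees. *)
Lemma is_derive_kern t x y : 0 < t ->
  is_derive t (1 : R) (fun t => kern t x y) (t * t^-1 ^+ m * Lap t x y).
Proof.
move=> t0; have tn : t != 0 by rewrite gt_eqF.
pose Z := sqd x y.
have dV : is_derive t (1 : R) (fun t : R => t^-1) (- t^-1 ^+ 2).
  have h := @is_deriveV R id t 1 1 tn (is_derive_id t (1 : R)).
  by apply: (is_derive_eq h); rewrite /GRing.scale/= mulr1 exprVn.
have dX n : is_derive t (1 : R) (fun t : R => t^-1 ^+ n) (n%:R * t^-1 ^+ n * - t^-1).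
  elim: n => [|n IH].
    rewrite (_ : (fun t : R => t^-1 ^+ 0) = cst 1); last by apply/funext => s; rewrite expr0.
    by apply: (is_derive_eq (is_derive_cst (1 : R) t (1 : R))); rewrite !mul0r.
  have h := is_deriveM dV IH.
  rewrite (_ : (fun t : R => t^-1 ^+ n.+1) = (fun t : R => t^-1 * t^-1 ^+ n)); last first.
    by apply/funext => s; rewrite exprS.
  apply: (is_derive_eq h); rewrite /GRing.scale/= [t^-1 ^+ n.+1]exprS -[n.+1%:R]natr1; ring.
have dq : is_derive t (1 : R) (fun t : R => Z * t^-1 ^+ 2) (- (2 * Z * t^-1 ^+ 3)).
  have h := is_deriveM (is_derive_cst Z t (1 : R)) (dX 2).
  by apply: (is_derive_eq h); rewrite scaler0 addr0 /GRing.scale/=; ring.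
have dp : is_derive t (1 : R) (fun t : R => prof1 (Z * t^-1 ^+ 2)) (prof2 (Z * t^-1 ^+ 2) * - (2 * Z * t^-1 ^+ 3)).
  exact: (@is_derive1_comp R prof1 (fun t : R => Z * t^-1 ^+ 2) t _ _
    (is_derive_bump (dbump 1) (Z * t^-1 ^+ 2)) dq).
have dp2 := is_deriveM (is_derive_cst (- 2 : R) t (1 : R)) dp.
have dk := is_deriveM (dX m) dp2.
apply: (is_derive_eq dk); rewrite LapE -/Z !scaler0 !addr0 /GRing.scale/=.
set p1 := prof1 _; set p2 := prof2 _.
transitivity (t^-1 ^+ m * (t / t) * (t^-1 * (4 * (Z * t^-1 ^+ 2) * p2 + 2 * m%:R * p1))); last by ring.
rewrite divff// mulr1; move: (t^-1) (m%:R : R) => w k.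
transitivity (w ^+ m * (- 2 * (p2 * - (2 * Z * w ^+ 3))) + - 2 * p1 * (k * w ^+ m * - w)); first by [].
move: (w ^+ m) => W; ring.
Qed.

Definition closed_cube x t : set V :=
  [set y : V | forall i, `[x ord0 i - t, x ord0 i + t]%classic (y ord0 i)].

Lemma compact_closed_cube x t : compact (closed_cube x t).
Proof.
by apply: (@rV_compact R m (fun i => `[x ord0 i - t, x ord0 i + t]%classic)) => i; exact: segment_compact.
Qed.

Lemma cube_closed_cube x t : cube x t `<=` closed_cube x t.
Proof. by move=> y /cubeP h i; rewrite /= in_itv/=; have := h i; lra. Qed.

Lemma bump_alg_Psi t x : bump_alg (Psi t x).
Proof.
apply: bump_comp; apply: bump_mul; last exact: bump_cst.
apply: bump_alg_sum => i.
by apply: bump_mul; apply: bump_add; [exact: bump_coord|exact: bump_cst|exact: bump_coord|exact: bump_cst].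
Qed.

Lemma test_function_Psi (U : set V) t x : 0 < t -> closed_cube x t `<=` U ->
  test_function U (Psi t x).
Proof.
move=> t0 xU; split; first exact/bump_alg_smooth/bump_alg_Psi.
exists (closed_cube x t); split=> //; first exact: compact_closed_cube.
by move=> y ny; apply: outside_cube => // /cube_closed_cube.
Qed.

Lemma test_function_partial_Psi (U : set V) t x k : 0 < t -> closed_cube x t `<=` U ->
  test_function U (partial k (Psi t x)).
Proof.
move=> t0 xU; split; first exact/bump_alg_smooth/bump_alg_partial/bump_alg_Psi.
exists (closed_cube x t); split=> //; first exact: compact_closed_cube.
by move=> y ny; rewrite partial_Psi /prof1 outside_cube ?mul0r// => /cube_closed_cube.
Qed.

Lemma grad_Psi_out t x y k : 0 < t -> ~ cube x t y -> partial k (Psi t x) y = 0.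
Proof. by move=> t0 h; rewrite partial_Psi /prof1 outside_cube// mul0r. Qed.

Lemma Lap_out t x y : 0 < t -> ~ cube x t y -> Lap t x y = 0.
Proof. by move=> t0 h; rewrite LapE /prof1 /prof2 !outside_cube//; ring. Qed.

Lemma kern_out t x y : 0 < t -> ~ cube x t y -> kern t x y = 0.
Proof. by move=> t0 h; rewrite /kern /prof1 outside_cube//; ring. Qed.

Lemma kern_ge0 t x y : 0 < t -> 0 <= kern t x y.
Proof.
move=> t0; rewrite /kern mulr_ge0 ?exprn_ge0 ?invr_ge0 ?(ltW t0)//.
by have := prof1_le0 (sqd x y * t^-1 ^+ 2); lra.
Qed.

Lemma grad_Psi_bound : exists C : R, 0 <= C /\ forall t x y, 0 < t ->
  enorm (\row_k partial k (Psi t x) y) <= C * t^-1.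
Proof.
have [C [C0 HC]] := bump_bounded (dbump (1 : {poly R})).
exists (2 * C); split=> [|t x y t0]; first by rewrite mulr_ge0.
have -> : \row_k partial k (Psi t x) y =
    (prof1 (sqd x y * t^-1 ^+ 2) * (2 * t^-1 ^+ 2)) *: (y - x).
  by apply/rowP => k; rewrite !mxE partial_Psi; ring.
rewrite enormZ; have [h|h] := ltP (enorm (y - x)) t; last first.
  by rewrite /prof1 outside_profile// mul0r normr0 mul0r ?mulr_ge0 ?invr_ge0 ?(ltW t0).
have ti : 0 < t^-1 by rewrite invr_gt0.
have h2 : 0 <= 2 * t^-1 ^+ 2 by rewrite pmulr_rge0// sqr_ge0.
rewrite normrM (ger0_norm h2).
apply: (@le_trans _ _ (C * (2 * t^-1 ^+ 2) * t)).
  apply: ler_pM; [by rewrite mulr_ge0|exact: enorm_ge0| |exact: ltW].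
  by apply: ler_wpM2r => //; exact/HC/scaled_sqd_ge0.
have -> : C * (2 * t^-1 ^+ 2) * t = 2 * C * t^-1 by field; exact: lt0r_neq0.
by [].
Qed.

Lemma kern_bound : exists C : R, 0 <= C /\ forall t x y, 0 < t -> kern t x y <= C * t^-1 ^+ m.
Proof.
have [C [C0 HC]] := bump_bounded (dbump (1 : {poly R})).
exists (2 * C); split=> [|t x y t0]; first by rewrite mulr_ge0.
rewrite /kern mulrC ler_wpM2r ?exprn_ge0 ?invr_ge0 ?(ltW t0)//.
have h : - prof1 (sqd x y * t^-1 ^+ 2) <= C.
  by apply: le_trans (ler_norm _) _; rewrite normrN; exact/HC/scaled_sqd_ge0.
by rewrite mulNr -mulrN ler_wpM2l.
Qed.

Lemma Lap_bound : exists C : R, 0 <= C /\ forall t x y, 0 < t -> `|Lap t x y| <= C * t^-1 ^+ 2.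
Proof.
have [C1 [C10 HC1]] := bump_bounded (dbump (1 : {poly R})).
have [C2 [C20 HC2]] := bump_bounded (dbump (dbump (1 : {poly R}))).
exists (4 * C2 + 2 * m%:R * C1); split=> [|t x y t0]; first by rewrite addr_ge0 ?mulr_ge0.
rewrite LapE normrM [`|t^-1 ^+ 2|]ger0_norm ?sqr_ge0// mulrC.
rewrite ler_wpM2r ?sqr_ge0//; set q := sqd x y * _.
have q0 : 0 <= q by exact: scaled_sqd_ge0.
apply: le_trans (ler_normD _ _) _; apply: lerD; last first.
  by rewrite normrM ger0_norm ?mulr_ge0// ler_wpM2l ?mulr_ge0//; exact: HC1.
have [q1|q1] := leP 1 q; first by rewrite /prof2 bump_ge1// mulr0 normr0 mulr_ge0.
have q4 : 0 <= 4 * q by rewrite mulr_ge0.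
have h2 : `|prof2 q| <= C2 by exact: HC2.
rewrite normrM (ger0_norm q4); apply: (@le_trans _ _ (4 * q * C2)); first exact: ler_wpM2l.
by apply: ler_wpM2r => //; lra.
Qed.

Lemma kern_lipschitz : exists C : R, 0 <= C /\ forall t x x' y, 0 < t ->
  `|kern t x y - kern t x' y| <=
    C * t^-1 ^+ m * (enorm (x - x') * (enorm (y - x) + enorm (y - x')) * t^-1 ^+ 2).
Proof.
have [C [C0 HC]] := bump_lipschitz (dbump (1 : {poly R})).
exists (2 * C); split=> [|t x x' y t0]; first by rewrite mulr_ge0.
rewrite /kern -mulrBr -mulrBr normrM [`|t^-1 ^+ m|]ger0_norm ?exprn_ge0 ?invr_ge0 ?(ltW t0)//.
rewrite normrM normrN [`|2|]ger0_norm// [leRHS](_ : _ = t^-1 ^+ m * (2 * (C * (enorm (x - x') * (enorm (y - x) + enorm (y - x')) * t^-1 ^+ 2)))); last by ring.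
rewrite ler_wpM2l ?exprn_ge0 ?invr_ge0 ?(ltW t0)// ler_wpM2l//.
apply: le_trans (HC _ _ (scaled_sqd_ge0 t x y) (scaled_sqd_ge0 t x' y)) _.
rewrite ler_wpM2l// -mulrBl normrM [`|t^-1 ^+ 2|]ger0_norm ?sqr_ge0// ler_wpM2r ?sqr_ge0//.
rewrite !sqdE subr_sqr normrM [X in _ * X]ger0_norm ?addr_ge0 ?enorm_ge0//.
rewrite ler_wpM2r ?addr_ge0 ?enorm_ge0//.
have h1 : enorm (y - x') <= enorm (y - x) + enorm (x - x') by exact: enorm_distD.
have h2 : enorm (y - x) <= enorm (y - x') + enorm (x - x').
  by rewrite (enormB x x'); exact: enorm_distD.
by rewrite ler_norml; lra.
Qed.

Lemma measurable_profile (P : {poly R}) : measurable_fun setT (bump P).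
Proof.
apply: continuous_measurable_fun => s; exact: (differentiable_continuous (differentiable_bump P s)).
Qed.

Lemma measurable_sqd : measurable_fun [set: V * V] (fun z => sqd z.1 z.2).
Proof.
apply: measurable_sum => i; apply: measurable_funX; apply: measurable_funB.
  exact: (measurableT_comp (measurable_coord i) measurable_snd).
exact: (measurableT_comp (measurable_coord i) measurable_fst).
Qed.

Lemma measurable_sqd_profile (P : {poly R}) t :
  measurable_fun [set: V * V] (fun z => bump P (sqd z.1 z.2 * t^-1 ^+ 2)).
Proof.
apply: (measurableT_comp (measurable_profile P)).
by apply: measurable_funM => //; exact: measurable_sqd.
Qed.

Lemma measurable_kern t : measurable_fun [set: V * V] (fun z => kern t z.1 z.2).
Proof.
apply: measurable_funM => //; apply: measurable_funM => //.
exact: measurable_sqd_profile.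
Qed.

Lemma measurable_kernx t x : measurable_fun [set: V] (kern t x).
Proof. exact: (measurableT_comp (measurable_kern t) (pair1_measurable x)). Qed.

Lemma measurable_sqd_profilex (P : {poly R}) t x :
  measurable_fun [set: V] (fun y => bump P (sqd x y * t^-1 ^+ 2)).
Proof. exact: (measurableT_comp (measurable_sqd_profile P t) (pair1_measurable x)). Qed.

Lemma measurable_sqdx x : measurable_fun [set: V] (sqd x).
Proof. exact: (measurableT_comp measurable_sqd (pair1_measurable x)). Qed.

Lemma measurable_Lap t x : measurable_fun [set: V] (Lap t x).
Proof.
rewrite (_ : Lap t x = fun y => t^-1 ^+ 2 *
    (4 * (sqd x y * t^-1 ^+ 2) * prof2 (sqd x y * t^-1 ^+ 2)
     + 2 * m%:R * prof1 (sqd x y * t^-1 ^+ 2))); last by apply/funext => y; exact: LapE.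
apply: measurable_funM => //; apply: measurable_funD.
  apply: measurable_funM; last exact: measurable_sqd_profilex.
  by apply: measurable_funM => //; apply: measurable_funM => //; exact: measurable_sqdx.
by apply: measurable_funM => //; exact: measurable_sqd_profilex.
Qed.

Lemma measurable_grad_Psi t x k : measurable_fun [set: V] (partial k (Psi t x)).
Proof.
rewrite partial_Psi; apply: measurable_funM; first exact: measurable_sqd_profilex.
apply: measurable_funM => //; apply: measurable_funM => //.
by apply: measurable_funB => //; exact: measurable_coord.
Qed.

Definition kern_mass : R := fine (\int[mu]_y (kern 1 0 y)%:E).

Lemma integral_kern1 : (\int[mu]_y (kern 1 (0 : V) y)%:E)%E \is a fin_num.
Proof.
have [C [C0 HC]] := kern_bound.
rewrite ge0_fin_numE; last by apply: integral_ge0 => y _; rewrite lee_fin kern_ge0.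
apply: (@le_lt_trans _ _ (\int[mu]_(y in cube (0 : V) 1) C%:E)%E); last first.
  by rewrite integral_cube_cst// -EFinM ltry.
rewrite [leRHS]integral_mkcond; apply: ge0_le_integral => //.
- by move=> y _; rewrite lee_fin kern_ge0.
- by apply/measurable_EFinP; exact: measurable_kernx.
- apply: (measurable_restrictT _ (measurable_cube _ _)).1; exact: measurable_cst.
move=> y _; rewrite /patch; case: ifPn => [_|].
  by rewrite lee_fin; have := HC 1 0 y ltr01; rewrite invr1 expr1n mulr1.
by rewrite notin_setE => h; rewrite kern_out.
Qed.

(** The kernels of different widths are rescalings of one another. *)
Lemma integral_kern t x : 0 < t ->
  (\int[mu]_y (kern t x y)%:E = (kern_mass)%:E)%E.
Proof.
move=> t0; pose f (z : V) := (kern 1 0 z)%:E.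
have E y : ((kern t x y)%:E = (t^-1 ^+ m)%:E * f (affine t x y))%E.
  rewrite /f -EFinM; congr EFin; rewrite /kern invr1 !expr1n mul1r mulr1.
  congr (_ * (_ * prof1 _)); rewrite /sqd mulr_suml; apply: eq_bigr => i _.
  by rewrite /affine !mxE; ring.
have mf : measurable_fun setT f by apply/measurable_EFinP; exact: measurable_kernx.
have f0 z : (0 <= f z)%E by rewrite lee_fin kern_ge0.
under eq_integral do rewrite E.
rewrite ge0_integralZl//; last 2 first.
- exact: (measurableT_comp mf (measurable_affine t x)).
- by rewrite lee_fin exprn_ge0// invr_ge0 ltW.
rewrite integral_affine// muleA -EFinM -exprMn mulVf ?gt_eqF// expr1n mul1e.
by rewrite fineK// integral_kern1.
Qed.

Lemma kern_mass_gt0 : 0 < kern_mass.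
Proof.
have [c [c0 Hc]] := @prof1_neg R.
pose r : R := (2 * m.+1%:R)^-1.
have r0 : 0 < r by rewrite invr_gt0.
rewrite -lte_fin fineK ?integral_kern1//.
apply: (@lt_le_trans _ _ (\int[mu]_(y in cube (0 : V) r) (2 * c)%:E)%E).
  by rewrite integral_cube_cst// -EFinM lte_fin mulr_gt0 ?mulr_gt0 ?exprn_gt0 ?mulrn_wgt0.
rewrite [leLHS]integral_mkcond; apply: ge0_le_integral => //.
- by move=> y _; rewrite /patch; case: ifP => // _; rewrite lee_fin mulr_ge0 ?(ltW c0).
- apply: (measurable_restrictT _ (measurable_cube _ _)).1; exact: measurable_cst.
- by apply/measurable_EFinP; exact: measurable_kernx.
move=> y _; rewrite /patch; case: ifPn => [|_]; last by rewrite lee_fin kern_ge0.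
rewrite inE => /cubeP yr; rewrite lee_fin /kern invr1 !expr1n mul1r mulr1.
have : prof1 (sqd 0 y) <= - c; last by lra.
apply: Hc; first exact: sqd_ge0.
apply: (@le_trans _ _ (\sum_(i < m) r ^+ 2)).
  apply: ler_sum => i _; rewrite mxE subr0 -real_normK ?num_real//.
  rewrite lerXn2r ?nnegrE ?(ltW r0)// ler_norml.
  by have := yr i; rewrite mxE; lra.
rewrite sumr_const card_ord.
have mr : m.+1%:R * r = 2^-1 by rewrite /r invfM mulrCA divff// mulr1.
apply: (@le_trans _ _ (m.+1%:R * r * r)).
  by rewrite -[_ *+ m]mulr_natl expr2 mulrA ler_wpM2r ?(ltW r0)// ler_wpM2r ?(ltW r0)// ler_nat leqnSn.
have r1 : r <= 1 by rewrite /r -natrM invf_le1 ?ltr0n// ler1n.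
rewrite mr; lra.
Qed.

(** Chosen once and for all, so that every later constant depends on the dimension
    only, and neither on the function nor on the cube. *)
Definition kernC : R := sval (cid kern_bound).
Definition gradC : R := sval (cid grad_Psi_bound).
Definition kernL : R := sval (cid kern_lipschitz).

Lemma kernC_ge0 : 0 <= kernC. Proof. by rewrite /kernC; case: cid => C []. Qed.
Lemma gradC_ge0 : 0 <= gradC. Proof. by rewrite /gradC; case: cid => C []. Qed.
Lemma kernL_ge0 : 0 <= kernL. Proof. by rewrite /kernL; case: cid => C []. Qed.

Lemma kern_le t x y : 0 < t -> kern t x y <= kernC * t^-1 ^+ m.
Proof. by rewrite /kernC; case: cid => C [C0 /= h]; exact: h. Qed.

Lemma grad_Psi_le t x y : 0 < t -> enorm (\row_k partial k (Psi t x) y) <= gradC * t^-1.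
Proof. by rewrite /gradC; case: cid => C [C0 /= h]; exact: h. Qed.

Lemma kern_lip t x x' y : 0 < t -> `|kern t x y - kern t x' y| <=
  kernL * t^-1 ^+ m * (enorm (x - x') * (enorm (y - x) + enorm (y - x')) * t^-1 ^+ 2).
Proof. by rewrite /kernL; case: cid => C [C0 /= h]; exact: h. Qed.

End radial.

(** * Functions integrable on every cube *)
Section lint.
Context {R : realType} {m : nat}.
Local Notation V := 'rV[R]_m.
Local Notation mu := (lebesgue_rV R m).
Implicit Types (f g : V -> R) (a : V) (r : R).

(** Measurable on the whole space and integrable on every cube: global measurability
    lets integrals over moving cubes be treated as functions of the centre. *)
Definition lint f := measurable_fun setT f /\
  forall a r, 0 < r -> mu.-integrable (cube a r) (EFin \o f).

Definition cint a r f : R := \int[mu]_(x in cube a r) f x.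

Lemma lintD f g : lint f -> lint g -> lint (fun x => f x + g x).
Proof.
move=> [mf intf] [mg intg]; split; first exact: measurable_funD.
move=> a r r0; have mC := measurable_cube a r.
exact: (@integrableD _ _ _ mu _ mC (EFin \o f) (EFin \o g) (intf a r r0) (intg a r r0)).
Qed.

Lemma lint_le f g : lint g -> measurable_fun setT f ->
  (forall x, `|f x| <= g x) -> lint f.
Proof.
move=> [mg intg] mf fg; split=> // a r r0.
apply: le_integrable (intg a r r0); first exact: measurable_cube.
  exact/measurable_EFinP/measurable_funTS.
by move=> x _ /=; rewrite lee_fin (le_trans (fg x))// ler_norm.
Qed.

Lemma lintZ (c : R) f : lint f -> lint (fun x => c * f x).
Proof.
move=> [mf intf]; split; first exact: measurable_funM.
move=> a r r0; have mC := measurable_cube a r.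
exact: (@integrableZl _ _ _ mu _ mC c (EFin \o f) (intf a r r0)).
Qed.

Lemma lint_cst (c : R) : lint (fun=> c).
Proof.
split=> // a r r0; apply/integrableP; split; first exact/measurable_EFinP.
by rewrite integral_cube_cst// /= -EFinM ltry.
Qed.

Lemma lintN f : lint f -> lint (fun x => - f x).
Proof.
by move=> /(lintZ (-1)); congr lint; apply/funext => x; rewrite mulN1r.
Qed.

Lemma lintB f g : lint f -> lint g -> lint (fun x => f x - g x).
Proof. by move=> lf lg; apply: lintD => //; exact: lintN. Qed.

Lemma lint_norm f : lint f -> lint (fun x => `|f x|).
Proof.
move=> [mf intf]; split; first exact: measurableT_comp.
by move=> a r r0; exact: (integrable_norm (intf a r r0)).
Qed.

Lemma lint_sum (I : Type) (l : seq I) (F : I -> V -> R) :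
  (forall i, lint (F i)) -> lint (fun x => \sum_(i <- l) F i x).
Proof.
move=> lF; elim: l => [|i l IH].
  by rewrite (_ : (fun=> _) = fun=> 0); [exact: lint_cst|apply/funext => x; rewrite big_nil].
rewrite (_ : (fun=> _) = fun x => F i x + \sum_(j <- l) F j x); first exact: lintD.
by apply/funext => x; rewrite big_cons.
Qed.

Lemma lint_mul_bounded (C : R) f g : lint f -> measurable_fun setT g ->
  (forall x, `|g x| <= C) -> lint (fun x => f x * g x).
Proof.
move=> lf mg gC; apply: (lint_le (lintZ C (lint_norm lf))).
  by apply: measurable_funM => //; case: lf.
by move=> x; rewrite normrM mulrC ler_wpM2r.
Qed.

Lemma cintD a r f g : 0 < r -> lint f -> lint g ->
  cint a r (fun x => f x + g x) = cint a r f + cint a r g.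
Proof.
move=> r0 [_ lf] [_ lg].
exact: (RintegralD (measurable_cube a r) (lf a r r0) (lg a r r0)).
Qed.

Lemma cintB a r f g : 0 < r -> lint f -> lint g ->
  cint a r (fun x => f x - g x) = cint a r f - cint a r g.
Proof.
move=> r0 [_ lf] [_ lg].
exact: (RintegralB (measurable_cube a r) (lf a r r0) (lg a r r0)).
Qed.

Lemma cintZ a r (c : R) f : 0 < r -> lint f -> cint a r (fun x => c * f x) = c * cint a r f.
Proof.
move=> r0 [_ lf].
exact: (RintegralZl c (measurable_cube a r) (lf a r r0)).
Qed.

Lemma cint_cst a r (c : R) : 0 < r -> cint a r (fun=> c) = c * (r *+ 2) ^+ m.
Proof. by move=> r0; rewrite /cint /Rintegral integral_cube_cst. Qed.

Lemma cint_sum (I : Type) (l : seq I) a r (F : I -> V -> R) : 0 < r ->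
  (forall i, lint (F i)) ->
  cint a r (fun x => \sum_(i <- l) F i x) = \sum_(i <- l) cint a r (F i).
Proof.
move=> r0 lF; elim: l => [|i l IH].
  rewrite (_ : (fun=> _) = fun=> 0); last by apply/funext => x; rewrite big_nil.
  by rewrite cint_cst// mul0r big_nil.
rewrite (_ : (fun=> _) = fun x => F i x + \sum_(j <- l) F j x); last first.
  by apply/funext => x; rewrite big_cons.
by rewrite cintD//; [rewrite IH big_cons|exact: lint_sum].
Qed.

Lemma le_cint a r f g : 0 < r -> lint f -> lint g ->
  (forall x, cube a r x -> f x <= g x) -> cint a r f <= cint a r g.
Proof.
move=> r0 [_ lf] [_ lg] fg.
exact: (le_Rintegral (measurable_cube a r) (lf a r r0) (lg a r r0)).
Qed.

Lemma cint_ge0 a r f : (forall x, cube a r x -> 0 <= f x) -> 0 <= cint a r f.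
Proof. by move=> f0; exact: Rintegral_ge0. Qed.

Lemma eq_cint a r f g : (forall x, cube a r x -> f x = g x) -> cint a r f = cint a r g.
Proof. by move=> fg; apply: eq_Rintegral => x; rewrite inE => /fg. Qed.

Lemma cint_EFin a r f : 0 < r -> lint f ->
  (\int[mu]_(x in cube a r) (f x)%:E = (cint a r f)%:E)%E.
Proof.
move=> r0 [_ lf]; rewrite fineK//.
exact: (integrable_fin_num (measurable_cube a r) (lf a r r0)).
Qed.

Lemma Rintegral_support (A B : set V) f : A `<=` B ->
  (forall y, B y -> ~ A y -> f y = 0) ->
  \int[mu]_(x in B) f x = \int[mu]_(x in A) f x.
Proof.
move=> AB f0; rewrite Rintegral_mkcond [RHS]Rintegral_mkcond.
congr (Rintegral _ _); apply/funext => y; rewrite /patch.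
have [Ay|nAy] := pselect (A y); first by rewrite !mem_set//; exact: AB.
rewrite (memNset nAy); case: ifPn => //; rewrite inE => By; exact: f0.
Qed.

Lemma cint_subset a' r' a r f : 0 < r' -> 0 < r -> lint f -> (forall x, 0 <= f x) ->
  subcube a' r' a r -> cint a' r' f <= cint a r f.
Proof.
move=> r'0 r0 lf f0 s; rewrite -lee_fin -!cint_EFin//.
apply: ge0_subset_integral; try exact: measurable_cube.
- by apply/measurable_EFinP/measurable_funTS; case: lf.
- by move=> x _; rewrite lee_fin.
- exact: subcube_sub.
Qed.

Lemma cint_children a r f : 0 < r -> lint f ->
  cint a r f = \sum_(b : {ffun 'I_m -> bool}) cint (child a r b) (r / 2) f.
Proof. by move=> r0 [_ lf]; apply: Rintegral_children => //; exact: lf. Qed.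

Lemma lint_restr (A : set V) f : measurable A -> measurable_fun A f ->
  mu.-integrable A (EFin \o f) -> lint (f \_ A).
Proof.
move=> mA mf intf; split; first exact: ((measurable_restrictT _ mA).1 mf).
move=> a r r0; have mC := measurable_cube a r.
apply: (@integrableS _ _ _ mu setT) => //.
have := (integrable_mkcond (EFin \o f) mA).1 intf.
by rewrite restrict_EFin.
Qed.

(** ** Vector-valued functions *)
Variable n : nat.
Implicit Types (u v : V -> 'rV[R]_n) (z : 'rV[R]_n).

Definition vlint u := forall i, lint (fun x => u x ord0 i).

Lemma vlintB u v : vlint u -> vlint v -> vlint (fun x => u x - v x).
Proof.
move=> lu lv i; rewrite (_ : (fun x => _) = (fun x => u x ord0 i - v x ord0 i)); first exact: lintB.
by apply/funext => x; rewrite !mxE.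
Qed.

Lemma vlint_cst z : vlint (fun=> z).
Proof. by move=> i; exact: lint_cst. Qed.

Lemma vlint_enorm u : vlint u -> lint (fun x => enorm (u x)).
Proof.
move=> lu; apply: (lint_le (lint_sum (index_enum _) (fun i => lint_norm (lu i)))).
  by apply: measurable_enorm => i; case: (lu i).
by move=> x; rewrite ger0_norm ?enorm_ge0//; exact: enorm_le_sum.
Qed.

Lemma lint_dist u z : vlint u -> lint (fun x => enorm (u x - z)).
Proof. by move=> lu; apply: vlint_enorm; apply: vlintB => //; exact: vlint_cst. Qed.

Definition vcint a r u : 'rV[R]_n := \row_i cint a r (fun x => u x ord0 i).

(** Test the integral against its own value and use Cauchy-Schwarz pointwise. *)
Lemma enorm_vcint a r u : 0 < r -> vlint u ->
  enorm (vcint a r u) <= cint a r (fun x => enorm (u x)).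
Proof.
move=> r0 lu; set w := vcint a r u.
have [w0|w0] := eqVneq (enorm w) 0.
  by rewrite w0; apply: cint_ge0 => x _; exact: enorm_ge0.
have wp : 0 < enorm w by rewrite lt_def w0 enorm_ge0.
rewrite -(ler_pM2l wp) -expr2 enorm_sqr.
rewrite (eq_bigr (fun i => cint a r (fun x => w ord0 i * u x ord0 i))); last first.
  by move=> i _; rewrite cintZ// expr2 {2}/w mxE.
rewrite -cintZ//; last exact: vlint_enorm.
rewrite -cint_sum//; last by move=> i; exact: lintZ.
apply: le_cint => //.
- by apply: lint_sum => i; exact: lintZ.
- by apply: lintZ; exact: vlint_enorm.
by move=> x _; exact: dot_le.
Qed.

Definition vol r : R := (r *+ 2) ^+ m.

Lemma vol_gt0 r : 0 < r -> 0 < vol r.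
Proof. by move=> r0; rewrite exprn_gt0// mulrn_wgt0. Qed.

Definition avg a r u : 'rV[R]_n := (vol r)^-1 *: vcint a r u.

Definition mean_dist a r u z : R := (vol r)^-1 * cint a r (fun x => enorm (u x - z)).

Definition osc a r u : R := mean_dist a r u (avg a r u).

Lemma mean_dist_ge0 a r u z : 0 < r -> 0 <= mean_dist a r u z.
Proof.
move=> r0; rewrite mulr_ge0 ?invr_ge0 ?(ltW (vol_gt0 r0))//.
by apply: cint_ge0 => x _; exact: enorm_ge0.
Qed.

Lemma osc_ge0 a r u : 0 < r -> 0 <= osc a r u.
Proof. exact: mean_dist_ge0. Qed.

Lemma avg_dist a r u z : 0 < r -> vlint u ->
  enorm (avg a r u - z) <= mean_dist a r u z.
Proof.
move=> r0 lu; have v0 := vol_gt0 r0.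
have -> : avg a r u - z = (vol r)^-1 *: vcint a r (fun x => u x - z).
  apply/rowP => i; rewrite !mxE.
  rewrite (@eq_cint _ _ (fun x => (u x - z) ord0 i) (fun x => u x ord0 i - z ord0 i)); last first.
    by move=> x _; rewrite !mxE.
  rewrite cintB//; last exact: lint_cst.
  by rewrite cint_cst// -/(vol r); field; exact: lt0r_neq0.
rewrite enormZ ger0_norm ?invr_ge0 ?(ltW v0)// ler_wpM2l ?invr_ge0 ?(ltW v0)//.
by apply: enorm_vcint => //; apply: vlintB => //; exact: vlint_cst.
Qed.

Lemma mean_dist_triangle a r u z z' : 0 < r -> vlint u ->
  mean_dist a r u z <= mean_dist a r u z' + enorm (z' - z).
Proof.
move=> r0 lu; have v0 := vol_gt0 r0.
have -> : enorm (z' - z) = (vol r)^-1 * cint a r (fun=> enorm (z' - z)).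
  by rewrite cint_cst// -/(vol r); field; exact: lt0r_neq0.
rewrite -mulrDr ler_wpM2l ?invr_ge0 ?(ltW v0)//.
rewrite -cintD//; [|exact: lint_dist|exact: lint_cst].
apply: le_cint => //; first exact: lint_dist.
  by apply: lintD; [exact: lint_dist|exact: lint_cst].
by move=> x _; exact: enorm_distD.
Qed.

(** The average is, up to a factor 2, the best constant. *)
Lemma osc_le_mean_dist a r u z : 0 < r -> vlint u -> osc a r u <= 2 * mean_dist a r u z.
Proof.
move=> r0 lu; apply: le_trans (mean_dist_triangle a _ z r0 lu) _.
by rewrite enormB mulr2n mulrDl mul1r lerD2l; exact: avg_dist.
Qed.

Lemma mean_dist_subcube a' r' a r u z : 0 < r' -> 0 < r -> vlint u ->
  subcube a' r' a r -> mean_dist a' r' u z <= vol r / vol r' * mean_dist a r u z.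
Proof.
move=> r'0 r0 lu s; have v0 := vol_gt0 r0; have v'0 := vol_gt0 r'0.
rewrite /mean_dist mulrA (_ : vol r / vol r' * (vol r)^-1 = (vol r')^-1); last first.
  by field; rewrite !lt0r_neq0.
rewrite ler_wpM2l ?invr_ge0 ?(ltW v'0)//.
by apply: cint_subset => //; [exact: lint_dist|move=> x; exact: enorm_ge0].
Qed.

Lemma avg_subcube a' r' a r u : 0 < r' -> 0 < r -> vlint u ->
  subcube a' r' a r -> enorm (avg a' r' u - avg a r u) <= vol r / vol r' * osc a r u.
Proof.
move=> r'0 r0 lu s; apply: le_trans (avg_dist _ _ r'0 lu) _.
exact: mean_dist_subcube.
Qed.

End lint.

Lemma eq_ler (R : realType) (x y : R) : x = y -> x <= y.
Proof. by move=> ->. Qed.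

(** * Radial averages *)
Section moll.
Context {R : realType} {m n : nat}.
Local Notation V := 'rV[R]_m.
Local Notation mu := (lebesgue_rV R m).
Local Notation c0 := (@kern_mass R m).
Implicit Types (u : V -> 'rV[R]_n) (f g : V -> R) (x a : V) (t r : R).

(** Average against the kernel of width [t], normalised by its mass. *)
Definition moll t u x : 'rV[R]_n :=
  c0^-1 *: vcint x t (fun y => kern t x y *: u y).

Lemma c0V_ge0 : 0 <= c0^-1.
Proof. by rewrite invr_ge0 ltW// kern_mass_gt0. Qed.

Lemma lint_kern t x f : 0 < t -> lint f -> lint (fun y => f y * kern t x y).
Proof.
move=> t0 lf.
apply: (@lint_mul_bounded _ _ (@kernC R m * t^-1 ^+ m)) => //; first exact: measurable_kernx.
by move=> y; rewrite ger0_norm ?kern_ge0//; exact: kern_le.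
Qed.

Lemma lint_kern1 t x : 0 < t -> lint (kern t x).
Proof.
move=> t0; have := lint_kern x t0 (lint_cst 1); congr lint.
by apply/funext => y; rewrite mul1r.
Qed.

Lemma cint_kern a r t x : 0 < t -> subcube x t a r -> cint a r (kern t x) = c0.
Proof.
move=> t0 s; transitivity (\int[mu]_y (kern t x y)); last first.
  by rewrite /Rintegral integral_kern.
apply/esym/Rintegral_support => // y _ nay; apply: kern_out => // xy.
by apply: nay; exact: subcube_sub s _ xy.
Qed.

Lemma vcint_support a r x t u : 0 < t -> subcube x t a r ->
  vcint x t (fun y => kern t x y *: u y) = vcint a r (fun y => kern t x y *: u y).
Proof.
move=> t0 s; apply/rowP => i; rewrite !mxE.
apply/esym/Rintegral_support; first exact: subcube_sub.
by move=> y _ nxy; rewrite mxE kern_out// mul0r.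
Qed.

Lemma vlint_kern t x u : 0 < t -> vlint u -> vlint (fun y => kern t x y *: u y).
Proof.
move=> t0 lu i; have := lint_kern x t0 (lu i); congr lint.
by apply/funext => y; rewrite mxE mulrC.
Qed.

(** As the kernel has constant mass, the difference of two averages only sees
    [u - z]. *)
Lemma moll_dist a r t x x' u z L : 0 < r -> 0 < t -> 0 <= L -> vlint u ->
  subcube x t a r -> subcube x' t a r ->
  (forall y, cube a r y -> `|kern t x y - kern t x' y| <= L) ->
  enorm (moll t u x - moll t u x') <= c0^-1 * L * cint a r (fun y => enorm (u y - z)).
Proof.
move=> r0 t0 L0 lu sx sx' HL.
pose k y := kern t x y - kern t x' y.
have lk : lint k by apply: lintB; exact: lint_kern1.
have luz : vlint (fun y => u y - z) by apply: vlintB => //; exact: vlint_cst.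
have lkz i : lint (fun y => k y * (u y - z) ord0 i).
  have := lintB (lint_kern x t0 (luz i)) (lint_kern x' t0 (luz i)); congr lint.
  by apply/funext => y; rewrite /k; ring.
have -> : moll t u x - moll t u x' = c0^-1 *: vcint a r (fun y => k y *: (u y - z)).
  rewrite /moll (vcint_support _ t0 sx) (vcint_support _ t0 sx') -scalerBr.
  congr (_ *: _); apply/rowP => i; rewrite !mxE.
  have lx := vlint_kern x t0 lu i; have lx' := vlint_kern x' t0 lu i.
  rewrite -cintB//.
  rewrite [RHS](@eq_cint _ _ _ _ _ (fun y =>
    (kern t x y *: u y) ord0 i - (kern t x' y *: u y) ord0 i - z ord0 i * k y)); last first.
    by move=> y _; rewrite /k !mxE; ring.
  rewrite (cintB _ _ (lintB lx lx'))//; last exact: lintZ.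
  rewrite cintZ// [cint a r k]cintB//; try exact: lint_kern1.
  by rewrite !cint_kern// subrr mulr0 subr0.
rewrite enormZ ger0_norm ?c0V_ge0// -mulrA ler_wpM2l ?c0V_ge0//.
have lv : vlint (fun y => k y *: (u y - z)).
  by move=> i; have := lkz i; congr lint; apply/funext => y; rewrite !mxE.
apply: le_trans (enorm_vcint _ r0 lv) _.
rewrite -cintZ//; last exact: lint_dist.
apply: le_cint => //; first exact: vlint_enorm.
  by apply: lintZ; exact: lint_dist.
by move=> y ay; rewrite enormZ ler_wpM2r ?enorm_ge0//; exact: HL.
Qed.

Lemma moll_sub t x u z : 0 < t -> vlint u ->
  enorm (moll t u x - z) <=
  c0^-1 * @kernC R m * t^-1 ^+ m * cint x t (fun y => enorm (u y - z)).
Proof.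
move=> t0 lu.
have luz : vlint (fun y => u y - z) by apply: vlintB => //; exact: vlint_cst.
have lku := vlint_kern x t0 lu.
have lk := vlint_kern x t0 luz.
have -> : moll t u x - z = c0^-1 *: vcint x t (fun y => kern t x y *: (u y - z)).
  rewrite /moll; apply/rowP => i; rewrite !mxE.
  rewrite (@eq_cint _ _ x t (fun y => (kern t x y *: (u y - z)) ord0 i) (fun y =>
    (kern t x y *: u y) ord0 i - z ord0 i * kern t x y)); last first.
    by move=> y _; rewrite !mxE; ring.
  rewrite cintB//; last by apply: lintZ; exact: lint_kern1.
  rewrite cintZ//; last exact: lint_kern1.
  rewrite cint_kern//; last exact: subcube_same.
  by field; exact/lt0r_neq0/kern_mass_gt0.
rewrite enormZ ger0_norm ?c0V_ge0// -!mulrA ler_wpM2l ?c0V_ge0//.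
apply: le_trans (enorm_vcint _ t0 lk) _.
rewrite mulrA -cintZ//; last exact: lint_dist.
apply: le_cint => //; first exact: vlint_enorm.
  by apply: lintZ; exact: lint_dist.
move=> y ay; rewrite enormZ ler_wpM2r ?enorm_ge0//.
by rewrite ger0_norm ?kern_ge0//; exact: kern_le.
Qed.

(** Measurability of integrals over moving cubes is known for nonnegative functions,
    whence the decomposition into positive and negative parts. *)
Lemma measurable_cint_kern t f : 0 < t -> lint f ->
  measurable_fun setT (fun x => cint x t (fun y => f y * kern t x y)).
Proof.
move=> t0 lf.
have pos g : measurable_fun setT g -> (forall y, 0 <= g y) ->
    measurable_fun setT (fun x => cint x t (fun y => g y * kern t x y)).
  move=> mg g0.
  have mfine : measurable_fun [set: \bar R] (@fine R) by [].
  apply: (measurableT_comp mfine).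
  apply: (@measurable_integral_cube _ _ t (fun z => (g z.2 * kern t z.1 z.2)%:E)).
    apply/measurable_EFinP; apply: measurable_funM; last exact: measurable_kern.
    exact: (measurableT_comp mg measurable_snd).
  by move=> z; rewrite lee_fin mulr_ge0// kern_ge0.
have mf : measurable_fun setT f by case: lf.
have mp : measurable_fun setT (f^\+) by exact: measurable_funrpos.
have mn : measurable_fun setT (f^\-) by exact: measurable_funrneg.
have lp : lint (f^\+).
  apply: (lint_le (lint_norm lf)) => // x.
  by rewrite ger0_norm ?funrpos_ge0// /funrpos ge_max ler_norm normr_ge0.
have ln : lint (f^\-).
  apply: (lint_le (lint_norm lf)) => // x.
  by rewrite ger0_norm ?funrneg_ge0// /funrneg ge_max -normrN ler_norm normr_ge0.
have := measurable_funB (pos _ mp (funrpos_ge0 f)) (pos _ mn (funrneg_ge0 f)).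
congr (measurable_fun _ _); apply/funext => x.
rewrite /= -cintB//; try exact: lint_kern.
by apply: eq_cint => y _; rewrite -mulrBl; congr (_ * _); rewrite -[in RHS](funrposBneg f).
Qed.

Lemma measurable_moll t u : 0 < t -> vlint u ->
  forall i, measurable_fun setT (fun x => moll t u x ord0 i).
Proof.
move=> t0 lu i.
have := measurable_funM (measurable_cst c0^-1) (measurable_cint_kern t0 (lu i)).
congr (measurable_fun _ _); apply/funext => x; rewrite /= !mxE; congr (_ * _).
by apply: eq_cint => y _; rewrite mxE mulrC.
Qed.

(** Derivation under the integral sign; away from [s = 0] the derivative of the kernel
    is bounded. The fixed cube of half-side [2 t] contains all the supports. *)
Lemma is_derive_cint_kern f x t s : 0 < t -> lint f -> t / 4 < s -> s < 2 * t ->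
  is_derive s (1 : R) (fun s => cint x (2 * t) (fun y => f y * kern s x y))
    (cint x (2 * t) (fun y => f y * (s * s^-1 ^+ m * Lap s x y))).
Proof.
move=> t0 lf s1 s2.
have [C [C0 HC]] := @Lap_bound R m.
pose F s y := f y * kern s x y.
pose K := 2 * t * (t / 4)^-1 ^+ m * (C * (t / 4)^-1 ^+ 2).
have t40 : 0 < t / 4 by lra.
have tt0 : 0 < 2 * t by lra.
have K0 : 0 <= K.
  by rewrite !mulr_ge0 ?exprn_ge0 ?invr_ge0 ?(ltW tt0) ?(ltW t40) ?(ltW t0).
have Is : `]t / 4, (2 * t)[%classic s by rewrite /= in_itv/= s1 s2.
have dF v y : t / 4 < v ->
    is_derive v (1 : R) (fun v => F v y) (f y * (v * v^-1 ^+ m * Lap v x y)).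
  move=> v1; have v0 : 0 < v by lra.
  have h := is_deriveM (is_derive_cst (f y) v (1 : R)) (is_derive_kern x y v0).
  by apply: (is_derive_eq h); rewrite scaler0 addr0.
have mC := measurable_cube x (2 * t).
have iF v : `]t / 4, (2 * t)[%classic v -> mu.-integrable (cube x (2 * t)) (EFin \o F v).
  rewrite /= in_itv/= => /andP[v1 _]; have v0 : 0 < v by lra.
  by have [_] := lint_kern x v0 lf; apply.
have derF v y : `]t / 4, (2 * t)[%classic v -> cube x (2 * t) y -> derivable (F^~ y) v 1.
  by rewrite /= in_itv/= => /andP[v1 _] _; case: (dF v y v1).
have partialE v y : t / 4 < v -> partial1of2 F v y = f y * (v * v^-1 ^+ m * Lap v x y).
  by move=> v1; rewrite partial1of2E; have h := dF v y v1; rewrite derive_val.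
pose G y := K * `|f y|.
have lG : lint G by apply: lintZ; exact: lint_norm.
have iG : mu.-integrable (cube x (2 * t)) (EFin \o G) by case: lG => _; apply.
have G0 y : 0 <= G y by rewrite mulr_ge0.
have Gub v y : `]t / 4, (2 * t)[%classic v -> cube x (2 * t) y -> `|partial1of2 F v y| <= G y.
  rewrite /= in_itv/= => /andP[v1 v2] _; have v0 : 0 < v by lra.
  rewrite partialE// normrM mulrC ler_wpM2r// normrM.
  have vi : v^-1 <= (t / 4)^-1 by rewrite lef_pV2 ?posrE// ltW.
  have vi0 : 0 <= v^-1 by rewrite invr_ge0 ltW.
  rewrite [`|v * _|]ger0_norm; last by rewrite mulr_ge0 ?(ltW v0)// exprn_ge0.
  apply: ler_pM => //; first by rewrite mulr_ge0 ?(ltW v0)// exprn_ge0.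
    by apply: ler_pM; rewrite ?(ltW v0) ?(ltW v2) ?exprn_ge0// lerXn2r// nnegrE ltW ?invr_gt0.
  apply: le_trans (HC v x y v0) _; apply: ler_wpM2l => //.
  by rewrite lerXn2r// nnegrE ltW ?invr_gt0.
apply: DeriveDef.
  exact: (derivable_under_integral mC Is iF derF G0 iG Gub).
have := differentiation_under_integral mC Is iF derF G0 iG Gub.
rewrite derive1E /cint => ->.
by apply: eq_Rintegral => y _; rewrite partialE.
Qed.

Lemma tensor_dot_le (e : 'rV[R]_n) (p : 'rV[R]_m) (G : 'I_n -> 'rV[R]_m) :
  \sum_i e ord0 i * \sum_k G i ord0 k * p ord0 k <=
  enorm e * (Num.sqrt (\sum_i enorm (G i) ^+ 2) * enorm p).
Proof.
apply: (@le_trans _ _ (\sum_i (`|e ord0 i| * enorm (G i)) * enorm p)).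
  apply: ler_sum => i _; apply: le_trans (ler_norm _) _.
  rewrite normrM -mulrA ler_wpM2l// ler_norml; apply/andP; split.
    rewrite lerNl -enormN; apply: le_trans (dot_le _ _).
    by rewrite -sumrN le_eqVlt; apply/orP; left; apply/eqP/eq_bigr => k _; rewrite mxE mulNr.
  exact: dot_le.
rewrite -mulr_suml mulrA ler_wpM2r ?enorm_ge0//.
apply: le_trans (cauchy_schwarz _ _) _.
rewrite ler_wpM2r ?sqrtr_ge0// /enorm ler_wsqrtr// le_eqVlt; apply/orP; left; apply/eqP.
by apply: eq_bigr => i _; rewrite real_normK// num_real.
Qed.

(** [G] represents the Laplacian of [u] as a divergence, tested against the radial
    function of radius [t] at [x]. *)
Definition div_test u (G : 'I_n -> V -> 'rV[R]_m) x t := forall i : 'I_n,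
  cint x t (fun y => u y ord0 i * Lap t x y) =
  - cint x t (fun y => \sum_k G i y ord0 k * partial k (Psi t x) y).

Definition step_const : R := c0^-1 * @gradC R m * 2 ^+ m.

Lemma step_const_ge0 : 0 <= step_const.
Proof. by rewrite !mulr_ge0 ?c0V_ge0 ?gradC_ge0 ?exprn_ge0. Qed.

Lemma lint_grad_norm (G : 'I_n -> V -> 'rV[R]_m) : (forall i, vlint (G i)) ->
  lint (grad_norm G).
Proof.
move=> lG.
have lE : vlint (fun y => \row_i enorm (G i y)).
  by move=> i; have := vlint_enorm (lG i); congr lint; apply/funext => y; rewrite mxE.
have := vlint_enorm lE; congr lint; apply/funext => y.
by rewrite /grad_norm /enorm; congr Num.sqrt; apply: eq_bigr => i _; rewrite mxE.
Qed.

Lemma lint_grad_Psi (k : 'I_m) x t (G : V -> 'rV[R]_m) : 0 < t ->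
  vlint G -> lint (fun y => G y ord0 k * partial k (Psi t x) y).
Proof.
move=> t0 lG; apply: (@lint_mul_bounded _ _ (@gradC R m * t^-1)) => //.
  exact: measurable_grad_Psi.
move=> y; apply: le_trans (grad_Psi_le x y t0).
by apply: le_trans (coord_le_enorm _ k); rewrite mxE.
Qed.

(** The mean value theorem in the scale [s], for the scalar function [e . moll s u x]
    where [e] is the difference to be estimated; [div_test] then replaces the Laplacian
    of the test function by its gradient, of size [1 / s]. *)
Lemma moll_step u (G : 'I_n -> V -> 'rV[R]_m) x t : 0 < t -> vlint u ->
  (forall i, vlint (G i)) ->
  (forall s, 0 < s -> s <= t -> div_test u G x s) ->
  enorm (moll t u x - moll (t / 2) u x) <=
  step_const * (t * t^-1 ^+ m) * cint x t (grad_norm G).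
Proof.
move=> t0 lu lG hG; set e := _ - _.
(* [e] is made opaque: it must be a constant vector when differentiating in [s]. *)
have eE : e = moll t u x - moll (t / 2) u x by []; clearbody e.
have lg := lint_grad_norm lG.
have g0 y : 0 <= grad_norm G y by exact: sqrtr_ge0.
have t20 : 0 < 2 * t by lra.
have c0p := @kern_mass_gt0 R m.
pose phi s := \sum_i e ord0 i * cint x (2 * t) (fun y => u y ord0 i * kern s x y).
have phiE s : 0 < s -> s <= 2 * t -> phi s = c0 * \sum_i e ord0 i * (moll s u x) ord0 i.
  move=> s0 s1; rewrite mulr_sumr; apply: eq_bigr => i _.
  rewrite /moll (vcint_support _ s0 (subcube_same x s1)) !mxE mulrCA; congr (_ * _).
  rewrite mulVKf ?gt_eqF//; apply: eq_cint => y _.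
  by rewrite mxE mulrC.
pose D s i := cint x (2 * t) (fun y => u y ord0 i * (s * s^-1 ^+ m * Lap s x y)).
have dphi s : t / 4 < s -> s < 2 * t -> is_derive s (1 : R) phi (\sum_i e ord0 i * D s i).
  move=> s1 s2.
  have h i : is_derive s (1 : R) (fun s => e ord0 i * cint x (2 * t) (fun y => u y ord0 i * kern s x y)) (e ord0 i * D s i).
    have hd := is_deriveM (is_derive_cst (e ord0 i) s (1 : R)) (is_derive_cint_kern x t0 (lu i) s1 s2).
    by apply: (is_derive_eq hd); rewrite scaler0 addr0.
  have := is_derive_sum h; congr (is_derive _ _ _ _).
  by apply/funext => v; rewrite fct_sumE.
have tt : t / 2 < t by lra.
have cphi : {within `[t / 2, t], continuous phi}.
  apply: continuous_in_subspaceT => s; rewrite inE/= in_itv/= => /andP[s1 s2].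
  apply: differentiable_continuous; apply/derivable1_diffP.
  have s3 : t / 4 < s by lra. have s4 : s < 2 * t by lra.
  by case: (dphi s s3 s4).
clearbody phi.
have dphi' s : s \in `]t / 2, t[ -> is_derive s (1 : R) phi (\sum_i e ord0 i * D s i).
  by rewrite in_itv/= => /andP[s1 s2]; apply: dphi; lra.
have [c + E] := MVT tt dphi' cphi.
rewrite in_itv/= => /andP[c1 c2]; have cp : 0 < c by lra.
have hGc := hG c cp (ltW c2).
have DE i : D c i = - (c * c^-1 ^+ m) * cint x c (fun y => \sum_k G i y ord0 k * partial k (Psi c x) y).
  rewrite mulNr -mulrN -hGc /D.
  have lL : lint (fun y => u y ord0 i * Lap c x y).
    have [C [C00 HC]] := @Lap_bound R m.
    apply: (@lint_mul_bounded _ _ (C * c^-1 ^+ 2)) => //; first exact: measurable_Lap.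
    by move=> y; exact: HC.
  rewrite -cintZ//.
  rewrite (@eq_cint _ _ x (2 * t) _ (fun y => c * c^-1 ^+ m * (u y ord0 i * Lap c x y))); last first.
    by move=> y _; ring.
  apply: Rintegral_support; first by apply/subcube_sub/subcube_same; lra.
  by move=> y _ ny; rewrite Lap_out// !mulr0.
have cm0 : 0 <= c * c^-1 ^+ m by rewrite mulr_ge0 ?(ltW cp)// exprn_ge0// invr_ge0 ltW.
have cI0 : 0 <= cint x c (grad_norm G) by exact: cint_ge0.
have S : \sum_i e ord0 i * D c i <=
    c * c^-1 ^+ m * (enorm e * (@gradC R m * c^-1) * cint x c (grad_norm G)).
  under eq_bigr do rewrite DE mulrCA.
  rewrite -mulr_sumr mulNr -mulrN ler_wpM2l// -sumrN.
  have ls i : lint (fun y => \sum_k G i y ord0 k * partial k (Psi c x) y).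
    by apply: lint_sum => k; exact: (lint_grad_Psi k x cp (lG i)).
  rewrite (eq_bigr (fun i => cint x c (fun y => (- e) ord0 i * \sum_k G i y ord0 k * partial k (Psi c x) y))); last first.
    by move=> i _; rewrite cintZ// mxE mulNr.
  rewrite -cint_sum//; last by move=> i; exact: lintZ.
  rewrite -cintZ//; apply: le_cint => //.
  - by apply: lint_sum => i; exact: lintZ.
  - exact: lintZ.
  move=> y _.
  have := tensor_dot_le (- e) (\row_k partial k (Psi c x) y) (G^~ y).
  rewrite enormN => h; apply: le_trans (le_trans _ h) _.
    by apply: ler_sum => i _; apply: eq_ler; congr (_ * _); apply: eq_bigr => k _; rewrite [in RHS]mxE.
  rewrite -mulrA ler_wpM2l ?enorm_ge0// mulrC ler_wpM2r//.
  exact: grad_Psi_le.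
have e2 : c0 * enorm e ^+ 2 <= t / 2 * (c * c^-1 ^+ m * (enorm e * (@gradC R m * c^-1) * cint x c (grad_norm G))).
  have -> : c0 * enorm e ^+ 2 = phi t - phi (t / 2).
    have th0 : 0 < t / 2 by lra. have t1 : t <= 2 * t by lra.
    have th1 : t / 2 <= 2 * t by lra.
    rewrite (phiE t t0 t1) (phiE (t / 2) th0 th1).
    rewrite -mulrBr -sumrB enorm_sqr; congr (_ * _); apply: eq_bigr => i _.
    by rewrite -mulrBr expr2 {2}eE; congr (_ * _); rewrite !mxE.
  rewrite E mulrC; have -> : t - t / 2 = t / 2 by lra.
  by rewrite ler_wpM2l//; lra.
have [e0|e0] := eqVneq (enorm e) 0.
  have tm0 : 0 <= t * t^-1 ^+ m by rewrite mulr_ge0 ?(ltW t0)// exprn_ge0// invr_ge0 ltW.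
  have It0 : 0 <= cint x t (grad_norm G) by exact: cint_ge0.
  by rewrite e0; exact: (mulr_ge0 (mulr_ge0 step_const_ge0 tm0) It0).
have ep : 0 < enorm e by rewrite lt_def e0 enorm_ge0.
have ci : cint x c (grad_norm G) <= cint x t (grad_norm G).
  by apply: cint_subset => //; apply: subcube_same; exact: ltW.
have cV : c^-1 <= 2 * t^-1.
  rewrite -[2]invrK -invfM lef_pV2 ?posrE; lra.
have cVm : c^-1 ^+ m <= 2 ^+ m * t^-1 ^+ m.
  by rewrite -exprMn lerXn2r// nnegrE ?mulr_ge0 ?invr_ge0 ?(ltW cp) ?(ltW t0).
have e3 : c0 * enorm e <= t / 2 * (c^-1 ^+ m * (@gradC R m * cint x c (grad_norm G))).
  rewrite -(ler_pM2r ep); move: e2; rewrite expr2 mulrA => e2; apply: le_trans e2 _.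
  apply: eq_ler; field; exact: lt0r_neq0.
rewrite -(ler_pM2l c0p); apply: le_trans e3 _.
rewrite /step_const; set I1 := cint x c _ in cI0 ci *; set I2 := cint x t _ in ci *.
have -> : c0 * (c0^-1 * @gradC R m * 2 ^+ m * (t * t^-1 ^+ m) * I2) =
   t * ((2 ^+ m * t^-1 ^+ m) * (@gradC R m * I2)).
  by field; exact: lt0r_neq0.
apply: ler_pM; [lra| |lra|].
  by rewrite !mulr_ge0 ?gradC_ge0 ?exprn_ge0 ?invr_ge0 ?(ltW cp).
apply: ler_pM => //.
- by rewrite exprn_ge0// invr_ge0 ltW.
- by rewrite mulr_ge0 ?gradC_ge0.
- by rewrite ler_wpM2l ?gradC_ge0.
Qed.

End moll.

(** * Decay of the oscillation *)
Section oscillation_decay.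
Context {R : realType} {m n : nat}.
Local Notation V := 'rV[R]_m.
Local Notation mu := (lebesgue_rV R m).
Local Notation c0 := (@kern_mass R m).
Implicit Types (u v w : V -> 'rV[R]_n) (g : V -> R) (x a : V) (t r rho th : R).

Lemma vlint_weight u : vlint u -> pair_weight (fun x y => enorm (u x - u y)).
Proof.
move=> lu; split=> [|x y]; last exact: enorm_ge0.
apply: measurable_enorm => i; under eq_fun do rewrite !mxE.
apply: measurable_funB.
  exact: (measurableT_comp (lu i).1 measurable_fst).
exact: (measurableT_comp (lu i).1 measurable_snd).
Qed.

Lemma vlint_vanishing u : vlint u -> vanishing (fun x y => enorm (u x - u y)).
Proof.
move=> lu.
have [wS vS] := @vanishing_sum R m _ (index_enum 'I_n) (fun i => adist (fun x => u x ord0 i))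
  (fun i => adist_weight (lu i).1)
  (fun i => vanishing_integrable (lu i).1 (lu i).2).
apply: vanishingS wS _ vS; first exact: vlint_weight.
move=> x y; apply: le_trans (enorm_le_sum _) _.
by apply: ler_sum => i _; rewrite /adist !mxE.
Qed.

Lemma measurable_dist u v :
  (forall i, measurable_fun setT (fun x => u x ord0 i)) ->
  (forall i, measurable_fun setT (fun x => v x ord0 i)) ->
  measurable_fun setT (fun x : V => (enorm (u x - v x))%:E).
Proof.
move=> mu_ mv; apply/measurable_EFinP/measurable_enorm => i.
by under eq_fun do rewrite !mxE; exact: measurable_funB.
Qed.

Lemma integral_dist_triangle (A : set V) u v w : measurable A ->
  (forall i, measurable_fun setT (fun x => u x ord0 i)) ->
  (forall i, measurable_fun setT (fun x => v x ord0 i)) ->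
  (forall i, measurable_fun setT (fun x => w x ord0 i)) ->
  (\int[mu]_(x in A) (enorm (u x - w x))%:E <=
   \int[mu]_(x in A) (enorm (u x - v x))%:E +
   \int[mu]_(x in A) (enorm (v x - w x))%:E)%E.
Proof.
move=> mA mu_ mv mw.
have p (f h : V -> 'rV[R]_n) x : (0 <= (enorm (f x - h x))%:E)%E by rewrite lee_fin enorm_ge0.
rewrite -ge0_integralD//; try by apply: measurable_funTS; exact: measurable_dist.
apply: ge0_le_integral => //.
- by apply: measurable_funTS; exact: measurable_dist.
- by apply: emeasurable_funD; apply: measurable_funTS; exact: measurable_dist.
by move=> x _; rewrite -EFinD lee_fin; exact: enorm_distD.
Qed.

(** [moll s u x - u x] is bounded by the mean of [|u y - u x|] over the cube of
    half-side [s]. *)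
Lemma moll_vanishing u a r e : vlint u -> 0 < r -> 0 < e ->
  exists d, 0 < d /\ forall s, 0 < s -> s < d ->
    (\int[mu]_(x in cube a r) (enorm (moll s u x - u x))%:E <= e%:E)%E.
Proof.
move=> lu r0 e0; pose C := c0^-1 * @kernC R m.
have C0 : 0 <= C by rewrite mulr_ge0 ?c0V_ge0 ?kernC_ge0.
pose e' := e / ((C + 1) * 2 ^+ m).
have e'0 : 0 < e' by rewrite divr_gt0// mulr_gt0// ?exprn_gt0//; lra.
have [d [d0 Hd]] := vlint_vanishing lu a r0 e'0.
exists d; split=> // s s0 sd.
have w := vlint_weight lu.
have Cs0 : 0 <= C * s^-1 ^+ m by rewrite mulr_ge0// exprn_ge0// invr_ge0 ltW.
apply: (@le_trans _ _ ((C * s^-1 ^+ m)%:E * pairint (fun x y => enorm (u x - u y)) s (cube a r))%E).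
  rewrite -ge0_integralZl//; last 3 first.
  - exact: measurable_cube.
  - by apply: measurable_funTS; exact: measurable_inner.
  - by move=> x _; apply: integral_ge0 => y _; rewrite lee_fin enorm_ge0.
  apply: ge0_le_integral.
  - exact: measurable_cube.
  - by move=> x _; rewrite lee_fin enorm_ge0.
  - apply: measurable_funTS; apply: measurable_dist; first exact: measurable_moll.
    by move=> i; case: (lu i).
  - by apply: measurable_funeM; apply: measurable_funTS; exact: measurable_inner.
  move=> x _.
  have -> : (\int[mu]_(y in cube x s) (enorm (u x - u y))%:E =
      (cint x s (fun y => enorm (u y - u x)))%:E)%E.
    rewrite -(cint_EFin x s0 (lint_dist (u x) lu)).
    by apply: eq_integral => y _; rewrite enormB.
  by rewrite -EFinM lee_fin; exact: moll_sub.
apply: (@le_trans _ _ ((C * s^-1 ^+ m)%:E * (e' * (s *+ 2) ^+ m)%:E)%E).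
  by rewrite lee_wpmul2l ?lee_fin//; exact: Hd.
rewrite -EFinM lee_fin -mulr_natl exprMn.
have -> : C * s^-1 ^+ m * (e' * (2 ^+ m * s ^+ m)) = C * (e' * 2 ^+ m).
  rewrite exprVn; field; exact/lt0r_neq0/exprn_gt0.
have -> : e' * 2 ^+ m = e / (C + 1).
  have C1 : C + 1 != 0 by rewrite lt0r_neq0//; lra.
  by rewrite /e' invfM -!mulrA [_^-1 * 2 ^+ m]mulVf ?mulr1// expf_neq0.
rewrite mulrCA ger_pMr// ler_pdivrMr; lra.
Qed.

(** Telescoping over the dyadic scales; the sum over the scales converges because the
    step at scale [s] gains a factor [s] in the mean. *)
Lemma moll_approx K a r t u g : 0 <= K -> 0 < r -> 0 < t -> vlint u ->
  lint g -> (forall x, 0 <= g x) ->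
  (forall x s, cube a r x -> 0 < s -> s <= t ->
    enorm (moll s u x - moll (s / 2) u x) <= K * (s * s^-1 ^+ m) * cint x s g) ->
  (\int[mu]_(x in cube a r) (enorm (u x - moll t u x))%:E <=
    (K * 2 ^+ m * (2 * t) * cint a (r + t) g)%:E)%E.
Proof.
move=> K0 r0 t0 lu lg g0 Hs.
have mC := measurable_cube a r.
have rt0 : 0 < r + t by lra.
pose I0 := cint a (r + t) g.
have I00 : 0 <= I0 by exact: cint_ge0.
have K2 : 0 <= K * 2 ^+ m by rewrite mulr_ge0 ?exprn_ge0.
pose s k : R := t * 2^-1 ^+ k.
have s0 k : 0 < s k by rewrite mulr_gt0 ?exprn_gt0.
have st k : s k <= t by rewrite ler_piMr ?(ltW t0)// exprn_ile1//; lra.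
have mm k := measurable_moll (s0 k) lu.
have mU : forall i, measurable_fun setT (fun x => u x ord0 i) by move=> i; case: (lu i).
have sS k : s k.+1 = s k / 2 by rewrite /s exprS; ring.
have step k : (\int[mu]_(x in cube a r) (enorm (moll (s k) u x - moll (s k.+1) u x))%:E <=
    (K * 2 ^+ m * s k * I0)%:E)%E.
  have Ks0 : 0 <= K * (s k * (s k)^-1 ^+ m).
    have sm0 : 0 <= (s k)^-1 ^+ m by rewrite exprn_ge0// invr_ge0 ltW.
    exact: (mulr_ge0 K0 (mulr_ge0 (ltW (s0 k)) sm0)).
  have mg : measurable_fun setT (EFin \o g) by apply/measurable_EFinP; case: lg.
  apply: (@le_trans _ _ ((K * (s k * (s k)^-1 ^+ m))%:E *
      \int[mu]_(x in cube a r) \int[mu]_(y in cube x (s k)) (g y)%:E)%E).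
    have mI : measurable_fun setT (fun x => \int[mu]_(y in cube x (s k)) (g y)%:E)%E.
      apply: (@measurable_integral_cube _ _ (s k) (fun z => (g z.2)%:E)).
        exact: (measurableT_comp mg measurable_snd).
      by move=> z; rewrite lee_fin.
    rewrite -ge0_integralZl//; last 2 first.
    - exact: measurable_funTS.
    - by move=> x _; apply: integral_ge0 => y _; rewrite lee_fin.
    apply: ge0_le_integral => //.
    - by move=> x _; rewrite lee_fin enorm_ge0.
    - by apply: measurable_funTS; apply: measurable_dist; exact: mm.
    - by apply: measurable_funeM; exact: measurable_funTS.
    by move=> x xa; rewrite cint_EFin// -EFinM lee_fin sS; exact: Hs.
  apply: (@le_trans _ _ ((K * (s k * (s k)^-1 ^+ m))%:E * ((s k *+ 2) ^+ m * I0)%:E)%E).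
    rewrite lee_wpmul2l ?lee_fin// EFinM /I0 -cint_EFin//.
    apply: integral_moving_cube => //; try exact: measurable_cube.
      move=> x /cube_subcube h; apply: subcube_sub; apply: subcube_trans (h (s k)) _.
      by apply: subcube_same; rewrite lerD2l.
  rewrite -EFinM lee_fin -[s k *+ 2]mulr_natl exprMn; apply: eq_ler.
  move: (s0 k); move: (s k) => v v0; have vm : v ^+ m != 0 by exact/lt0r_neq0/exprn_gt0.
  by rewrite exprVn; field.
have tele k : (\int[mu]_(x in cube a r) (enorm (moll t u x - moll (s k) u x))%:E <=
    (K * 2 ^+ m * (2 * t - 2 * s k) * I0)%:E)%E.
  elim: k => [|k IH].
    rewrite /s expr0 mulr1; under eq_integral do rewrite subrr enorm0.
    by rewrite integral0 subrr mulr0 mul0r.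
  apply: le_trans (integral_dist_triangle mC _ (mm k) (mm k.+1)) _; first exact: measurable_moll.
  apply: le_trans (leeD IH (step k)) _; rewrite -EFinD lee_fin sS; apply: eq_ler.
  by field.
apply/lee_addgt0Pr => e e0.
have [d [d0 Hd]] := moll_vanishing a lu r0 e0.
have [k kd] : exists k, s k < d.
  have [k hk] : exists k : nat, t / d < k%:R.
    by exists (Num.truncn (t / d)).+1; exact: truncnS_gt.
  exists k; rewrite /s exprVn ltr_pdivrMr ?exprn_gt0//.
  rewrite mulrC -ltr_pdivrMr//; apply: lt_trans hk _.
  by rewrite -natrX ltr_nat; exact: ltn_expl.
apply: (@le_trans _ _ (\int[mu]_(x in cube a r) (enorm (moll t u x - u x))%:E)%E).
  by under eq_integral do rewrite enormB.
apply: le_trans (integral_dist_triangle mC _ (mm k) mU) _; first exact: measurable_moll.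
apply: leeD (Hd (s k) (s0 k) kd); apply: le_trans (tele k) _.
rewrite lee_fin -/I0 ler_wpM2r// ler_wpM2l//.
by have := s0 k; lra.
Qed.

Definition decay_const : R := 2 * (c0^-1 * @kernL R m * (4 ^+ m * 12 * m%:R ^+ 2)) + 2 * @step_const R m.

Lemma enorm_cube a r x : 0 < r -> cube a r x -> enorm (x - a) <= m%:R * r.
Proof.
move=> r0 /cubeP ax; apply: le_trans (enorm_le_sum _) _.
apply: (@le_trans _ _ (\sum_(i < m) r)); last by rewrite sumr_const card_ord mulr_natl.
by apply: ler_sum => i _; rewrite !mxE ler_norml; have := ax i; lra.
Qed.

Lemma decay_const_ge0 : 0 <= decay_const.
Proof.
have h1 : 0 <= c0^-1 * @kernL R m * (4 ^+ m * 12 * m%:R ^+ 2).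
  by apply: mulr_ge0; [rewrite mulr_ge0 ?c0V_ge0 ?kernL_ge0|rewrite !mulr_ge0 ?exprn_ge0].
have := @step_const_ge0 R m; rewrite /decay_const; lra.
Qed.

(** The average at scale [rho / 2] is Lipschitz with constant of order
    [osc a rho u / rho], hence oscillates little on the cube of half-side [th * rho];
    [moll_approx] bounds the distance of [u] from it. *)
Lemma osc_decay a rho th u g : 0 < rho -> 0 < th -> th <= 2^-1 -> vlint u ->
  lint g -> (forall x, 0 <= g x) ->
  (forall x s, 0 < s -> subcube x s a rho ->
    enorm (moll s u x - moll (s / 2) u x) <= @step_const R m * (s * s^-1 ^+ m) * cint x s g) ->
  osc a (th * rho) u <= decay_const * th * osc a rho u +
    decay_const * th^-1 ^+ m * (rho * rho^-1 ^+ m * cint a rho g).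
Proof.
move=> rho0 th0 th1 lu lg g0 Hs.
pose t := rho / 2; pose r := th * rho.
have t0 : 0 < t by rewrite /t; lra.
have r0 : 0 < r by exact: mulr_gt0.
have rt : r <= t by rewrite /r /t mulrC ler_wpM2l// ltW.
have rtr : r + t <= rho by rewrite /t in rt *; lra.
pose A := avg a rho u.
pose O := osc a rho u.
have O0 : 0 <= O by exact: osc_ge0.
pose K := @step_const R m.
have K0 : 0 <= K := @step_const_ge0 R m.
pose W := c0^-1 * @kernL R m * (4 ^+ m * 12 * m%:R ^+ 2).
have W0 : 0 <= W.
  by apply: mulr_ge0; [rewrite mulr_ge0 ?c0V_ge0 ?kernL_ge0|rewrite !mulr_ge0 ?exprn_ge0].
have ar : subcube a r a rho by apply: subcube_same; lra.
have at_ : subcube a t a rho by apply: subcube_same; rewrite /t; lra.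
have xt x : cube a r x -> subcube x t a rho.
  move=> /cube_subcube h; apply: subcube_trans (h t) _; exact: subcube_same.
have lip x : cube a r x -> enorm (moll t u x - moll t u a) <= W * th * O.
  move=> xa.
  pose L := @kernL R m * t^-1 ^+ m * (m%:R * r * (3 * m%:R * rho) * t^-1 ^+ 2).
  have t1 : 0 <= t^-1 by rewrite invr_ge0 ltW.
  have L0 : 0 <= L.
    have h1 : 0 <= @kernL R m * t^-1 ^+ m by rewrite mulr_ge0 ?kernL_ge0 ?exprn_ge0.
    have h2 : 0 <= m%:R * r * (3 * m%:R * rho) * t^-1 ^+ 2.
      by apply: mulr_ge0 (exprn_ge0 2 t1); rewrite !mulr_ge0 ?(ltW th0) ?(ltW rho0).
    exact: mulr_ge0.
  have HL y : cube a rho y -> `|kern t x y - kern t a y| <= L.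
    move=> ya; apply: le_trans (kern_lip x a y t0) _.
    apply: ler_wpM2l; first by rewrite mulr_ge0 ?kernL_ge0 ?exprn_ge0.
    apply: ler_wpM2r; first exact: exprn_ge0.
    have h1 := enorm_cube r0 xa; have h2 := enorm_cube rho0 ya.
    apply: ler_pM => //; rewrite ?enorm_ge0 ?addr_ge0 ?enorm_ge0//.
    have h3 : enorm (y - x) <= enorm (y - a) + enorm (a - x) by exact: enorm_distD.
    rewrite (enormB a x) in h3.
    have h4 : m%:R * r <= m%:R * rho by apply: ler_wpM2l => //; lra.
    lra.
  apply: le_trans (moll_dist A rho0 t0 L0 lu (xt x xa) at_ HL) _.
  have vr := @vol_gt0 R m rho rho0.
  have -> : cint a rho (fun y => enorm (u y - A)) = @vol R m rho * O.
    by rewrite /O /osc /mean_dist mulrA divff ?mul1r// lt0r_neq0.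
  apply: eq_ler; rewrite /W /L /vol -[rho *+ 2]mulr_natl exprMn /t invfM invrK exprMn /r.
  rewrite (_ : 4 = 2 * 2) ?exprMn; last by ring.
  by rewrite (exprVn rho); field; rewrite lt0r_neq0 ?lt0r_neq0 ?exprn_gt0//; exact: kern_mass_gt0.
pose z0 := moll t u a.
have mm := measurable_moll t0 lu.
have mU : forall i, measurable_fun setT (fun x => u x ord0 i) by move=> i; case: (lu i).
have approx : cint a r (fun x => enorm (u x - z0)) <=
    K * 2 ^+ m * (2 * t) * cint a rho g + W * th * O * @vol R m r.
  rewrite -lee_fin -(cint_EFin a r0 (lint_dist z0 lu)).
  have mC := measurable_cube a r.
  apply: le_trans (@integral_dist_triangle _ u (moll t u) (fun=> z0) mC mU mm _) _.
    by move=> i; exact: measurable_cst.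
  rewrite EFinD; apply: leeD.
    apply: (@le_trans _ _ (K * 2 ^+ m * (2 * t) * cint a (r + t) g)%:E).
      apply: moll_approx => //.
      move=> x s xa s0 st; apply: Hs => //; apply: subcube_trans (xt x xa).
      exact: subcube_same.
    rewrite lee_fin; apply: ler_wpM2l.
      have t2 : 0 <= 2 * t by lra.
      have m2 : 0 <= 2 ^+ m :> R by exact: exprn_ge0.
      exact: (mulr_ge0 (mulr_ge0 K0 m2) t2).
    by apply: cint_subset => //; [lra|exact: subcube_same].
  rewrite EFinM /vol -(@integral_cube_cst R m a r (W * th * O)%:E r0).
  apply: ge0_le_integral => //.
  - by move=> x _; rewrite lee_fin enorm_ge0.
  - exact: measurable_funTS (@measurable_dist (moll t u) (fun=> z0) mm (fun i => measurable_cst _)).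
apply: le_trans (osc_le_mean_dist a z0 r0 lu) _.
have vr := @vol_gt0 R m r r0.
apply: (@le_trans _ _ (2 * ((@vol R m r)^-1 * (K * 2 ^+ m * (2 * t) * cint a rho g + W * th * O * @vol R m r)))).
  by rewrite ler_wpM2l// /mean_dist ler_wpM2l// invr_ge0 ltW.
have I0 : 0 <= cint a rho g by exact: cint_ge0.
have -> : 2 * ((@vol R m r)^-1 * (K * 2 ^+ m * (2 * t) * cint a rho g + W * th * O * @vol R m r)) =
    2 * W * (th * O) + 2 * K * (th^-1 ^+ m * (rho * rho^-1 ^+ m * cint a rho g)).
  rewrite /t /vol -[r *+ 2]mulr_natl exprMn /r exprMn !exprVn; field.
  by rewrite !lt0r_neq0 ?exprn_gt0.
have D1 : 2 * W <= decay_const by rewrite /decay_const -/W -/K; lra.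
have D2 : 2 * K <= decay_const by rewrite /decay_const -/W -/K; lra.
have th2 : 0 <= th^-1 ^+ m by rewrite exprn_ge0// invr_ge0 ltW.
have rho2 : 0 <= rho^-1 ^+ m by rewrite exprn_ge0// invr_ge0 ltW.
rewrite -(mulrA decay_const th) -(mulrA decay_const (th^-1 ^+ m)).
apply: lerD; apply: ler_wpM2r => //; first by apply: mulr_ge0 => //; exact: ltW.
exact: (mulr_ge0 th2 (mulr_ge0 (mulr_ge0 (ltW rho0) rho2) I0)).
Qed.

End oscillation_decay.

(** * Exponential integrability of the oscillation *)
Section john_nirenberg.
Context {R : realType} {m n : nat}.
Local Notation V := 'rV[R]_m.
Local Notation mu := (lebesgue_rV R m).
Local Notation vol := (@vol R m).
Implicit Types (u : V -> 'rV[R]_n) (a : V) (r : R) (phi psi : V -> R -> R).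

(** The mean of [phi] over the [2^(m k)] dyadic descendants of generation [k]. *)
Fixpoint dyad (k : nat) phi a r : R :=
  if k is k'.+1 then
    2^-1 ^+ m * \sum_(b : {ffun 'I_m -> bool}) dyad k' phi (child a r b) (r / 2)
  else phi a r.

Lemma card_children : #|{ffun 'I_m -> bool}| = (2 ^ m)%N.
Proof. by rewrite card_ffun card_bool card_ord. Qed.

Lemma mean_cst (c : R) : 2^-1 ^+ m * (\sum_(b : {ffun 'I_m -> bool}) c) = c.
Proof.
rewrite sumr_const card_children -[c *+ _]mulr_natl natrX mulrA -exprMn mulVf ?expr1n ?mul1r//.
Qed.

Lemma le_mean (F G : {ffun 'I_m -> bool} -> R) : (forall b, F b <= G b) ->
  2^-1 ^+ m * (\sum_b F b) <= 2^-1 ^+ m * (\sum_b G b).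
Proof. by move=> FG; rewrite ler_wpM2l ?exprn_ge0//; exact: ler_sum. Qed.

Lemma le_dyad k phi psi a r : (forall a r, phi a r <= psi a r) ->
  dyad k phi a r <= dyad k psi a r.
Proof.
move=> h; elim: k a r => [|k IH] a r //=; exact: le_mean.
Qed.

Lemma dyad_affine k (c d : R) phi a r :
  dyad k (fun a r => c * (phi a r + d)) a r = c * (dyad k phi a r + d).
Proof.
elim: k a r => [|k IH] a r //=.
under eq_bigr do rewrite IH; rewrite -mulr_sumr big_split/= mulrCA mulrDr mean_cst.
by [].
Qed.

Lemma vol_half r : vol (r / 2) = 2^-1 ^+ m * vol r.
Proof. by rewrite /vol -exprMn; congr (_ ^+ _); lra. Qed.

Lemma mean_dist_children a r u z : 0 < r -> vlint u ->
  mean_dist a r u z = 2^-1 ^+ m * \sum_(b : {ffun 'I_m -> bool}) mean_dist (child a r b) (r / 2) u z.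
Proof.
move=> r0 lu; rewrite /mean_dist (cint_children a r0 (lint_dist z lu)).
rewrite -mulr_sumr vol_half mulrA; congr (_ * _).
have v0 := @vol_gt0 R m r r0; have p0 : 2^-1 ^+ m != 0 :> R by rewrite expf_neq0.
by field; rewrite p0 lt0r_neq0.
Qed.

Lemma powRD_le (x y q : R) : 0 <= x -> 0 <= y -> 0 <= q ->
  (x + y) `^ q <= 2 `^ q * (x `^ q + y `^ q).
Proof.
move=> x0 y0 q0; wlog xy : x y x0 y0 / x <= y.
  by move=> W; have [|/ltW] := leP x y; [exact: W|rewrite addrC [x `^ q + _]addrC; exact: W].
apply: (@le_trans _ _ ((2 * y) `^ q)).
  by apply: ge0_ler_powR; rewrite ?nnegrE ?mulr_ge0 ?addr_ge0//; lra.
by rewrite powRM// ler_wpM2l ?powR_ge0// lerDr powR_ge0.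
Qed.

(** In units of the oscillation, the threshold at which the recursion of [jn_dyad]
    restarts; with the exponent [q + 1], the factor
    [2^q] lost in a restart leaves a factor [1 / 2]. *)
Definition jn_level (q : R) : R := 2 `^ (q + 1).
Definition jn_const (q : R) : R := 2 * jn_level q `^ q + (jn_level q + 2 ^+ m) `^ q.

Lemma jn_const_ge0 q : 0 <= jn_const q.
Proof. by rewrite addr_ge0 ?mulr_ge0 ?powR_ge0. Qed.

(** Descend the dyadic tree until an average leaves the ball of radius [lam] around
    [z]: that happens on a set of cubes of small relative measure, on each of which the
    estimate around its own average takes over. *)
Lemma jn_dyad u a0 r0 (S q : R) k a r : vlint u -> 0 < S -> 0 < q -> 0 < r ->
  (forall a' r', 0 < r' -> subcube a' r' a0 r0 -> osc a' r' u <= S) ->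
  subcube a r a0 r0 ->
  dyad k (fun a' r' => enorm (avg a' r' u - avg a r u) `^ q) a r <= jn_const q * S `^ q.
Proof.
move=> lu S0 q0 + hS.
pose lam := jn_level q * S.
have L0 : 0 < jn_level q by rewrite powR_gt0.
have lam0 : 0 < lam by exact: mulr_gt0.
pose D := jn_const q * S `^ q.
have D0 : 0 <= D by rewrite mulr_ge0 ?jn_const_ge0 ?powR_ge0.
pose B := (lam + 2 ^+ m * S) `^ q.
have B0 : 0 <= B := powR_ge0 _ _.
have DE : D = 2 * lam `^ q + B.
  rewrite /D /jn_const /B /lam -[jn_level q * S + _]mulrDl !powRM ?addr_ge0 ?exprn_ge0 ?(ltW L0) ?(ltW S0)//.
  by ring.
pose K := 2 `^ q * (D + B) / lam.
have K0 : 0 <= K by rewrite !mulr_ge0 ?powR_ge0 ?addr_ge0 ?invr_ge0 ?(ltW lam0).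
have mono x y : 0 <= x -> x <= y -> x `^ q <= y `^ q.
  by move=> x0 xy; apply: ge0_ler_powR; rewrite ?nnegrE ?(ltW q0)// (le_trans x0).
pose P k := forall a r, 0 < r -> subcube a r a0 r0 ->
  dyad k (fun a' r' => enorm (avg a' r' u - avg a r u) `^ q) a r <= D.
pose Q k := forall a r z, 0 < r -> subcube a r a0 r0 -> enorm (avg a r u - z) <= lam ->
  dyad k (fun a' r' => enorm (avg a' r' u - z) `^ q) a r <= lam `^ q + K * mean_dist a r u z.
have QP k' : Q k' -> P k'.
  move=> hQ a' r' r'0 s'.
  have hz : enorm (avg a' r' u - avg a' r' u) <= lam.
    by rewrite (subrr (avg a' r' u)) enorm0 ltW.
  apply: le_trans (hQ a' r' (avg a' r' u) r'0 s' hz) _.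
  have h1 : K * mean_dist a' r' u (avg a' r' u) <= K * S.
    by apply: ler_wpM2l => //; exact: hS.
  (* This is where the value of [jn_level] is used. *)
  have h2 : K * S = 2^-1 * (D + B).
    rewrite /K /lam /jn_level powRD ?powRr1//; last by rewrite pnatr_eq0 implybT.
    by field; rewrite lt0r_neq0// lt0r_neq0// powR_gt0.
  by rewrite h2 in h1; rewrite DE in h1 *; lra.
suff [hP _] : P k /\ Q k by move=> ? ?; exact: hP.
elim: k => [|k [IHP IHQ]].
  have Q0 : Q 0%N.
    move=> a' r' z r'0 s' h /=; apply: le_trans (mono _ _ (enorm_ge0 _) h) _.
    by rewrite lerDl mulr_ge0// mean_dist_ge0.
  by split => //; exact: QP.
suff QS : Q k.+1 by split => //; exact: QP.
move=> a' r' z r'0 s' hz /=.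
rewrite (mean_dist_children a' z r'0 lu) [K * _]mulrCA -{1}(mean_cst (lam `^ q)) -mulrDr.
rewrite [K * _]mulr_sumr -big_split/=; apply: le_mean => b.
have r20 : 0 < r' / 2 by rewrite divr_gt0.
have sb := subcube_child a' b r'0.
have sb0 := subcube_trans sb s'.
have [h|h] := leP (enorm (avg (child a' r' b) (r' / 2) u - z)) lam; first exact: IHQ.
set A := avg (child a' r' b) (r' / 2) u in h *.
have hA : enorm (A - avg a' r' u) <= 2 ^+ m * S.
  apply: le_trans (avg_subcube r20 r'0 lu sb) _.
  have v0 := @vol_gt0 R m r' r'0.
  have -> : vol r' / vol (r' / 2) = 2 ^+ m.
    rewrite vol_half invfM exprVn invrK mulrCA divff ?mulr1// lt0r_neq0//.
  by rewrite ler_wpM2l ?exprn_ge0//; exact: hS.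
have hAz : enorm (A - z) <= lam + 2 ^+ m * S.
  apply: le_trans (enorm_distD (avg a' r' u) A z) _.
  by rewrite addrC; exact: lerD hz hA.
apply: (@le_trans _ _ (dyad k (fun a'' r'' => 2 `^ q *
    (enorm (avg a'' r'' u - A) `^ q + enorm (A - z) `^ q)) (child a' r' b) (r' / 2))).
  apply: le_dyad => a'' r''.
  apply: le_trans (powRD_le (enorm_ge0 _) (enorm_ge0 _) (ltW q0)).
  by apply: mono; [exact: enorm_ge0|exact: enorm_distD].
rewrite dyad_affine.
apply: (@le_trans _ _ (2 `^ q * (D + B))).
  rewrite ler_wpM2l ?powR_ge0// lerD//; first exact: IHP.
  by apply: mono => //; exact: enorm_ge0.
have -> : 2 `^ q * (D + B) = K * lam by rewrite /K divfK// lt0r_neq0.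
apply: (@le_trans _ _ (K * mean_dist (child a' r' b) (r' / 2) u z)); last by rewrite lerDr powR_ge0.
rewrite ler_wpM2l//; apply: le_trans (ltW h) _; exact: avg_dist.
Qed.

(** The average over a dyadic cube of half-side [s] is compared with [u x] for every [x]
    in that cube; all its points lie in the cube of half-side [2 s] around [x]. *)
Lemma dyad_osc_le u k a r : vlint u -> 0 < r ->
  ((vol r * dyad k (fun a' r' => osc a' r' u) a r)%:E <=
   ((vol (r * 2^-1 ^+ k))^-1)%:E *
     pairint (fun x y => enorm (u x - u y)) (2 * (r * 2^-1 ^+ k)) (cube a r))%E.
Proof.
move=> lu; have w := vlint_weight lu; elim: k a r => [|k IH] a r r0 /=.
  have v0 := @vol_gt0 R m r r0.
  rewrite expr0 mulr1 /osc /mean_dist mulrA divff ?lt0r_neq0// mul1r.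
  have la := lint_dist (avg a r u) lu.
  rewrite -(cint_EFin a r0 la) /pairint -ge0_integralZl//; last 4 first.
  - exact: measurable_cube.
  - by apply: measurable_funTS; exact: measurable_inner.
  - by move=> x _; apply: integral_ge0 => y _; rewrite lee_fin enorm_ge0.
  - by rewrite lee_fin invr_ge0 ltW.
  apply: ge0_le_integral.
  - exact: measurable_cube.
  - by move=> x _; rewrite lee_fin enorm_ge0.
  - by apply/measurable_EFinP; apply: measurable_funTS; case: la.
  - by apply: measurable_funeM; apply: measurable_funTS; exact: measurable_inner.
  move=> x xa.
  apply: (@le_trans _ _ (mean_dist a r u (u x))%:E).
    by rewrite lee_fin enormB; exact: avg_dist.
  rewrite /mean_dist EFinM lee_wpmul2l ?lee_fin ?invr_ge0 ?(ltW v0)//.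
  rewrite -(cint_EFin a r0 (lint_dist (u x) lu)).
  rewrite (eq_integral (fun y => (enorm (u x - u y))%:E)); last by move=> y _; rewrite enormB.
  apply: ge0_subset_integral.
  - exact: measurable_cube.
  - exact: measurable_cube.
  - exact: measurable_funTS (@weight_xm R m (fun x y => enorm (u x - u y)) x w).
  - by move=> y _; rewrite lee_fin enorm_ge0.
  apply: subcube_sub => i; move/cubeP: xa => /(_ i) xa.
  by have : `|x ord0 i - a ord0 i| <= r; [rewrite ler_norml; lra|lra].
have r20 : 0 < r / 2 by rewrite divr_gt0.
have rE : r / 2 * 2^-1 ^+ k = r * 2^-1 ^+ k.+1 by rewrite exprS mulrA.
rewrite [vol r * (_ * _)]mulrA [vol r * 2^-1 ^+ m]mulrC -vol_half mulr_sumr -sumEFin.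
rewrite /pairint (@integral_children _ _ a r _ r0); last 2 first.
- by apply: measurable_funTS; exact: measurable_inner.
- by move=> x _; apply: integral_ge0 => y _; rewrite lee_fin enorm_ge0.
rewrite ge0_sume_distrr; last first.
  move=> b _; apply: integral_ge0 => x _; apply: integral_ge0 => y _; rewrite lee_fin; exact: enorm_ge0.
apply: lee_sum => b _; rewrite -rE; exact: IH.
Qed.

Lemma dyad_osc_vanishing u a r e : vlint u -> 0 < r -> 0 < e ->
  exists k, vol r * dyad k (fun a' r' => osc a' r' u) a r <= e.
Proof.
move=> lu r0 e0; have e'0 : 0 < e / 2 ^+ m by rewrite divr_gt0 ?exprn_gt0.
have [d [d0 Hd]] := vlint_vanishing lu a r0 e'0.
have [k hk] : exists k : nat, 2 * r / d < k%:R.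
  by exists (Num.truncn (2 * r / d)).+1; exact: truncnS_gt.
exists k; pose s := r * 2^-1 ^+ k.
have s0 : 0 < s by rewrite mulr_gt0 ?exprn_gt0.
have s20 : 0 < 2 * s by rewrite mulr_gt0.
have sd : 2 * s < d.
  rewrite /s mulrA exprVn ltr_pdivrMr ?exprn_gt0// [d * _]mulrC -ltr_pdivrMr//.
  by apply: lt_trans hk _; rewrite -natrX ltr_nat; exact: ltn_expl.
rewrite -lee_fin; apply: le_trans (dyad_osc_le k a lu r0) _.
have vs := @vol_gt0 R m s s0.
apply: (@le_trans _ _ ((vol s)^-1%:E * (e / 2 ^+ m * ((2 * s) *+ 2) ^+ m)%:E)%E).
  by rewrite lee_wpmul2l ?lee_fin ?invr_ge0 ?(ltW vs)//; exact: Hd.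
rewrite -EFinM lee_fin -mulrnAr exprMn -/(vol s); apply: eq_ler.
have vn : vol s != 0 by rewrite lt0r_neq0.
have pn : 2 ^+ m != 0 :> R by rewrite expf_neq0.
by move: (vol s) (2 ^+ m : R) vn pn => v P vn pn; field; rewrite vn pn.
Qed.

Lemma vol_dyadS k phi a r :
  vol r * dyad k.+1 phi a r =
  \sum_(b : {ffun 'I_m -> bool}) vol (r / 2) * dyad k phi (child a r b) (r / 2).
Proof. by rewrite /= mulrA [vol r * _]mulrC -vol_half mulr_sumr. Qed.

(** On the dyadic cubes of generation [k], [u] is replaced by its average, to which
    Young's inequality [young] applies. The error is paid for by the bound [N] of the
    weight and by the oscillation at generation [k]. *)
Lemma jn_young u (w h : V -> R) z (al c q N : R) k a r : vlint u -> lint w -> lint h ->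
  lint (fun x => w x * enorm (u x - z)) ->
  (forall x, 0 <= w x) -> (forall x, w x <= N) -> 0 <= al ->
  (forall x X, 0 <= X -> w x * X <= al * (h x + c * X `^ q)) -> 0 < r ->
  cint a r (fun x => w x * enorm (u x - z)) <=
  al * (cint a r h + c * (vol r * dyad k (fun a' r' => enorm (avg a' r' u - z) `^ q) a r)) +
  N * (vol r * dyad k (fun a' r' => osc a' r' u) a r).
Proof.
move=> lu lw lh lwu w0 wN al0 young; elim: k a r => [|k IH] a r r0; last first.
  have r20 : 0 < r / 2 by rewrite divr_gt0.
  rewrite (cint_children a r0 lwu) (cint_children a r0 lh) !vol_dyadS.
  rewrite (mulr_sumr _ _ _ c) -big_split/= (mulr_sumr _ _ _ al) (mulr_sumr _ _ _ N) -big_split/=.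
  by apply: ler_sum => b _; exact: IH.
rewrite /=; set A := avg a r u.
have vr := @vol_gt0 R m r r0.
have -> : vol r * osc a r u = cint a r (fun x => enorm (u x - A)).
  by rewrite /osc /mean_dist mulrA divff ?mul1r// lt0r_neq0.
have lA := lint_dist A lu.
have N0 : 0 <= N by apply: le_trans (wN a).
have lAl : lint (fun x => al * (h x + c * enorm (A - z) `^ q)).
  by apply: lintZ; apply: lintD => //; exact: lint_cst.
have -> : al * (cint a r h + c * (vol r * enorm (A - z) `^ q)) =
    cint a r (fun x => al * (h x + c * enorm (A - z) `^ q)).
  have lc : lint (fun _ : V => c * enorm (A - z) `^ q) by exact: lint_cst.
  rewrite (cintZ a al r0 (lintD lh lc)) (cintD a r0 lh lc) (cint_cst a _ r0) -/(vol r).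
  by congr (_ * (_ + _)); ring.
rewrite -(cintZ a N r0 lA) -(cintD a r0 lAl (lintZ N lA)).
apply: le_cint => //; first by apply: lintD => //; exact: lintZ.
move=> x _; apply: (@le_trans _ _ (w x * (enorm (A - z) + enorm (u x - A)))).
  by apply: ler_wpM2l => //; rewrite [leRHS]addrC; exact: enorm_distD.
rewrite mulrDr; apply: lerD; first by apply: young; exact: enorm_ge0.
by apply: ler_wpM2r => //; exact: enorm_ge0.
Qed.

(** A weight in [L^p] pairs with a function of bounded mean oscillation: truncate the
    weight at height [N], let the generation tend to infinity in [jn_young] (the
    powers are bounded by [jn_dyad], the errors vanish), then let [N] tend to
    infinity. *)
Lemma jn_weighted u (w : V -> R) a r (S p q al H : R) : vlint u ->
  measurable_fun setT w -> (forall x, 0 <= w x) -> 0 < r -> 0 < S ->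
  0 < p -> 0 < q -> p^-1 + q^-1 = 1 -> 1 <= p -> 1 <= q -> 0 < al ->
  (forall a' r', 0 < r' -> subcube a' r' a r -> osc a' r' u <= S) ->
  (\int[mu]_(x in cube a r) ((S / al * w x) `^ p)%:E <= H%:E)%E ->
  (\int[mu]_(x in cube a r) (w x * enorm (u x - avg a r u))%:E <=
   (al * (H + jn_const q * vol r))%:E)%E.
Proof.
move=> lu mw w0 r0 S0 p0 q0 pq p1 q1 al0 hS hH.
set z := avg a r u.
have mC := measurable_cube a r.
have vr := @vol_gt0 R m r r0.
have luz := lint_dist z lu.
have mono x y : 0 <= x -> x <= y -> x `^ p <= y `^ p.
  by move=> x0 xy; apply: ge0_ler_powR; rewrite ?nnegrE ?(ltW p0)// (le_trans x0).
have Sal : 0 < S / al by rewrite divr_gt0.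
pose wN (N : nat) x := Num.min (w x) N%:R.
have wN0 N x : 0 <= wN N x by rewrite /wN le_min w0 /=.
have wNN N x : wN N x <= N%:R by rewrite /wN ge_min lexx orbT.
have wNw N x : wN N x <= w x by rewrite /wN ge_min lexx.
have mwN N : measurable_fun setT (wN N) by exact: measurable_minr.
have lwN N : lint (wN N).
  apply: (lint_le (lint_cst N%:R)) => // x; by rewrite ger0_norm.
pose hN N x := (S / al * wN N x) `^ p.
have mpow (f : V -> R) : measurable_fun setT f -> measurable_fun setT (fun x => (S / al * f x) `^ p).
  move=> mf; apply: (measurableT_comp (measurable_powR p)).
  exact: measurable_funM.
have lhN N : lint (hN N).
  apply: (lint_le (lint_cst ((S / al * N%:R) `^ p))); first exact: mpow.
  move=> x; rewrite ger0_norm ?powR_ge0//.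
  apply: mono; first by rewrite mulr_ge0// ltW.
  by apply: ler_wpM2l => //; exact: ltW.
have lwu N : lint (fun x => wN N x * enorm (u x - z)).
  have h : lint (fun x => enorm (u x - z) * wN N x).
    by apply: (@lint_mul_bounded _ _ N%:R) => // x; rewrite ger0_norm.
  by move: h; congr lint; apply/funext => x; rewrite mulrC.
have bound N : cint a r (fun x => wN N x * enorm (u x - z)) <= al * (H + jn_const q * vol r).
  have hHN : cint a r (hN N) <= H.
    rewrite -lee_fin -(cint_EFin a r0 (lhN N)); apply: le_trans hH.
    apply: ge0_le_integral => //.
    - by move=> x _; rewrite lee_fin powR_ge0.
    - by apply/measurable_EFinP; apply: measurable_funTS; exact: mpow.
    - by apply/measurable_EFinP; apply: measurable_funTS; exact: mpow.
    move=> x _; rewrite lee_fin; apply: mono; first by rewrite mulr_ge0// ltW.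
    by apply: ler_wpM2l; [exact: ltW|exact: wNw].
  have young x X : 0 <= X -> wN N x * X <= al * (hN N x + S^-1 `^ q * X `^ q).
    move=> X0.
    have SX0 : 0 <= S^-1 * X by rewrite mulr_ge0// invr_ge0 ltW.
    have SW0 : 0 <= S / al * wN N x by rewrite mulr_ge0// ltW.
    have := conjugate_powR SW0 SX0 p0 q0 pq.
    have -> : S / al * wN N x * (S^-1 * X) = al^-1 * (wN N x * X).
      by field; rewrite !lt0r_neq0.
    rewrite ler_pdivrMl// => h; apply: le_trans h _; rewrite (ler_pM2l al0).
    have Si : 0 <= S^-1 by rewrite invr_ge0 ltW.
    rewrite -(powRM q Si X0) -/(hN N x); apply: lerD.
      by rewrite ler_pdivrMr// ler_peMr// powR_ge0.
    by rewrite ler_pdivrMr// ler_peMr// powR_ge0.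
  apply/ler_addgt0Pr => e e0.
  have e'0 : 0 < e / (N%:R + 1) by rewrite divr_gt0// ltr_wpDl.
  have [k hk] := dyad_osc_vanishing a lu r0 e'0.
  apply: le_trans (@jn_young u (wN N) (hN N) z al (S^-1 `^ q) q N%:R k a r lu (lwN N) (lhN N) (lwu N) (wN0 N) (wNN N) (ltW al0) young r0) _.
  apply: lerD.
    rewrite (ler_pM2l al0); apply: lerD => //.
    have hk2 := @jn_dyad u a r S q k a r lu S0 q0 r0 hS (subcube_same a (lexx r)).
    have Sq : 0 <= S^-1 `^ q := powR_ge0 _ _.
    rewrite mulrCA [leRHS]mulrC (ler_pM2l vr).
    apply: le_trans (ler_wpM2l Sq hk2) _; rewrite mulrCA -powRM ?invr_ge0 ?(ltW S0)//.
    by rewrite mulVf ?lt0r_neq0// powR1 mulr1.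
  have N0 : 0 <= N%:R :> R by [].
  apply: le_trans (ler_wpM2l N0 hk) _.
  rewrite mulrCA ger_pMr// ler_pdivrMr ?ltr_wpDl// mul1r lerDl//.
have -> : (\int[mu]_(x in cube a r) (w x * enorm (u x - z))%:E =
    \int[mu]_(x in cube a r) limn (fun N => (wN N x * enorm (u x - z))%:E))%E.
  apply: eq_integral => x _; apply/esym/cvg_lim => //.
  apply: cvg_near_cst; near=> N; rewrite /wN min_l//.
  by near: N; exact: nbhs_infty_ger.
rewrite monotone_convergence//; last 3 first.
- move=> N; apply/measurable_EFinP; apply: measurable_funTS; by case: (lwu N).
- by move=> N x _; rewrite lee_fin mulr_ge0// enorm_ge0.
- move=> x _ N M NM; rewrite lee_fin ler_wpM2r ?enorm_ge0// /wN le_min ge_min lexx/=.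
  by rewrite ge_min ler_nat NM orbT.
apply: lime_le.
  apply: ereal_nondecreasing_is_cvgn => N M NM; apply: ge0_le_integral => //.
  - by move=> x _; rewrite lee_fin mulr_ge0// enorm_ge0.
  - by apply/measurable_EFinP; apply: measurable_funTS; case: (lwu N).
  - by apply/measurable_EFinP; apply: measurable_funTS; case: (lwu M).
  move=> x _; rewrite lee_fin ler_wpM2r ?enorm_ge0// /wN le_min ge_min lexx/=.
  by rewrite ge_min ler_nat NM orbT.
by apply: nearW => N; rewrite cint_EFin// lee_fin.
Unshelve. all: by end_near. Qed.

End john_nirenberg.

(** * From decay of the oscillation to Hoelder continuity *)
Section iteration.
Context {R : realType}.

Lemma coordB n (x y : 'rV[R]_n) i : (x - y) ord0 i = x ord0 i - y ord0 i.
Proof. by rewrite !mxE. Qed.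

Lemma halves_small (d : R) : 0 < d -> exists N, forall k, (N <= k)%N -> 2^-1 ^+ k <= d.
Proof.
move=> d0; exists (Num.truncn d^-1).+1 => k Nk; rewrite exprVn -[leRHS]invrK.
rewrite lef_pV2 ?posrE ?exprn_gt0 ?invr_gt0//.
apply: le_trans (ltW (truncnS_gt _)) _; rewrite -natrX ler_nat.
by apply: leq_trans Nk _; apply: ltnW; exact: ltn_expl.
Qed.

Lemma powR_small (C al e : R) : 0 <= C -> 0 < al -> 0 < e ->
  exists d, 0 < d /\ forall s, 0 <= s -> s <= d -> C * s `^ al <= e.
Proof.
move=> C0 al0 e0; have C1 : 0 < C + 1 by lra.
have eC : 0 < e / (C + 1) by rewrite divr_gt0.
exists ((e / (C + 1)) `^ al^-1); split=> [|s s0 sd]; first exact: powR_gt0.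
have h : s `^ al <= e / (C + 1).
  have E : e / (C + 1) = ((e / (C + 1)) `^ al^-1) `^ al.
    by rewrite -powRrM mulVf ?powRr1 ?(ltW eC)// lt0r_neq0.
  rewrite [leRHS]E.
  by apply: ge0_ler_powR; rewrite ?nnegrE ?powR_ge0 ?(ltW al0).
apply: (@le_trans _ _ (C * (e / (C + 1)))); first exact: ler_wpM2l.
by rewrite mulrCA ger_pMr// ler_pdivrMr//; lra.
Qed.

Lemma half_powR_lt1 (al : R) : 0 < al -> 2^-1 `^ al < 1 :> R.
Proof.
have one : 1 `^ al = 1 :> R by rewrite powR1.
by move=> al0; rewrite -[ltRHS]one; apply: gt0_ltr_powR; rewrite ?nnegrE//; lra.
Qed.

(** A geometric iteration from the scales between [th * r1] and [r1] downwards. *)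
Lemma bounded_iter (O : R -> R) (th r1 M T : R) : 0 < th -> th <= 2^-1 -> 0 < r1 ->
  0 <= M -> 0 <= T ->
  (forall r, 0 < r -> r <= r1 -> O (th * r) <= 2^-1 * O r + M) ->
  (forall r, th * r1 <= r -> r <= r1 -> O r <= T) ->
  forall r, 0 < r -> r <= r1 -> O r <= T + 2 * M.
Proof.
move=> th0 th1 r10 M0 T0 step top.
have main k r : 0 < r -> r <= r1 -> th ^+ k * r1 <= r -> O r <= T + 2 * M.
  elim: k r => [|k IH] r r0 rr h.
    rewrite expr0 mul1r in h; have : O r <= T.
      by apply: top => //; apply: le_trans h; rewrite ger_pMl//; lra.
    lra.
  have [h1|h1] := leP (th * r1) r.
    by have := top r h1 rr; lra.
  have r'0 : 0 < r / th by rewrite divr_gt0.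
  have r'1 : r / th <= r1 by rewrite ler_pdivrMr// mulrC ltW.
  have := IH _ r'0 r'1; rewrite ler_pdivlMr// mulrAC -exprSr => /(_ h) h2.
  have := step _ r'0 r'1; rewrite mulrCA divff ?mulr1 ?lt0r_neq0// => h3.
  lra.
move=> r r0 rr.
have [N HN] := halves_small (divr_gt0 r0 r10).
apply: (main N) => //; rewrite -ler_pdivlMr//; apply: le_trans (HN N (leqnn N)).
by rewrite lerXn2r// nnegrE ?(ltW th0)//.
Qed.

End iteration.

Section campanato.
Context {R : realType} {m n : nat}.
Local Notation V := 'rV[R]_m.
Local Notation mu := (lebesgue_rV R m).
Local Notation vol := (@vol R m).
Implicit Types (u : V -> 'rV[R]_n) (a x y : V) (r s : R).

(** A subcube of a cube shrunk by [th / 2] remains inside that cube when it is enlarged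
    by [1 / th]: the hypothesis then applies to the enlarged cube, with the bound of
    the previous stage. *)
Lemma decay_iter u x rho0 th B0 : 0 < th -> th <= 2^-1 -> 0 < rho0 -> 0 < B0 ->
  (forall a r b, 0 < r -> 0 < b -> subcube a r x rho0 ->
    (forall a' r', 0 < r' -> subcube a' r' a r -> osc a' r' u <= b) ->
    osc a (th * r) u <= b / 2) ->
  (forall a r, 0 < r -> subcube a r x rho0 -> osc a r u <= B0) ->
  forall k a r, 0 < r -> subcube a r x ((th / 2) ^+ k * rho0) ->
    osc a r u <= B0 * 2^-1 ^+ k.
Proof.
move=> th0 th1 rho0_gt0 B00 step top; elim=> [|k IH] a r r0 s.
  by rewrite expr0 mul1r in s; rewrite expr0 mulr1; exact: top.
have r'0 : 0 < r / th by rewrite divr_gt0.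
have p0 : 0 < (th / 2) ^+ k * rho0 by rewrite mulr_gt0// exprn_gt0// divr_gt0.
have s' : subcube a (r / th) x ((th / 2) ^+ k * rho0).
  move=> i; have := s i; rewrite exprS -mulrA; set P := _ * rho0 in p0 *.
  set d := `|_| => h; have d0 : 0 <= d := normr_ge0 _.
  have h1 : r / th <= P / 2 by rewrite ler_pdivrMr//; lra.
  have h2 : th / 2 * P <= P / 2.
    by rewrite mulrAC ler_wpM2r//; apply: ler_piMl; lra.
  lra.
have kk : (th / 2) ^+ k * rho0 <= rho0.
  by rewrite ler_piMl ?(ltW rho0_gt0)// exprn_ile1//; lra.
have b0 : 0 < B0 * 2^-1 ^+ k by rewrite mulr_gt0// exprn_gt0.
have := step a (r / th) _ r'0 b0 (subcube_trans s' (subcube_same x kk)).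
rewrite mulrCA divff ?lt0r_neq0// mulr1 exprSr mulrA; apply => a' r' r'1 s''.
by apply: IH => //; exact: subcube_trans s'' s'.
Qed.

(** The exponent is the solution [al] of [(th / 2)^al = 1 / 2]. *)
Lemma powR_decay (th B0 rho0 : R) (O : R -> R) : 0 < th -> th <= 2^-1 -> 0 < rho0 -> 0 < B0 ->
  (forall k r, 0 < r -> r <= (th / 2) ^+ k * rho0 -> O r <= B0 * 2^-1 ^+ k) ->
  forall r, 0 < r -> r <= rho0 ->
    O r <= 2 * B0 * (rho0^-1) `^ (ln 2 / - ln (th / 2)) * r `^ (ln 2 / - ln (th / 2)).
Proof.
move=> th0 th1 rho0_gt0 B00 H r r0 rr.
set al := ln 2 / - ln (th / 2).
have t0 : 0 < th / 2 by rewrite divr_gt0.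
have t1 : th / 2 < 1 by lra.
have l0 : ln (th / 2) < 0 by rewrite ln_lt0// t0.
have l2 : 0 < ln 2 :> R by rewrite ln_gt0// ltr1n.
have al0 : 0 < al by rewrite divr_gt0// oppr_gt0.
have tal : (th / 2) `^ al = 2^-1.
  rewrite /powR gt_eqF// /al (_ : ln 2 / - ln (th / 2) * ln (th / 2) = - ln 2).
    by rewrite expRN lnK// posrE.
  by field; rewrite lt_eqF.
pose q := r / rho0.
have q0 : 0 < q by rewrite divr_gt0.
have q1 : q <= 1 by rewrite ler_pdivrMr// mul1r.
have [k [k1 k2]] : exists k, q <= (th / 2) ^+ k /\ (th / 2) ^+ k.+1 < q.
  have ex : exists k, (th / 2) ^+ k < q.
    have [N HN] := halves_small (divr_gt0 q0 (ltr0n _ 2 : 0 < 2 :> R)).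
    exists N; apply: (@le_lt_trans _ _ (q / 2)); last by lra.
    by apply: le_trans (HN N (leqnn N)); rewrite lerXn2r ?nnegrE //; lra.
  have := ex_minnP ex; case=> -[|k] hk hm.
    by move: hk; rewrite expr0 ltNge q1.
  exists k; split=> //; rewrite leNgt; apply/negP => hh.
  by have := hm _ hh; rewrite ltnn.
have rk : r <= (th / 2) ^+ k * rho0 by rewrite -ler_pdivrMr.
apply: le_trans (H k r r0 rk) _.
have -> : 2 * B0 * rho0^-1 `^ al * r `^ al = 2 * B0 * q `^ al.
  by rewrite -mulrA -powRM ?invr_ge0 ?(ltW rho0_gt0) ?(ltW r0)// /q [_ * r]mulrC.
have h : 2^-1 ^+ k.+1 <= q `^ al.
  rewrite -tal -powR_mulrn ?powR_ge0// -powRrM [al * _]mulrC powRrM.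
  apply: ge0_ler_powR; rewrite ?nnegrE ?powR_ge0 ?(ltW al0) ?(ltW q0)//.
  by rewrite powR_mulrn ?(ltW t0)// ltW.
rewrite exprS in h; have := ler_wpM2l (ltW B00) h; lra.
Qed.

Lemma avg_scale u x r s (C al : R) : 0 < s -> s <= r -> r <= 2 * s -> vlint u -> 0 <= C ->
  osc x r u <= C * r `^ al -> enorm (avg x s u - avg x r u) <= 2 ^+ m * C * r `^ al.
Proof.
move=> s0 sr rs lu C0 h; have r0 : 0 < r by lra.
apply: le_trans (avg_subcube s0 r0 lu (subcube_same x sr)) _.
rewrite -[leRHS]mulrA; apply: ler_pM => //.
- by apply: divr_ge0; apply: ltW; exact: vol_gt0.
- exact: osc_ge0.
rewrite ler_pdivrMr ?vol_gt0// /vol -exprMn; apply: lerXn2r; rewrite ?nnegrE; lra.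
Qed.

(** The averages at the scales [r / 2^k] differ by the terms of a geometric series. *)
Lemma avg_chain u x (C al rho0 : R) : vlint u -> 0 <= C -> 0 < al ->
  (forall r, 0 < r -> r <= rho0 -> osc x r u <= C * r `^ al) ->
  forall s r, 0 < s -> s <= r -> r <= rho0 ->
    enorm (avg x s u - avg x r u) <= 2 ^+ m * C / (1 - 2^-1 `^ al) * r `^ al.
Proof.
move=> lu C0 al0 H s r s0 sr rr.
set be := 2^-1 `^ al.
have be1 : be < 1.
  exact: half_powR_lt1.
have D0 : 0 < 1 - be by lra.
set C2 := _ / _.
have C20 : 0 <= C2 by rewrite divr_ge0 ?(ltW D0)// mulr_ge0// exprn_ge0.
have [N HN] := halves_small (divr_gt0 s0 (lt_le_trans s0 sr)).
have {HN} : 2^-1 ^+ N * r <= s by rewrite -ler_pdivlMr ?HN// (lt_le_trans s0).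
elim: N r sr rr => [|N IH] r sr rr h.
  have -> : s = r by apply/eqP; rewrite eq_le sr; move: h; rewrite expr0 mul1r.
  by rewrite subrr enorm0 mulr_ge0// powR_ge0.
have r0 : 0 < r by lra.
have [h1|h1] := leP r (2 * s).
  apply: le_trans (avg_scale s0 sr h1 lu C0 (H r r0 rr)) _.
  rewrite ler_wpM2r ?powR_ge0// ler_pdivlMr// ler_piMr//.
    by rewrite mulr_ge0// exprn_ge0.
  by have := powR_ge0 2^-1 al; rewrite -/be; lra.
have r20 : 0 < r / 2 by rewrite divr_gt0.
have a1 : s <= r / 2 by lra.
have a2 : r / 2 <= rho0 by lra.
have a3 : 2^-1 ^+ N * (r / 2) <= s by move: h; rewrite exprSr -mulrA [2^-1 * r]mulrC.
have IH' := IH (r / 2) a1 a2 a3.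
have b1 : r / 2 <= r by lra.
have b2 : r <= 2 * (r / 2) by lra.
have S1 := avg_scale r20 b1 b2 lu C0 (H r r0 rr).
apply: le_trans (enorm_distD (avg x (r / 2) u) _ _) _.
apply: le_trans (lerD IH' S1) _.
rewrite powRM ?(ltW r0)// -/be; apply: eq_ler.
by rewrite /C2; field; rewrite lt0r_neq0.
Qed.

(** The precise representative: the limit of averages, where it exists. *)
Definition repr u x : 'rV[R]_n :=
  \row_i lim ((fun k => avg x (2^-1 ^+ k) u ord0 i) @ \oo).

Lemma repr_avg u x (C al rho0 : R) : vlint u -> 0 <= C -> 0 < al -> 0 < rho0 ->
  (forall r, 0 < r -> r <= rho0 -> osc x r u <= C * r `^ al) ->
  forall r, 0 < r -> r <= rho0 ->
    enorm (repr u x - avg x r u) <= 2 ^+ m * C / (1 - 2^-1 `^ al) * r `^ al.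
Proof.
move=> lu C0 al0 rho0_gt0 H r r0 rr.
set C2 := _ / _.
have be1 : 2^-1 `^ al < 1 :> R by exact: half_powR_lt1.
have C20 : 0 <= C2 by rewrite divr_ge0 ?subr_ge0 ?(ltW be1)// mulr_ge0// exprn_ge0.
have chain s t : 0 < s -> s <= t -> t <= rho0 -> enorm (avg x s u - avg x t u) <= C2 * t `^ al.
  exact: avg_chain.
have p0 k : 0 < 2^-1 ^+ k :> R by rewrite exprn_gt0.
have cv i : cvg ((fun k => avg x (2^-1 ^+ k) u ord0 i) @ \oo).
  apply: cauchy_cvg; apply: cauchy_exP => e e0.
  have [d [d0 hd]] := powR_small C20 al0 (divr_gt0 e0 (ltr0n _ 2 : 0 < 2 :> R)).
  have dr : 0 < Num.min d rho0 by rewrite lt_min d0.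
  have [N HN] := halves_small dr.
  have := HN N (leqnn N); rewrite le_min => /andP[N1 N2].
  exists (avg x (2^-1 ^+ N) u ord0 i); exists N => // k /= Nk.
  have kN : 2^-1 ^+ k <= 2^-1 ^+ N :> R by rewrite ler_wiXn2l//; lra.
  have h := chain _ _ (p0 k) kN N2.
  have h2 := hd _ (ltW (p0 N)) N1.
  have h3 := coord_le_enorm (avg x (2^-1 ^+ k) u - avg x (2^-1 ^+ N) u) i.
  rewrite coordB in h3; rewrite /ball/= /ball_/= distrC.
  by apply: le_lt_trans h3 _; lra.
apply/ler_addgt0Pr => e e0.
have e2 : 0 < e / n.+1%:R by rewrite divr_gt0.
have cvi i : \forall k \near \oo, `|repr u x ord0 i - avg x (2^-1 ^+ k) u ord0 i| <= e / n.+1%:R.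
  by rewrite mxE; have /cvgrPdist_le := cv i; apply.
have : \forall k \near \oo, forall i : 'I_n, `|repr u x ord0 i - avg x (2^-1 ^+ k) u ord0 i| <= e / n.+1%:R.
  exact: filter_forall.
move=> [N1 _ HN1]; have [N2 HN2] := halves_small r0.
pose k := maxn N1 N2.
have k1 := HN1 k (leq_maxl _ _); have k2 := HN2 k (leq_maxr _ _).
apply: le_trans (enorm_distD (avg x (2^-1 ^+ k) u) _ _) _.
rewrite addrC; apply: lerD; first exact: chain.
apply: le_trans (enorm_le_sum _) _.
apply: (@le_trans _ _ (\sum_(i < n) e / n.+1%:R)).
  by apply: ler_sum => i _; rewrite coordB; exact: k1.
rewrite sumr_const card_ord -[_ *+ n]mulr_natl mulrCA ger_pMr// ler_pdivrMr// mul1r ler_nat.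
exact: leqnSn.
Qed.

(** Two points at distance [d] are compared through the cube of half-side [2 d] around
    one of them; if [2 d] exceeds [rho0] the bound [T] on the averages suffices. *)
Lemma campanato u (E : set V) (C al rho0 T : R) : vlint u -> 0 <= C -> 0 < al ->
  0 < rho0 -> 0 <= T ->
  (forall x r, E x -> 0 < r -> r <= rho0 -> osc x r u <= C * r `^ al) ->
  (forall x, E x -> enorm (avg x rho0 u) <= T) ->
  holder_on E al (repr u).
Proof.
move=> lu C0 al0 rho0_gt0 T0 H HT.
set C2 := 2 ^+ m * C / (1 - 2^-1 `^ al).
have be1 : 2^-1 `^ al < 1 :> R by exact: half_powR_lt1.
have C20 : 0 <= C2 by rewrite divr_ge0 ?subr_ge0 ?(ltW be1)// mulr_ge0// exprn_ge0.
have m0 : 0 <= 2 ^+ m * C by rewrite mulr_ge0// exprn_ge0.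
pose W := (2 * C2 + 2 ^+ m * C) * 2 `^ al + 2 * (C2 * rho0 `^ al + T) * (2 / rho0) `^ al.
have W1 : 0 <= (2 * C2 + 2 ^+ m * C) * 2 `^ al by rewrite mulr_ge0 ?powR_ge0//; lra.
have W20 : 0 <= C2 * rho0 `^ al + T by rewrite addr_ge0// mulr_ge0// powR_ge0.
have W2 : 0 <= 2 * (C2 * rho0 `^ al + T) * (2 / rho0) `^ al by rewrite mulr_ge0 ?powR_ge0//; lra.
exists W => x y Ex Ey; pose d := enorm (x - y).
have d0 : 0 <= d := enorm_ge0 _; rewrite -/d.
have [dz|dn] := eqVneq d 0.
  have -> : x = y.
    apply/rowP => i; have := coord_le_enorm (x - y) i; rewrite -/d dz coordB => h.
    by apply/eqP; rewrite -subr_eq0 -normr_le0.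
  by rewrite subrr enorm0 mulr_ge0 ?powR_ge0// addr_ge0.
have dp : 0 < d by rewrite lt_def dn.
have dd : d <= 2 * d by rewrite ler_peMl// ler1n.
have d20 : 0 < 2 * d by rewrite mulr_gt0.
have rx r : 0 < r -> r <= rho0 -> enorm (repr u x - avg x r u) <= C2 * r `^ al.
  by apply: repr_avg => // s; exact: H.
have ry r : 0 < r -> r <= rho0 -> enorm (repr u y - avg y r u) <= C2 * r `^ al.
  by apply: repr_avg => // s; exact: H.
have p2 : (2 * d) `^ al = 2 `^ al * d `^ al by rewrite powRM// ltW.
have [h|h] := leP (2 * d) rho0.
  have s : subcube y d x (2 * d).
    by move=> i; have := coord_le_enorm (x - y) i; rewrite -/d coordB mulr2n mulrDl mul1r lerD2r.
  have vE : vol (2 * d) / vol d = 2 ^+ m.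
    rewrite /vol -mulrnAr exprMn mulfK// lt0r_neq0// -/(vol d); exact: vol_gt0.
  have h1 := rx _ d20 h.
  have dh : d <= rho0 by exact: le_trans h.
  have h2 := ry _ dp dh.
  have h3 := avg_subcube dp d20 lu s; rewrite vE in h3.
  have h4 := H x _ Ex d20 h.
  have h5 : 2 ^+ m * osc x (2 * d) u <= 2 ^+ m * C * (2 * d) `^ al.
    by rewrite -mulrA ler_wpM2l// exprn_ge0.
  have h6 : d `^ al <= (2 * d) `^ al.
    by apply: ge0_ler_powR; rewrite ?nnegrE ?(ltW al0) ?(ltW dp) ?(ltW d20).
  have h7 := ler_wpM2l C20 h6.
  have t1 : enorm (repr u x - repr u y) <= enorm (repr u x - avg x (2 * d) u) +
      (enorm (avg y d u - avg x (2 * d) u) + enorm (repr u y - avg y d u)).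
    apply: le_trans (enorm_distD (avg x (2 * d) u) _ _) _.
    rewrite lerD2l (enormB (avg x (2 * d) u)) [leRHS]addrC; exact: enorm_distD.
  apply: (@le_trans _ _ ((2 * C2 + 2 ^+ m * C) * (2 * d) `^ al)).
    apply: le_trans t1 _.
    apply: le_trans (lerD h1 (lerD (le_trans h3 h5) (le_trans h2 h7))) _.
    by apply: eq_ler; rewrite -/C2; move: ((2 * d) `^ al) => P; ring.
  by rewrite p2 mulrA; apply: ler_wpM2r; [exact: powR_ge0|rewrite /W lerDl].
have rr : rho0 <= rho0 by [].
have h1 := rx _ rho0_gt0 rr; have h2 := ry _ rho0_gt0 rr.
have h3 := HT x Ex; have h4 := HT y Ey.
have b (z : V) (w : V) : enorm (repr u z - avg z rho0 u) <= C2 * rho0 `^ al ->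
    enorm (avg z rho0 u) <= T -> enorm (repr u z) <= C2 * rho0 `^ al + T.
  move=> g1 g2; have := enormD (repr u z - avg z rho0 u) (avg z rho0 u).
  by rewrite subrK => g3; apply: le_trans g3 _; exact: lerD.
have B1 := b x x h1 h3; have B2 := b y y h2 h4.
apply: (@le_trans _ _ (2 * (C2 * rho0 `^ al + T))).
  apply: le_trans (enormD _ _) _; rewrite enormN; apply: le_trans (lerD B1 B2) _.
  by rewrite -[leLHS]mulr2n -[leLHS]mulr_natl.
have q1 : 1 <= (2 / rho0) `^ al * d `^ al.
  rewrite -powRM ?(ltW dp)//; last by rewrite divr_ge0// ltW.
  have one : 1 `^ al = 1 :> R by rewrite powR1.
  rewrite -[leLHS]one; apply: ge0_ler_powR; rewrite ?nnegrE ?(ltW al0)//.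
    by rewrite mulr_ge0 ?(ltW dp)// divr_ge0// ltW.
  by rewrite mulrAC ler_pdivlMr// mul1r ltW.
apply: (@le_trans _ _ (2 * (C2 * rho0 `^ al + T) * (2 / rho0) `^ al * d `^ al)).
  by rewrite -[leRHS]mulrA; apply: ler_peMr => //; exact: mulr_ge0.
by apply: ler_wpM2r; [exact: powR_ge0|rewrite /W lerDr].
Qed.

(** The averages converge to [u] in the mean on [E] and to [repr u] uniformly on [E].
    Along suitable scales [s j] the functions [D j] bound the distance between the two
    and have integrals tending to [0], so that their infimum vanishes almost
    everywhere. *)
Lemma ae_repr u (E : set V) (C al rho0 : R) a r0 : vlint u -> 0 <= C -> 0 < al ->
  0 < rho0 -> measurable E -> 0 < r0 -> E `<=` cube a r0 ->
  (forall x r, E x -> 0 < r -> r <= rho0 -> osc x r u <= C * r `^ al) ->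
  {ae mu, forall x, E x -> u x = repr u x}.
Proof.
move=> lu C0 al0 rho0_gt0 mE r00 Ea H.
set C2 := 2 ^+ m * C / (1 - 2^-1 `^ al).
have be1 : 2^-1 `^ al < 1 :> R by exact: half_powR_lt1.
have C20 : 0 <= C2 by rewrite divr_ge0 ?subr_ge0 ?(ltW be1)// mulr_ge0// exprn_ge0.
have w := vlint_weight lu.
have vv := vlint_vanishing lu.
pose sel (j : nat) (s : R) := [/\ 0 < s, s <= rho0, C2 * s `^ al <= j.+1%:R^-1 &
  (pairint (fun x y => enorm (u x - u y)) s (cube a r0) <= (j.+1%:R^-1 * (s *+ 2) ^+ m)%:E)%E].
have /choice[s Hs] : forall j, exists s, sel j s.
  move=> j; have j0 : 0 < j.+1%:R^-1 :> R by rewrite invr_gt0.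
  have [d1 [d10 h1]] := powR_small C20 al0 j0.
  have [d2 [d20 h2]] := vv a r0 _ r00 j0.
  pose s := Num.min d1 (Num.min (d2 / 2) rho0).
  have s0 : 0 < s by rewrite !lt_min d10 rho0_gt0 divr_gt0.
  have [s1 s2 s3] : [/\ s <= d1, s <= d2 / 2 & s <= rho0].
    by rewrite /s !ge_min !lexx ?orbT.
  exists s; split=> //; first by apply: h1 => //; exact: ltW.
  by apply: h2 => //; lra.
pose D j x : \bar R := ((vol (s j))^-1%:E * (\int[mu]_(y in cube x (s j)) (enorm (u x - u y))%:E) + (j.+1%:R^-1)%:E)%E.
have vs j : 0 < vol (s j) by case: (Hs j) => ? _ _ _; exact: vol_gt0.
have mD j : measurable_fun setT (D j).
  by apply: emeasurable_funD => //; apply: measurable_funeM; exact: measurable_inner.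
have D0 j x : (0 <= D j x)%E.
  rewrite /D adde_ge0 ?lee_fin// mule_ge0 ?lee_fin ?invr_ge0 ?(ltW (vs j))//.
  by apply: integral_ge0 => y _; rewrite lee_fin enorm_ge0.
have muE : (mu E <= (vol r0)%:E)%E.
  by rewrite /vol -(lebesgue_cube a r00); apply: le_measure; rewrite ?inE//; exact: measurable_cube.
have intD j : (\int[mu]_(x in E) D j x <= (j.+1%:R^-1 * (1 + vol r0))%:E)%E.
  case: (Hs j) => s0 s1 s2 s3.
  have mI : measurable_fun setT (fun x => \int[mu]_(y in cube x (s j)) (enorm (u x - u y))%:E)%E.
    exact: measurable_inner.
  have I0 x : (0 <= \int[mu]_(y in cube x (s j)) (enorm (u x - u y))%:E)%E.
    by apply: integral_ge0 => y _; rewrite lee_fin enorm_ge0.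
  have vV : (0 <= (vol (s j))^-1%:E :> \bar R)%E by rewrite lee_fin invr_ge0 ltW.
  have mA : measurable_fun E (fun x => (vol (s j))^-1%:E *
      \int[mu]_(y in cube x (s j)) (enorm (u x - u y))%:E)%E.
    by apply: measurable_funTS; exact: measurable_funeM.
  have A0 x : E x -> (0 <= (vol (s j))^-1%:E *
      \int[mu]_(y in cube x (s j)) (enorm (u x - u y))%:E)%E.
    by move=> _; rewrite mule_ge0.
  rewrite /D ge0_integralD//.
  rewrite mulrDr mulr1 EFinD; apply: leeD.
    rewrite ge0_integralZl//; last exact: measurable_funTS.
    apply: (@le_trans _ _ ((vol (s j))^-1%:E * pairint (fun x y => enorm (u x - u y)) (s j) (cube a r0))%E).
      rewrite lee_wpmul2l//; apply: ge0_subset_integral => //; first exact: measurable_cube.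
      exact: measurable_funTS.
    apply: (@le_trans _ _ ((vol (s j))^-1%:E * (j.+1%:R^-1 * vol (s j))%:E)%E).
      by rewrite lee_wpmul2l.
    by rewrite -EFinM lee_fin mulrCA mulVf ?mulr1// lt0r_neq0.
  by rewrite integral_cst// EFinM lee_wpmul2l// lee_fin.
pose I x := einfs (fun j => D j x) 0.
have mI : measurable_fun setT I by exact: measurable_fun_einfs.
have I0 x : (0 <= I x)%E by apply: le_ereal_inf_tmp => _ [j _ <-].
have ID j x : (I x <= D j x)%E by apply: ereal_inf_lbound; exists j.
have intI : (\int[mu]_(x in E) `|I x| = 0)%E.
  apply/eqP; rewrite eq_le; apply/andP; split; last by apply: integral_ge0.
  apply/lee_addgt0Pr => e e0; rewrite add0e.
  have v0 : 0 < 1 + vol r0 by rewrite addr_gt0// vol_gt0.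
  have [j hj] : exists j : nat, (1 + vol r0) / e < j.+1%:R.
    by exists (Num.truncn ((1 + vol r0) / e)); exact: truncnS_gt.
  apply: (@le_trans _ _ (\int[mu]_(x in E) D j x)%E).
    apply: ge0_le_integral => //.
    - by apply: measurable_funTS; exact: measurableT_comp.
    - exact: measurable_funTS.
    by move=> x _; rewrite gee0_abs.
  apply: le_trans (intD j) _; rewrite lee_fin mulrC ler_pdivrMr// mulrC -ler_pdivrMr// ltW//.
have := (ae_eq_integral_abs mu mE (measurable_funTS mI)).1 intI.
apply: filterS => x Ix Ex; apply/eqP; rewrite -subr_eq0.
have fI : ((enorm (u x - repr u x))%:E <= I x)%E.
  apply: le_ereal_inf_tmp => _ [j _ <-]; case: (Hs j) => s0 s1 s2 _.
  have h1 : enorm (repr u x - avg x (s j) u) <= j.+1%:R^-1.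
    apply: le_trans s2; apply: (@repr_avg u x C al rho0) => // t; exact: H.
  apply: (@le_trans _ _ (mean_dist x (s j) u (u x) + j.+1%:R^-1)%:E).
    rewrite lee_fin; apply: le_trans (enorm_distD (avg x (s j) u) _ _) _.
    rewrite enormB; apply: lerD; first exact: avg_dist.
    by rewrite enormB.
  rewrite EFinD /D leeD2r// /mean_dist EFinM -(cint_EFin x s0 (lint_dist (u x) lu)).
  rewrite lee_wpmul2l ?lee_fin ?invr_ge0 ?(ltW (vs j))// le_eqVlt; apply/orP; left; apply/eqP.
  by apply: eq_integral => y _; rewrite enormB.
have : enorm (u x - repr u x) <= 0 by have := fI; rewrite (Ix Ex) lee_fin.
move=> h; apply/eqP/rowP => i; rewrite [RHS]mxE; apply/eqP; rewrite -normr_le0.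
exact: le_trans (coord_le_enorm _ _) h.
Qed.

End campanato.

(** * The elliptic system *)
Section system.
Context {R : realType} {m : nat}.
Local Notation V := 'rV[R]_m.
Local Notation mu := (lebesgue_rV R m).
Local Notation vol := (@vol R m).
Implicit Types (a x y : V) (r s t rho : R).

Lemma measurable_eball a r : measurable (eball a r).
Proof.
have mf : measurable_fun setT (fun y : V => enorm (y - a)).
  apply: measurable_enorm => i; under eq_fun do rewrite coordB.
  by apply: measurable_funB => //; exact: measurable_coord.
rewrite -[X in measurable X]setTI (_ : eball a r = (fun y : V => enorm (y - a)) @^-1` `]-oo, r[%classic).
  exact: (mf measurableT _ (measurable_itv _)).
by apply/seteqP; split => y /=; rewrite in_itv.
Qed.

Lemma enorm_closed_cube a r y : 0 <= r -> closed_cube a r y -> enorm (y - a) <= m%:R * r.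
Proof.
move=> r0 ya; apply: le_trans (enorm_le_sum _) _.
apply: (@le_trans _ _ (\sum_(i < m) r)); last by rewrite sumr_const card_ord mulr_natl.
by apply: ler_sum => i _; have := ya i; rewrite /= in_itv/= coordB ler_norml; lra.
Qed.

(** Points of the closed cube are at distance at most [m * rho] from its centre; the
    factor 2 leaves room for a ball around the cube inside the unit ball. *)
Definition safe a rho := enorm a + 2 * m%:R * rho <= 1.

Lemma safe_eball a rho : safe a rho -> eball a (2 * m%:R * rho) `<=` unit_ball R m.
Proof.
move=> h y; rewrite /eball /unit_ball/= /eball/= subr0 => ya.
have := enormD (y - a) a; rewrite subrK => h2.
by apply: le_lt_trans h2 _; apply: lt_le_trans h; rewrite addrC ltrD2l.
Qed.

Lemma closed_cube_eball a rho : (0 < m)%N -> 0 < rho ->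
  closed_cube a rho `<=` eball a (2 * m%:R * rho).
Proof.
move=> m0 rho0 y ya; apply: le_lt_trans (enorm_closed_cube (ltW rho0) ya) _.
by rewrite ltr_pM2r// ltr_pMl ?ltr0n// ltr1n.
Qed.

Lemma safe_closed_cube a rho : (0 < m)%N -> 0 < rho -> safe a rho ->
  closed_cube a rho `<=` unit_ball R m.
Proof.
by move=> m0 rho0 h; exact: subset_trans (closed_cube_eball m0 rho0) (safe_eball h).
Qed.

Lemma safe_subcube a' r' a r : (0 < m)%N -> 0 < r' -> safe a r -> subcube a' r' a r -> safe a' r'.
Proof.
move=> m0 r'0 h s; rewrite /safe.
have h1 : enorm (a' - a) <= m%:R * (r - r').
  apply: le_trans (enorm_le_sum _) _.
  apply: (@le_trans _ _ (\sum_(i < m) (r - r'))); last by rewrite sumr_const card_ord mulr_natl.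
  by apply: ler_sum => i _; rewrite coordB distrC lerBrDr; exact: s.
have r'r : r' <= r.
  have := s (Ordinal m0); have := normr_ge0 (a ord0 (Ordinal m0) - a' ord0 (Ordinal m0)); lra.
have h2 := enormD (a' - a) a; rewrite subrK in h2.
have h3 : m%:R * r' <= m%:R * r by rewrite ler_wpM2l.
apply: le_trans h; apply: (@le_trans _ _ (m%:R * (r - r') + enorm a + 2 * m%:R * r')).
  by rewrite lerD2r (le_trans h2)// lerD2r.
rewrite mulrBr -!(mulrA 2); move: (m%:R * r) (m%:R * r') (enorm a) h3; clear => A B e h3; lra.
Qed.

(** From [|f| <= 1 + f^2]. *)
Lemma lint_Lp2 (U : set V) (f : V -> R) : measurable U -> in_Lp U 2 f -> lint (f \_ U).
Proof.
move=> mU [mf]; rewrite /finite_norm unlock => /lty_poweRy h.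
have {}h := h _.
have mfU : measurable_fun setT (f \_ U) by exact: ((measurable_restrictT _ mU).1 mf).
have mg : measurable_fun setT (fun x => `|(f \_ U) x| `^ 2).
  apply: (measurableT_comp (measurable_powR 2)); exact: measurableT_comp.
have lg : lint (fun x => `|(f \_ U) x| `^ 2).
  split=> // a r r0; apply: (@integrableS _ _ _ mu setT) => //; first exact: measurable_cube.
  apply/integrableP; split; first exact/measurable_EFinP.
  under eq_integral do rewrite /= ger0_norm ?powR_ge0// -poweR_EFin.
  by apply: h; rewrite invr_neq0.
apply: (lint_le (lintD (lint_cst 1) lg)) => // x.
rewrite -[X in _ `^ X]/(2%:R) powR_mulrn//.
have := sqr_ge0 (`|(f \_ U) x| - 2^-1); rewrite sqrrB; lra.
Qed.

Lemma measurable_closed_cube a r : measurable (closed_cube a r).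
Proof.
by apply: (@measurable_box R m (fun i => `[a ord0 i - r, a ord0 i + r]%classic)) => i; exact: measurable_itv.
Qed.

Lemma lint_closed_cube (U : set V) (f : V -> R) a r : measurable U ->
  loc_integrable U f -> closed_cube a r `<=` U -> lint (f \_ (closed_cube a r)).
Proof.
move=> mU [mf intf] aU; apply: lint_restr; first exact: measurable_closed_cube.
  exact: measurable_funS mf.
by apply: intf => //; exact: compact_closed_cube.
Qed.

Lemma cint_test (U : set V) (f f' phi : V -> R) x t : cube x t `<=` U ->
  (forall y, ~ cube x t y -> phi y = 0) -> (forall y, cube x t y -> f' y = f y) ->
  fine (\int[mu]_(y in U) (f y * phi y)%:E)%E = cint x t (fun y => f' y * phi y).
Proof.
move=> xU phi0 ff'.
rewrite -[LHS]/(\int[mu]_(y in U) (f y * phi y)) (@Rintegral_support _ _ (cube x t))//.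
  by apply: eq_cint => y xy; rewrite ff'.
by move=> y _ nxy; rewrite phi0// mulr0.
Qed.

Lemma partial2_Psi_bounded t x k : 0 < t ->
  exists C : R, forall y, `|partial k (partial k (Psi t x)) y| <= C.
Proof.
move=> t0.
have [C1 [C10 HC1]] := bump_bounded (dbump (1 : {poly R})).
have [C2 [C20 HC2]] := bump_bounded (dbump (dbump (1 : {poly R}))).
have ti : 0 < t^-1 ^+ 2 by rewrite exprn_gt0// invr_gt0.
exists (C2 * (2 * t * t^-1 ^+ 2) ^+ 2 + C1 * (2 * t^-1 ^+ 2)) => y.
rewrite partial2_Psi; have q0 := scaled_sqd_ge0 t x y.
apply: le_trans (ler_normD _ _) _; apply: lerD; last first.
  have ti2 : 0 <= 2 * t^-1 ^+ 2 by rewrite ltW//; exact: mulr_gt0.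
  by rewrite normrM (ger0_norm ti2) ler_wpM2r//; exact: HC1.
have [h|h] := ltP (enorm (y - x)) t; last first.
  by rewrite /prof2 outside_profile// mul0r normr0; apply: mulr_ge0 => //; exact: sqr_ge0.
rewrite normrM [`|_ ^+ 2|]ger0_norm ?sqr_ge0//.
apply: ler_pM.
- exact: normr_ge0.
- exact: sqr_ge0.
- exact: (HC2 _ q0).
have tt0 : 0 <= 2 * t * t^-1 ^+ 2 by rewrite ltW//; apply: mulr_gt0 ti; exact: mulr_gt0.
rewrite -real_normK ?num_real//; apply: lerXn2r; rewrite ?nnegrE//.
rewrite normrM [`|t^-1 ^+ 2|]ger0_norm ?(ltW ti)// ler_wpM2r ?(ltW ti)//.
rewrite normrM [`|2|]ger0_norm// ler_wpM2l//.
by have := coord_le_enorm (y - x) k; rewrite coordB => h2; apply: le_trans h2 _; exact: ltW.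
Qed.

Lemma measurable_partial2_Psi t x k : measurable_fun [set: V] (partial k (partial k (Psi t x))).
Proof.
have mz : measurable_fun [set: V] (fun y : V => 2 * (y ord0 k - x ord0 k) * t^-1 ^+ 2).
  apply: measurable_funM => //; apply: measurable_funM => //.
  by apply: measurable_funB => //; exact: measurable_coord.
rewrite partial2_Psi; apply: measurable_funD.
  by apply: measurable_funM; [exact: measurable_sqd_profilex|exact: measurable_funX].
by apply: measurable_funM => //; exact: measurable_sqd_profilex.
Qed.

Variable n : nat.
Implicit Types (u : V -> 'rV[R]_n).

Lemma coordD k (x y : 'rV[R]_k) (i : 'I_k) : (x + y) ord0 i = x ord0 i + y ord0 i.
Proof. by rewrite mxE. Qed.

Lemma coordZ k (c : R) (x : 'rV[R]_k) (i : 'I_k) : (c *: x) ord0 i = c * x ord0 i.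
Proof. by rewrite mxE. Qed.

(** Values outside [U] are irrelevant to the problem; extension by zero makes them
    harmless for functions on the whole space. *)
Definition cut k (U : set V) (X : V -> 'rV[R]_k) (y : V) : 'rV[R]_k :=
  \row_i ((fun y => X y ord0 i) \_ U) y.

Lemma cut_in k (U : set V) (X : V -> 'rV[R]_k) y : U y -> cut U X y = X y.
Proof. by move=> Uy; apply/rowP => i; rewrite mxE patchE mem_set. Qed.

Lemma vlint_cut k (U : set V) (X : V -> 'rV[R]_k) :
  (forall i, lint ((fun y => X y ord0 i) \_ U)) -> vlint (cut U X).
Proof. by move=> h i; have := h i; congr lint; apply/funext => y; rewrite mxE. Qed.

(** The definition of the weak gradient, tested with the partial derivatives of [Psi]. *)
Lemma div_test_gradient (U : set V) u (Du : 'I_n -> V -> V) x t : 0 < t ->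
  closed_cube x t `<=` U ->
  vlint (cut U u) -> (forall i, vlint (cut U (Du i))) ->
  (forall i, is_weak_gradient U (fun x => u x ord0 i) (Du i)) ->
  div_test (cut U u) (fun i => cut U (Du i)) x t.
Proof.
move=> t0 xU lu lD wg i.
have xU' : cube x t `<=` U := subset_trans (@cube_closed_cube _ _ _ _) xU.
have lu2 k : lint (fun y => cut U u y ord0 i * partial k (partial k (Psi t x)) y).
  have [C HC] := partial2_Psi_bounded x k t0.
  apply: lint_mul_bounded HC; first exact: lu.
  exact: measurable_partial2_Psi.
have lD1 k : lint (fun y => cut U (Du i) y ord0 k * partial k (Psi t x) y).
  exact: lint_grad_Psi.
rewrite (@eq_cint _ _ x t _ (fun y => \sum_k cut U u y ord0 i * partial k (partial k (Psi t x)) y)); last first.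
  by move=> y _; rewrite /Lap mulr_sumr.
rewrite (cint_sum _ _ t0 lu2) (cint_sum _ _ t0 lD1) -sumrN; apply: eq_bigr => k _.
have [_ _ H] := wg i.
have E := congr1 fine (H (partial k (Psi t x)) k (test_function_partial_Psi k t0 xU)).
have F1 := @cint_test U (fun y => u y ord0 i) (fun y => cut U u y ord0 i)
  (partial k (partial k (Psi t x))) x t xU'.
have F2 := @cint_test U (fun y => Du i y ord0 k) (fun y => cut U (Du i) y ord0 k)
  (partial k (Psi t x)) x t xU'.
rewrite -F1; last 2 first.
- by move=> y nxy; rewrite partial2_Psi /prof1 /prof2 !outside_cube//; ring.
- by move=> y xy; rewrite cut_in//; exact: xU'.
rewrite -F2; last 2 first.
- by move=> y nxy; exact: grad_Psi_out.
- by move=> y xy; rewrite cut_in//; exact: xU'.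
by rewrite -fineN.
Qed.

Lemma cint_div_free (U K : set V) (X : V -> V) x t : 0 < t ->
  closed_cube x t `<=` U -> cube x t `<=` K -> div_free U X ->
  cint x t (fun y => \sum_k cut K X y ord0 k * partial k (Psi t x) y) = 0.
Proof.
move=> t0 xU xK [_ H].
have xU' : cube x t `<=` U := subset_trans (@cube_closed_cube _ _ _ _) xU.
have E := congr1 fine (H (Psi t x) (test_function_Psi t0 xU)).
pose F y := \sum_k X y ord0 k * partial k (Psi t x) y.
have S : \int[mu]_(y in U) F y = cint x t F.
  by apply: Rintegral_support => // y _ nxy; apply: big1 => k _; rewrite grad_Psi_out// mulr0.
transitivity (cint x t F); last by rewrite -S; exact: E.
by apply: eq_cint => y xy; apply: eq_bigr => k _; rewrite cut_in//; exact: xK.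
Qed.

(** Cauchy-Schwarz in each row. *)
Lemma tensor_apply_le (d : 'rV[R]_n) (Om : 'I_n -> 'I_n -> 'rV[R]_m) :
  Num.sqrt (\sum_i enorm (\sum_j d ord0 j *: Om i j) ^+ 2) <=
  Num.sqrt (\sum_i \sum_j enorm (Om i j) ^+ 2) * enorm d.
Proof.
have S0 i : 0 <= \sum_j enorm (Om i j) ^+ 2 by apply: sumr_ge0 => j _; exact: sqr_ge0.
rewrite -[enorm d]ger0_norm ?enorm_ge0// -sqrtr_sqr -sqrtrM; last by apply: sumr_ge0.
rewrite ler_wsqrtr// mulr_suml; apply: ler_sum => i _.
have h : enorm (\sum_j d ord0 j *: Om i j) <= \sum_j `|d ord0 j| * enorm (Om i j).
  elim/big_ind2 : _ => [|x1 x2 y1 y2 h1 h2|j _]; first by rewrite enorm0.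
    by apply: le_trans (enormD _ _) _; exact: lerD.
  by rewrite enormZ.
have h2 := le_trans h (cauchy_schwarz _ _).
have S1 : Num.sqrt (\sum_j `|d ord0 j| ^+ 2) = enorm d.
  by congr Num.sqrt; apply: eq_bigr => j _; rewrite real_normK// num_real.
rewrite S1 mulrC in h2.
rewrite -[X in _ <= X * _](sqr_sqrtr (S0 i)) -exprMn.
by apply: lerXn2r h2; rewrite nnegrE ?enorm_ge0// mulr_ge0 ?enorm_ge0 ?sqrtr_ge0.
Qed.

(** As [Omega] is divergence free, [div (Omega u) = div (Omega (u - c))]. The witness
    is the gradient plus terms without divergence, arranged to be equal to
    [- Omega (u - c)] on the cube. *)
Lemma div_test_system (U : set V) (Om : 'I_n -> 'I_n -> V -> V) u (Du : 'I_n -> V -> V)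
    (c : 'rV[R]_n) a rho : measurable U ->
  closed_cube a rho `<=` U ->
  vlint (cut U u) -> (forall i, vlint (cut U (Du i))) ->
  (forall i, is_weak_gradient U (fun x => u x ord0 i) (Du i)) ->
  (forall i j, div_free U (Om i j)) ->
  weak_solution U Om u Du ->
  exists G : 'I_n -> V -> V, [/\ (forall i, vlint (G i)),
    (forall x t, 0 < t -> subcube x t a rho -> closed_cube x t `<=` closed_cube a rho ->
      div_test (cut U u) G x t) &
    (forall y, cube a rho y ->
      grad_norm G y <= potential_norm Om y * enorm (cut U u y - c))].
Proof.
move=> mU aU lu lD wg dOm sol.
pose K := closed_cube a rho.
pose P i := cut K (fun x => Du i x + potential_mul Om u i x).
pose O i j := cut K (Om i j).
pose D i := cut K (Du i).
have locK (X : V -> V) : (forall k, loc_integrable U (fun x => X x ord0 k)) -> vlint (cut K X).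
  by move=> h; apply: vlint_cut => k; exact: (lint_closed_cube mU (h k)).
have lP i : vlint (P i) by apply: locK; case: (sol i).
have lO i j : vlint (O i j) by apply: locK; case: (dOm i j).
have lDK i : vlint (D i) by apply: locK; case: (wg i).
pose G i y : V := \sum_j c ord0 j *: O i j y + D i y - P i y.
have lG i : vlint (G i).
  move=> k; have := lintB (lintD (lint_sum (index_enum 'I_n) (fun j => lintZ (c ord0 j) (lO i j k))) (lDK i k)) (lP i k).
  congr lint; apply/funext => y; rewrite /G coordB coordD summxE; congr (_ + _ - _).
  by apply: eq_bigr => j _; rewrite coordZ.
exists G; split=> // [x t t0 xs xK i|y ya].
  have xa : cube x t `<=` K := subset_trans (@cube_closed_cube _ _ _ _) xK.
  have xU : closed_cube x t `<=` U := subset_trans xK aU.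
  have E1 := div_test_gradient t0 xU lu lD wg i.
  have E2 := cint_div_free t0 xU xa (sol i).
  have E3 j := cint_div_free t0 xU xa (dOm i j).
  have lpsi (X : V -> V) : vlint X -> lint (fun y => \sum_k X y ord0 k * partial k (Psi t x) y).
    by move=> lX; apply: lint_sum => k; exact: lint_grad_Psi.
  rewrite E1; congr (- _).
  have -> : cint x t (fun y => \sum_k cut U (Du i) y ord0 k * partial k (Psi t x) y) =
      cint x t (fun y => \sum_k D i y ord0 k * partial k (Psi t x) y).
    apply: eq_cint => y xy; apply: eq_bigr => k _.
    by rewrite /D !cut_in//; [exact: xa|exact/aU/xa].
  rewrite [RHS](@eq_cint _ _ x t _ (fun y =>
    \sum_j c ord0 j * (\sum_k O i j y ord0 k * partial k (Psi t x) y) +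
    (\sum_k D i y ord0 k * partial k (Psi t x) y) - (\sum_k P i y ord0 k * partial k (Psi t x) y))); last first.
    move=> y _; under [X in X + _ - _]eq_bigr do rewrite mulr_sumr.
    rewrite exchange_big/= -big_split/= -sumrB; apply: eq_bigr => k _.
    rewrite /G coordB coordD summxE mulrBl mulrDl mulr_suml; congr (_ + _ - _).
    by apply: eq_bigr => j _; rewrite coordZ mulrA.
  have lOs : lint (fun y => \sum_j c ord0 j * (\sum_k O i j y ord0 k * partial k (Psi t x) y)).
    by apply: lint_sum => j; apply: lintZ; exact: lpsi.
  rewrite (cintB _ t0 (lintD lOs (lpsi _ (lDK i))) (lpsi _ (lP i))).
  rewrite (cintD _ t0 lOs (lpsi _ (lDK i))) [X in _ - X]E2 subr0.
  rewrite (cint_sum _ _ t0 (fun j => lintZ (c ord0 j) (lpsi _ (lO i j)))).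
  rewrite [X in _ = X + _]big1 ?add0r// => j _.
  by rewrite (cintZ _ _ t0 (lpsi _ (lO i j))) [X in _ * X]E3 mulr0.
have Ky : K y := cube_closed_cube ya.
rewrite (_ : grad_norm G y = Num.sqrt (\sum_i enorm (\sum_j (c - cut U u y) ord0 j *: Om i j y) ^+ 2)).
  by rewrite enormB; exact: tensor_apply_le.
congr Num.sqrt; apply: eq_bigr => i _; congr (enorm _ ^+ 2).
rewrite /G /D /P (cut_in _ Ky) (cut_in _ Ky) opprD addrA addrK /potential_mul -sumrB.
apply: eq_bigr => j _; rewrite /O (cut_in _ Ky) -scalerBl coordB.
by rewrite cut_in//; exact: aU.
Qed.

(** ** The Morrey norm *)
Lemma morrey_bound (U : set V) p (f : V -> R) (N : R) a r : 0 < p -> 0 < N -> 0 < r ->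
  eball a r `<=` U -> (morrey_norm U p f < N%:E)%E ->
  (\int[mu]_(y in eball a r) (`|f y| `^ p)%:E <= (N `^ p * r `^ (m%:R - p))%:E)%E.
Proof.
move=> p0 N0 r0 aU hN; set I := (\int[mu]_(y in _) _)%E.
have I0 : (0 <= I)%E by apply: integral_ge0 => y _; rewrite lee_fin powR_ge0.
have c0 : 0 < r `^ (p - m%:R) by rewrite powR_gt0.
have h : ((((r `^ (p - m%:R))%:E * I) `^ p^-1) < N%:E)%E.
  by apply: le_lt_trans hN; apply: ereal_sup_ubound; exists a, r; split.
have cI : (0 <= (r `^ (p - m%:R))%:E * I)%E by rewrite mule_ge0// lee_fin ltW.
have h2 : ((r `^ (p - m%:R))%:E * I <= (N `^ p)%:E)%E.
  have e1 : (((r `^ (p - m%:R))%:E * I) `^ p^-1 `^ p = (r `^ (p - m%:R))%:E * I)%E.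
    by rewrite -poweRrM mulVf ?gt_eqF// poweRe1.
  rewrite -e1 -[leRHS]/((N%:E `^ p)%E); apply: (gt0_ler_poweR (ltW p0)).
  - by rewrite in_itv/= poweR_ge0 leey.
  - by rewrite in_itv/= leey lee_fin (ltW N0).
  - exact: ltW.
have -> : r `^ (m%:R - p) = (r `^ (p - m%:R))^-1 by rewrite -powRN opprB.
by rewrite EFinM lee_pdivlMr// muleC.
Qed.

(** The unit ball itself is one of the balls of the supremum. *)
Lemma morrey_ge0 p (f : V -> R) : (0 <= morrey_norm (unit_ball R m) p f)%E.
Proof.
apply: (@le_trans _ _ (((1 `^ (p - m%:R))%:E *
   \int[mu]_(y in eball (0 : V) 1) (`|f y| `^ p)%:E) `^ p^-1)%E).
  exact: poweR_ge0.
by apply: ereal_sup_ubound; exists 0, 1; split.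
Qed.

End system.

(** * Bounded mean oscillation *)
Section regularity.
Context {R : realType} {m : nat}.
Local Notation V := 'rV[R]_m.
Local Notation mu := (lebesgue_rV R m).
Local Notation vol := (@vol R m).
Local Notation U := (unit_ball R m).
Local Notation C1 := (@decay_const R m).
Implicit Types (a x y : V) (r s t rho p : R).

(** The Morrey norm is a supremum over balls: this is the price of enclosing a cube of
    half-side [rho] in the ball of radius [2 * m * rho]. *)
Definition cube_ball_const p : R := (2 * m%:R) `^ (m%:R - p).

Lemma cube_ball_const_ge0 p : 0 <= cube_ball_const p.
Proof. exact: powR_ge0. Qed.

Lemma vol_expr r : vol r = 2 ^+ m * r ^+ m.
Proof. by rewrite /vol -[r *+ 2]mulr_natl exprMn. Qed.

Lemma cube_morrey p (f g : V -> R) N a rho : (0 < m)%N -> 0 < p -> 0 < N -> 0 < rho ->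
  measurable_fun setT g -> (forall y, 0 <= g y) -> (forall y, U y -> g y = f y) ->
  safe a rho -> (morrey_norm U p f < N%:E)%E ->
  (\int[mu]_(y in cube a rho) (g y `^ p)%:E <=
   (N `^ p * (cube_ball_const p * rho `^ (m%:R - p)))%:E)%E.
Proof.
move=> m0 p0 N0 rho0 mg g0 gf sa hN.
have k0 : 0 < 2 * m%:R * rho by rewrite !mulr_gt0// ltr0n.
have ball_U := safe_eball sa.
rewrite /cube_ball_const -powRM ?(ltW rho0)//.
apply: le_trans (morrey_bound p0 N0 k0 ball_U hN).
apply: (@le_trans _ _ (\int[mu]_(y in eball a (2 * m%:R * rho)) (g y `^ p)%:E)%E).
  apply: ge0_subset_integral => //.
  - exact: measurable_cube.
  - exact: measurable_eball.
  - apply/measurable_EFinP; apply: (measurableT_comp (measurable_powR p)).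
    exact: measurable_funS mg.
  - by move=> y _; rewrite lee_fin powR_ge0.
  - exact: subset_trans (@cube_closed_cube _ _ _ _) (closed_cube_eball m0 rho0).
rewrite le_eqVlt; apply/orP; left; apply/eqP; apply: eq_integral => y.
by rewrite inE => ya; rewrite -(gf y (ball_U _ ya)) ger0_norm.
Qed.

(** Young's inequality [g <= c + c (g / c)^p] at the level [c = N / rho], where both
    terms have integrals of the same size. *)
Lemma cint_morrey p (g : V -> R) N K a rho : 1 <= p -> 0 < N -> 0 < rho ->
  lint g -> (forall y, 0 <= g y) ->
  (\int[mu]_(y in cube a rho) (g y `^ p)%:E <= (N `^ p * (K * rho `^ (m%:R - p)))%:E)%E ->
  rho * rho^-1 ^+ m * cint a rho g <= N * (2 ^+ m + K).
Proof.
move=> p1 N0 rho0 lg g0 hN.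
have p0 : 0 < p by apply: lt_le_trans p1.
have Nr : 0 < N / rho by rewrite divr_gt0.
pose c := N / rho.
have young y : g y <= c + c * c^-1 `^ p * g y `^ p.
  have [h|h] := leP (g y) c.
    by apply: le_trans h _; rewrite lerDl mulr_ge0 ?powR_ge0// mulr_ge0 ?powR_ge0// ltW.
  have z1 : 1 <= c^-1 * g y by rewrite -ler_pdivrMl ?invr_gt0// invrK mulr1 ltW.
  have h2 : c^-1 * g y <= (c^-1 * g y) `^ p.
    rewrite -[leLHS]powRr1 ?(le_trans _ z1)//; exact: ler_powR.
  apply: (@le_trans _ _ (c * (c^-1 * g y) `^ p)).
    by rewrite -ler_pdivrMl.
  by rewrite powRM// ?invr_ge0 ?(ltW Nr)// mulrA lerDr ltW.
have mgp : measurable_fun setT (fun y => g y `^ p).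
  by apply: (measurableT_comp (measurable_powR p)); case: lg.
have k1 : 0 <= c * c^-1 `^ p by rewrite mulr_ge0 ?powR_ge0// ltW.
have key : ((cint a rho g)%:E <= (c * vol rho + c * c^-1 `^ p * (N `^ p * (K * rho `^ (m%:R - p))))%:E)%E.
  rewrite -(cint_EFin a rho0 lg).
  apply: (@le_trans _ _ (\int[mu]_(y in cube a rho) (c%:E + (c * c^-1 `^ p)%:E * (g y `^ p)%:E))%E).
    apply: ge0_le_integral => //.
    - exact: measurable_cube.
    - by move=> y _; rewrite lee_fin.
    - by apply/measurable_EFinP; apply: measurable_funS (lg.1).
    - apply/measurable_EFinP; apply: measurable_funD => //; apply: measurable_funM => //.
      exact: measurable_funS mgp.
    - by move=> y _; rewrite -EFinM -EFinD lee_fin.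
  rewrite ge0_integralD//; last 4 first.
  - exact: measurable_cube.
  - by move=> y _; rewrite lee_fin ltW.
  - by move=> y _; rewrite mule_ge0// lee_fin// powR_ge0.
  - apply/measurable_EFinP; apply: measurable_funM => //; exact: measurable_funS mgp.
  rewrite EFinD; apply: leeD.
    rewrite integral_cst; last exact: measurable_cube.
    rewrite le_eqVlt; apply/orP; left; apply/eqP.
    exact: (congr1 (fun z => c%:E * z)%E (lebesgue_cube a rho0)).
  rewrite ge0_integralZl.
  - by rewrite [X in (_ <= X)%E]EFinM; apply: lee_wpmul2l; rewrite ?lee_fin.
  - exact: measurable_cube.
  - by apply/measurable_EFinP; exact: measurable_funS mgp.
  - by move=> y _; rewrite lee_fin powR_ge0.
  - by rewrite lee_fin.
rewrite lee_fin in key.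
have r1 : 0 < rho * rho^-1 ^+ m by rewrite mulr_gt0// exprn_gt0// invr_gt0.
apply: le_trans (ler_wpM2l (ltW r1) key) _.
rewrite le_eqVlt; apply/orP; left; apply/eqP.
have E : c^-1 `^ p * (N `^ p * rho `^ (m%:R - p)) = rho ^+ m.
  rewrite /c invf_div powRM ?invr_ge0 ?(ltW rho0) ?(ltW N0)//.
  have Ni : N^-1 `^ p * N `^ p = 1.
    by rewrite -powRM ?invr_ge0 ?(ltW N0)// mulVf ?gt_eqF// powR1.
  rewrite mulrA -(mulrA (rho `^ p)) Ni mulr1 -powRD; last by rewrite (gt_eqF rho0) ?implybT.
  by rewrite addrC subrK powR_mulrn// ltW.
(* The powers of [N] and [rho] combine so that both terms are of size [N rho^(m - 1)]. *)
have -> : c * c^-1 `^ p * (N `^ p * (K * rho `^ (m%:R - p))) =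
  c * K * (c^-1 `^ p * (N `^ p * rho `^ (m%:R - p))) by ring.
rewrite E vol_expr /c exprVn; field.
by rewrite expf_neq0 gt_eqF.
Qed.

Variable n : nat.
Implicit Types (u : V -> 'rV[R]_n) (Du : 'I_n -> V -> V) (Om : 'I_n -> 'I_n -> V -> V).

Lemma subcube_closed_cube a' r' a r : subcube a' r' a r -> closed_cube a' r' `<=` closed_cube a r.
Proof.
move=> s y ya i; have := ya i; have := s i.
have := ler_norm (a ord0 i - a' ord0 i); have := lerNnormlW (lexx `|a ord0 i - a' ord0 i|).
by rewrite /= !in_itv/=; lra.
Qed.

(** In [osc_decay] with [G = Du] the inhomogeneity is bounded, uniformly in the scale, by
    the Morrey norm. *)
Lemma gradient_osc_decay p N u Du a rho th : (0 < m)%N -> 1 <= p -> 0 < N ->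
  vlint (cut U u) -> (forall i, vlint (cut U (Du i))) ->
  (forall i, is_weak_gradient U (fun x => u x ord0 i) (Du i)) ->
  (morrey_norm U p (grad_norm Du) < N%:E)%E ->
  0 < rho -> safe a rho -> 0 < th -> th <= 2^-1 ->
  osc a (th * rho) (cut U u) <= C1 * th * osc a rho (cut U u) +
    C1 * th^-1 ^+ m * (N * (2 ^+ m + cube_ball_const p)).
Proof.
move=> m0 p1 N0 lu lD wg hN rho0 sa th0 th1.
pose g := grad_norm (fun i => cut U (Du i)).
have lg : lint g := lint_grad_norm lD.
have g0 y : 0 <= g y by exact: sqrtr_ge0.
have step x s : 0 < s -> subcube x s a rho ->
    enorm (moll s (cut U u) x - moll (s / 2) (cut U u) x) <=
    @step_const R m * (s * s^-1 ^+ m) * cint x s g.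
  move=> s0 sub; apply: moll_step => // s' s'0 s's; apply: div_test_gradient => //.
  apply: (safe_closed_cube m0 s'0); apply: (safe_subcube m0 s'0 sa).
  by apply: subcube_trans sub; exact: subcube_same.
apply: le_trans (osc_decay rho0 th0 th1 lu lg g0 step) _.
rewrite lerD2l; apply: ler_wpM2l.
  by rewrite mulr_ge0 ?decay_const_ge0// exprn_ge0// invr_ge0 ltW.
apply: (@cint_morrey p) => //; apply: cube_morrey hN => //; first exact: lt_le_trans p1.
  by case: lg.
by move=> y Uy; congr Num.sqrt; apply: eq_bigr => i _; rewrite cut_in.
Qed.

Lemma lower_scale (C : R) : 0 <= C -> forall e, 0 < e -> exists th, [/\ 0 < th, th <= 2^-1 & C * th <= e].
Proof.
move=> C0 e e0; exists (Num.min 2^-1 (e / (C + 1))).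
have d0 : 0 < C + 1 by rewrite ltr_wpDl.
split; first by rewrite lt_min invr_gt0 ltr0n divr_gt0.
  by rewrite ge_min lexx.
apply: (@le_trans _ _ (C * (e / (C + 1)))).
  by rewrite ler_wpM2l// ge_min lexx orbT.
by rewrite mulrCA ler_piMr ?(ltW e0)// ler_pdivrMr// mul1r lerDl.
Qed.

(** Bounded mean oscillation at the distance [d] from the sphere: [gradient_osc_decay] is
    iterated from a fixed scale, where the [L^1] norm of [u] bounds the oscillation. *)
Lemma gradient_bmo p N u Du d : (0 < m)%N -> 1 <= p -> 0 < N ->
  vlint (cut U u) -> (forall i, vlint (cut U (Du i))) ->
  (forall i, is_weak_gradient U (fun x => u x ord0 i) (Du i)) ->
  (morrey_norm U p (grad_norm Du) < N%:E)%E -> 0 < d ->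
  exists B0 : R, 0 < B0 /\ forall a r, enorm a + d <= 1 -> 0 < r -> 2 * m%:R * r <= d ->
    osc a r (cut U u) <= B0.
Proof.
move=> m0 p1 N0 lu lD wg hN d0.
have [th [th0 th1 Cth]] := lower_scale (@decay_const_ge0 R m) (e := 2^-1) ltac:(by rewrite invr_gt0).
have m0R : 0 < m%:R :> R by rewrite ltr0n.
have k0 : 0 < 2 * m%:R :> R by rewrite mulr_gt0.
pose r1 := d / (2 * m%:R).
have r10 : 0 < r1 by rewrite divr_gt0.
pose M := C1 * th^-1 ^+ m * (N * (2 ^+ m + cube_ball_const p)).
have M0 : 0 <= M.
  rewrite mulr_ge0//; first by rewrite mulr_ge0 ?decay_const_ge0// exprn_ge0// invr_ge0 ltW.
  by rewrite mulr_ge0 ?(ltW N0)// addr_ge0 ?exprn_ge0// cube_ball_const_ge0.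
pose L := cint 0 2 (fun y => enorm (cut U u y - 0)).
have L0 : 0 <= L by apply: cint_ge0 => y _; exact: enorm_ge0.
pose T := 2 * ((vol (th * r1))^-1 * L).
have thr : 0 < th * r1 by rewrite mulr_gt0.
have T0 : 0 <= T.
  by rewrite /T mulr_ge0// mulr_ge0// invr_ge0 ltW// vol_gt0.
exists (T + 2 * M + 1); split.
  by rewrite ltr_wpDl// addr_ge0// mulr_ge0.
move=> a r ad r0 rd.
have rr1 : r <= r1 by rewrite ler_pdivlMr// mulrC.
have d1 : d <= 1 by apply: le_trans ad; rewrite lerDr enorm_ge0.
apply: (@le_trans _ _ (T + 2 * M)); last by rewrite lerDl.
apply: (@bounded_iter _ (fun r => osc a r (cut U u)) th r1 M T) => //.
  move=> s s0 sr1.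
  have sa : safe a s.
    by apply: le_trans ad; rewrite lerD2l mulrC -ler_pdivlMr.
  apply: le_trans (gradient_osc_decay m0 p1 N0 lu lD wg hN s0 sa th0 th1) _.
  by rewrite lerD2r; apply: ler_wpM2r Cth; exact: osc_ge0.
move=> s ts sr1; have s0 : 0 < s by exact: lt_le_trans ts.
apply: le_trans (osc_le_mean_dist a 0 s0 lu) _; rewrite /T ler_wpM2l//.
have r1m : r1 <= 1.
  rewrite ler_pdivrMr// mul1r (le_trans d1)//.
  by rewrite -[leLHS]mulr1 ler_pM// ?ler1n// ler_nat.
apply: ler_pM.
- by rewrite invr_ge0 ltW// vol_gt0.
- by apply: cint_ge0 => y _; exact: enorm_ge0.
- rewrite lef_pV2 ?posrE ?vol_gt0// !vol_expr ler_wpM2l ?exprn_ge0//.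
  by apply: lerXn2r; rewrite ?nnegrE// ltW.
- apply: cint_subset => //; first exact: lint_dist.
    by move=> y; exact: enorm_ge0.
  move=> i; rewrite mxE sub0r normrN; have := coord_le_enorm a i; move: ad sr1 r1m d0.
  by clear; lra.
Qed.

End regularity.

(** * Decay for the system *)
Section system_decay.
Context {R : realType} {m : nat}.
Local Notation V := 'rV[R]_m.
Local Notation mu := (lebesgue_rV R m).
Local Notation vol := (@vol R m).
Local Notation U := (unit_ball R m).
Local Notation C1 := (@decay_const R m).
Local Notation jn_const := (@jn_const R m).
Local Notation cube_ball_const := (@cube_ball_const R m).
Implicit Types (a x y : V) (r s t rho p : R).
Variable n : nat.
Implicit Types (u : V -> 'rV[R]_n) (Du : 'I_n -> V -> V) (Om : 'I_n -> 'I_n -> V -> V).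

Lemma measurable_potential_norm Om :
  (forall i j k, measurable_fun [set: V] (fun y => Om i j y ord0 k)) ->
  measurable_fun [set: V] (potential_norm Om).
Proof.
move=> mO.
have ms : measurable_fun [set: R] (@Num.sqrt R).
  by apply: continuous_measurable_fun; exact: sqrt_continuous.
apply: (measurableT_comp ms); apply: measurable_sum => i; apply: measurable_sum => j.
by apply: measurable_funX; apply: measurable_enorm => k; exact: mO.
Qed.

(** In [osc_decay] with [G = - Omega (u - c)] and [c] the average, the inhomogeneity is
    a small multiple of the bound [b] on the oscillation: [jn_weighted] is applied with
    [al = eps * b / r], the value at which its two terms have the same size. *)
Lemma system_osc_decay p q eps th u Du Om a r b : (0 < m)%N -> 1 <= p -> 1 <= q ->
  p^-1 + q^-1 = 1 -> 0 < eps ->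
  vlint (cut U u) -> (forall i, vlint (cut U (Du i))) ->
  (forall i j k, measurable_fun [set: V] (fun y => cut U (Om i j) y ord0 k)) ->
  (forall i, is_weak_gradient U (fun x => u x ord0 i) (Du i)) ->
  (forall i j, div_free U (Om i j)) -> weak_solution U Om u Du ->
  (morrey_norm U p (potential_norm Om) < eps%:E)%E ->
  0 < r -> safe a r -> 0 < th -> th <= 2^-1 -> 0 < b ->
  (forall a' r', 0 < r' -> subcube a' r' a r -> osc a' r' (cut U u) <= b) ->
  osc a (th * r) (cut U u) <= C1 * th * b +
    C1 * th^-1 ^+ m * (eps * (cube_ball_const p + jn_const q * 2 ^+ m)) * b.
Proof.
move=> m0 p1 q1 pq e0 lu lD mO wg dOm sol hN r0 sa th0 th1 b0 hb.
have p0 : 0 < p by exact: lt_le_trans p1.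
have q0 : 0 < q by exact: lt_le_trans q1.
have aU := safe_closed_cube m0 r0 sa.
have caU : cube a r `<=` U := subset_trans (@cube_closed_cube _ _ _ _) aU.
pose c := avg a r (cut U u).
have [G [lG dG leG]] := div_test_system c (@measurable_eball _ _ 0 1) aU lu lD wg dOm sol.
have lg := lint_grad_norm lG.
have g0 y : 0 <= grad_norm G y by exact: sqrtr_ge0.
have step x s : 0 < s -> subcube x s a r ->
    enorm (moll s (cut U u) x - moll (s / 2) (cut U u) x) <=
    @step_const R m * (s * s^-1 ^+ m) * cint x s (grad_norm G).
  move=> s0 sub; apply: moll_step => // s' s'0 s's.
  have sub' : subcube x s' a r by apply: subcube_trans sub; exact: subcube_same.
  by apply: dG => //; exact: subcube_closed_cube.
have := osc_decay r0 th0 th1 lu lg g0 step.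
have k0 : 0 <= C1 * th^-1 ^+ m.
  by rewrite mulr_ge0 ?decay_const_ge0// exprn_ge0// invr_ge0 ltW.
have oscb : osc a r (cut U u) <= b by apply: hb => //; exact: subcube_same.
pose w := potential_norm (fun i j => cut U (Om i j)).
have mw : measurable_fun setT w by exact: measurable_potential_norm.
have w0 y : 0 <= w y by exact: sqrtr_ge0.
have wE y : U y -> w y = potential_norm Om y.
  by move=> Uy; congr Num.sqrt; apply: eq_bigr => i _; apply: eq_bigr => j _; rewrite cut_in.
have hw := cube_morrey m0 p0 e0 r0 mw w0 wE sa hN.
pose al := eps * b / r.
have al0 : 0 < al by rewrite divr_gt0// mulr_gt0.
pose H := cube_ball_const p * r ^+ m.
have mwp : measurable_fun setT (fun y => w y `^ p).
  exact: (measurableT_comp (measurable_powR p)).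
have hH : (\int[mu]_(x in cube a r) ((b / al * w x) `^ p)%:E <= H%:E)%E.
  have bal : b / al = r / eps by rewrite /al; field; rewrite !gt_eqF.
  have bal0 : 0 <= r / eps by rewrite divr_ge0 ?(ltW r0) ?(ltW e0).
  have hk : (0 <= ((r / eps) `^ p)%:E)%E by rewrite lee_fin powR_ge0.
  rewrite bal (eq_integral (fun x => (((r / eps) `^ p)%:E * (w x `^ p)%:E)%E)); last first.
    by move=> y _; rewrite -EFinM (powRM _ bal0 (w0 y)).
  rewrite ge0_integralZl//.
  - apply: le_trans (lee_wpmul2l hk hw) _; rewrite -EFinM lee_fin.
    rewrite powRM ?invr_ge0 ?(ltW r0) ?(ltW e0)//.
    have Ni : eps^-1 `^ p * eps `^ p = 1.
      by rewrite -powRM ?invr_ge0 ?(ltW e0)// mulVf ?gt_eqF// powR1.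
    have E : r `^ p * r `^ (m%:R - p) = r ^+ m.
      rewrite -powRD; last by rewrite (gt_eqF r0) ?implybT.
      by rewrite addrC subrK powR_mulrn// ltW.
    rewrite [leLHS](_ : _ = (eps^-1 `^ p * eps `^ p) *
      (cube_ball_const p * (r `^ p * r `^ (m%:R - p)))); last by ring.
    by rewrite Ni mul1r E.
  - exact: measurable_cube.
  - by apply/measurable_EFinP; exact: measurable_funS mwp.
  - by move=> y _; rewrite lee_fin powR_ge0.
have jn := jn_weighted lu mw w0 r0 b0 p0 q0 pq p1 q1 al0 hb hH.
have gle : cint a r (grad_norm G) <= al * (H + jn_const q * vol r).
  rewrite -lee_fin -(cint_EFin a r0 lg); apply: le_trans jn.
  apply: ge0_le_integral => //.
  - exact: measurable_cube.
  - by move=> y _; rewrite lee_fin.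
  - by apply/measurable_EFinP; apply: measurable_funS (lg.1).
  - apply/measurable_EFinP; apply: measurable_funS (measurableT) (@subsetT _ _) _.
    by apply: measurable_funM => //; exact: (lint_dist c lu).1.
  - by move=> y ya; rewrite lee_fin wE; [exact: leG|exact: caU].
have rr : 0 < r * r^-1 ^+ m by rewrite mulr_gt0// exprn_gt0// invr_gt0.
move=> h; apply: le_trans h _; apply: lerD.
  by apply: ler_wpM2l oscb; rewrite mulr_ge0 ?decay_const_ge0// ltW.
rewrite -[leRHS]mulrA; apply: ler_wpM2l => //; apply: le_trans (ler_wpM2l (ltW rr) gle) _.
rewrite /al /H vol_expr le_eqVlt; apply/orP; left; apply/eqP.
rewrite exprVn; field; by rewrite expf_neq0 gt_eqF.
Qed.

(** Near a point at distance [d] from the sphere, [gradient_bmo] gives a first bound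
    and [system_osc_decay] the hypothesis of [decay_iter]. *)
Lemma osc_power p q eps th u Du Om d : (0 < m)%N -> 1 <= p -> 1 <= q ->
  p^-1 + q^-1 = 1 -> 0 < eps ->
  vlint (cut U u) -> (forall i, vlint (cut U (Du i))) ->
  (forall i j k, measurable_fun [set: V] (fun y => cut U (Om i j) y ord0 k)) ->
  (forall i, is_weak_gradient U (fun x => u x ord0 i) (Du i)) ->
  (forall i j, div_free U (Om i j)) -> weak_solution U Om u Du ->
  (morrey_norm U p (grad_norm Du) < eps%:E)%E ->
  (morrey_norm U p (potential_norm Om) < eps%:E)%E ->
  0 < th -> th <= 2^-1 -> C1 * th <= 4^-1 ->
  C1 * th^-1 ^+ m * (eps * (cube_ball_const p + jn_const q * 2 ^+ m)) <= 4^-1 ->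
  0 < d ->
  exists C rho0 : R, [/\ 0 <= C, 0 < rho0, rho0 <= 1 &
    forall x r, enorm x <= 1 - d -> 0 < r -> r <= rho0 ->
      osc x r (cut U u) <= C * r `^ (ln 2 / - ln (th / 2))].
Proof.
move=> m0 p1 q1 pq e0 lu lD mO wg dOm sol hD hO th0 th1 C1th C1eps d0.
have d20 : 0 < d / 2 by rewrite divr_gt0.
have m0R : 0 < m%:R :> R by rewrite ltr0n.
have k0 : 0 < 2 * m%:R :> R by rewrite mulr_gt0.
have [B0 [B00 hB0]] := gradient_bmo m0 p1 e0 lu lD wg hD d20.
pose rho0 := Num.min 1 (d / 2 / (2 * m%:R)).
have rho00 : 0 < rho0 by rewrite lt_min ltr01 divr_gt0.
have rho1 : rho0 <= 1 by rewrite ge_min lexx.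
have rhod : 2 * m%:R * rho0 <= d / 2 by rewrite mulrC -ler_pdivlMr// ge_min lexx orbT.
pose al : R := ln 2 / - ln (th / 2).
exists (2 * B0 * (rho0^-1) `^ al), rho0; split=> //.
  by rewrite mulr_ge0 ?powR_ge0// mulr_ge0// ltW.
move=> x r xd r0 rr.
have sx : safe x rho0.
  apply: (@le_trans _ _ (1 - d + d / 2)); first by rewrite lerD.
  by move: d0; clear; lra.
have interior a s : 0 < s -> subcube a s x rho0 -> osc a s (cut U u) <= B0.
  move=> s0 sub; apply: hB0 => //.
    have h1 : enorm (a - x) <= m%:R * rho0.
      apply: le_trans (enorm_le_sum _) _.
      apply: (@le_trans _ _ (\sum_(i < m) rho0)); last by rewrite sumr_const card_ord mulr_natl.
      apply: ler_sum => i _; rewrite coordB distrC.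
      by apply: le_trans (sub i); rewrite lerDl ltW.
    have h2 := enormD (a - x) x; rewrite subrK in h2.
    have h3 : m%:R * rho0 <= d / 2 by apply: le_trans rhod; rewrite ler_wpM2r ?(ltW rho00)// ler_peMl// ?ler1n.
    by move: h1 h2 h3 xd; clear; lra.
  apply: le_trans rhod; rewrite ler_wpM2l ?(ltW k0)//.
  by apply: le_trans (sub (Ordinal m0)); rewrite lerDr normr_ge0.
have step a s b : 0 < s -> 0 < b -> subcube a s x rho0 ->
    (forall a' r', 0 < r' -> subcube a' r' a s -> osc a' r' (cut U u) <= b) ->
    osc a (th * s) (cut U u) <= b / 2.
  move=> s0 b0 sub hb; have sa := safe_subcube m0 s0 sx sub.
  apply: le_trans (system_osc_decay m0 p1 q1 pq e0 lu lD mO wg dOm sol hO s0 sa th0 th1 b0 hb) _.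
  have -> : b / 2 = 4^-1 * b + 4^-1 * b by field.
  by apply: lerD; rewrite ler_wpM2r// ltW.
apply: (@powR_decay _ th B0 rho0 (fun r => osc x r (cut U u))) => // k s s0 sk.
by apply: (decay_iter th0 th1 rho00 B00 step interior s0); exact: subcube_same.
Qed.

End system_decay.

(** * Conclusion *)
Section conclusion.
Context {R : realType} {m : nat}.
Local Notation V := 'rV[R]_m.
Local Notation mu := (lebesgue_rV R m).
Local Notation vol := (@vol R m).
Local Notation U := (unit_ball R m).

Lemma enorm_continuous : continuous (@enorm R m).
Proof.
have cs : continuous (fun x : V => \sum_(i < m) x ord0 i ^+ 2).
  have -> : (fun x : V => \sum_(i < m) x ord0 i ^+ 2) =
      \sum_(i < m) (fun x : V => x ord0 i ^+ 2).
    by apply/funext => x; rewrite fct_sumE.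
  elim/big_ind : _ => [|f g cf cg|i _] x; first exact: cst_continuous.
    exact: continuousD (cf x) (cg x).
  apply: (@continuous_comp _ _ _ (fun x : V => x ord0 i) (fun z : R => z ^+ 2)).
    exact: coord_continuous.
  exact: exprn_continuous.
by move=> x; apply: continuous_comp; [exact: cs|exact: sqrt_continuous].
Qed.

Lemma compact_in_unit_ball (K : set V) : compact K -> K `<=` U ->
  exists d : R, 0 < d /\ forall x, K x -> enorm x <= 1 - d.
Proof.
move=> cK KU; have [[y Ky]|/set0P/negP/negPn/eqP K0] := pselect (K !=set0); last first.
  by exists 1; split=> // x; rewrite K0.
have [c Kc hc] := @compact_EVT_max V R _ K (ex_intro _ y Ky) cK
  (continuous_subspaceT enorm_continuous).
exists (1 - enorm c); split=> [|x Kx].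
  by have := KU c (set_mem Kc); rewrite /unit_ball /eball/= subr0 subr_gt0.
by rewrite subKr; apply: hc; exact: mem_set.
Qed.

Variable n : nat.

(** The balls of radius [1 - 1 / (k + 1)] exhaust the unit ball, hence the
    representative is good almost everywhere; every compact subset lies in one of the
    closed balls of radius [1 - d]. *)
Lemma interior_decay_holder (u w : V -> 'rV[R]_n) (al : R) : vlint w ->
  (forall x, U x -> w x = u x) -> 0 < al -> al < 1 ->
  (forall d : R, 0 < d -> exists C rho0 : R, [/\ 0 <= C, 0 < rho0, rho0 <= 1 &
    forall x r, enorm x <= 1 - d -> 0 < r -> r <= rho0 -> osc x r w <= C * r `^ al]) ->
  locally_holder U u.
Proof.
move=> lw wu al0 al1 hd; exists (repr w); split.
  pose E (k : nat) : set V := [set x | enorm x <= 1 - k.+1%:R^-1].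
  have aeE k : {ae mu, forall x, E k x -> w x = repr w x}.
    have k0 : 0 < k.+1%:R^-1 :> R by rewrite invr_gt0.
    have [C [rho0 [C0 rho00 _ hC]]] := hd _ k0.
    have mE : measurable (E k).
      have me : measurable_fun [set: V] (@enorm R m).
        by apply: (@measurable_enorm _ _ _ _ _ id) => i; exact: measurable_coord.
      rewrite -[X in measurable X]setTI (_ : E k = @enorm R m @^-1` `]-oo, 1 - k.+1%:R^-1]%classic).
        exact: (me measurableT _ (measurable_itv _)).
      by apply/seteqP; split => x /=; rewrite in_itv.
    apply: (@ae_repr _ _ _ w (E k) C al rho0 0 2) => //.
      move=> x Ex; apply/cubeP => i; rewrite mxE.
      have := coord_le_enorm x i; have h : enorm x <= 1 - k.+1%:R^-1 by [].
      by rewrite ler_norml => /andP[h1 h2]; apply/andP; split; move: (k.+1%:R^-1) h k0 h1 h2; clear => e; lra.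
  have : {ae mu, forall x, forall k, E k x -> w x = repr w x}.
    exact: ae_foralln.
  apply: filterS => x H Ux; rewrite -(wu x Ux).
  have := Ux; rewrite /unit_ball /eball/= subr0 => /ltr_add_invr[k xk].
  by apply: (H k); rewrite /E/= lerBrDr ltW.
move=> K cK KU; exists al; split=> //.
have [d [d0 Kd]] := compact_in_unit_ball cK KU.
have [C [rho0 [C0 rho00 rho1 hC]]] := hd d d0.
pose L := cint 0 2 (fun y => enorm (w y - 0)).
have L0 : 0 <= L by apply: cint_ge0 => y _; exact: enorm_ge0.
have vi : 0 <= (vol rho0)^-1 by rewrite invr_ge0 ltW// vol_gt0.
apply: (@campanato _ _ _ w K C al rho0 ((vol rho0)^-1 * L)) => //.
- exact: mulr_ge0.
- by move=> x r Kx; apply: hC; exact: Kd.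
move=> x Kx; have := avg_dist x 0 rho00 lw; rewrite subr0 => h; apply: le_trans h _.
apply: ler_wpM2l => //; apply: cint_subset => //; first exact: lint_dist.
  by move=> y; exact: enorm_ge0.
move=> i; rewrite mxE sub0r normrN; have := coord_le_enorm x i; have := Kd x Kx.
by move: rho1 d0; clear; lra.
Qed.

(** As [th / 2 <= 1 / 4], the exponent is at most [1 / 2]. *)
Lemma log_exponent (th : R) : 0 < th -> th <= 2^-1 ->
  0 < ln 2 / - ln (th / 2) /\ ln 2 / - ln (th / 2) < 1.
Proof.
move=> th0 th1.
have l2 : 0 < ln 2 :> R by rewrite ln_gt0// ltr1n.
have e : 0 < th / 2 by rewrite divr_gt0.
have h : ln (th / 2) <= - (ln 2 + ln 2).
  rewrite -lnM ?posrE// -lnV ?posrE ?mulr_gt0// ler_ln ?posrE ?invr_gt0 ?mulr_gt0//.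
  by rewrite invfM ler_wpM2r ?invr_ge0.
have h2 : ln 2 + ln 2 <= - ln (th / 2) by rewrite lerNr.
have h3 : 0 < - ln (th / 2) by apply: lt_le_trans h2; rewrite addr_gt0.
split; first by rewrite divr_gt0.
by rewrite ltr_pdivrMr// mul1r; apply: lt_le_trans h2; rewrite ltrDl.
Qed.

End conclusion.

Theorem theorem1p5 (R : realType) (m : nat) (p : R) :
  (2 <= m)%N -> 1 < p -> p < m%:R / (m%:R - 1) ->
  exists eps : R, 0 < eps /\
    forall n : nat, (1 <= n)%N ->
    forall Omega : 'I_n -> 'I_n -> 'rV[R]_m -> 'rV[R]_m,
      (forall (i j : 'I_n) (k : 'I_m),
        in_Lp (unit_ball R m) p (fun x => Omega i j x ord0 k)) ->
      (forall i j : 'I_n, div_free (unit_ball R m) (Omega i j)) ->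
    forall (u : 'rV[R]_m -> 'rV[R]_n) (Du : 'I_n -> 'rV[R]_m -> 'rV[R]_m),
      is_sobolev1 (unit_ball R m) 2 u Du ->
      weak_solution (unit_ball R m) Omega u Du ->
      (morrey_norm (unit_ball R m) p (grad_norm Du) +
       morrey_norm (unit_ball R m) p (potential_norm Omega) < eps%:E)%E ->
      locally_holder (unit_ball R m) u.
Proof.
move=> m2 p1 _.
have m0 : (0 < m)%N by exact: leq_trans m2.
have p0 : 0 < p by exact: lt_trans p1.
pose q := p / (p - 1).
have pm1 : 0 < p - 1 by rewrite subr_gt0.
have pq : p^-1 + q^-1 = 1 by rewrite /q; field; rewrite !gt_eqF.
have q1 : 1 <= q by rewrite ler_pdivlMr// mul1r gerBl.
have p1' := ltW p1.
(* [th] makes the homogeneous term of [system_osc_decay] at most a quarter, then [eps]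
   does the same for the other term, whose constant depends on [th]. *)
have [th [th0 th1 Cth]] := lower_scale (@decay_const_ge0 R m) (e := 4^-1) ltac:(by rewrite invr_gt0).
pose A := @decay_const R m * th^-1 ^+ m * (@cube_ball_const R m p + @jn_const R m q * 2 ^+ m).
have A0 : 0 <= A.
  apply: mulr_ge0; first by rewrite mulr_ge0 ?decay_const_ge0// exprn_ge0// invr_ge0 ltW.
  by rewrite addr_ge0 ?cube_ball_const_ge0// mulr_ge0 ?jn_const_ge0// exprn_ge0.
have [eps [eps0 _ Ceps]] := lower_scale A0 (e := 4^-1) ltac:(by rewrite invr_gt0).
exists eps; split=> // n _ Omega LOm dOm u Du sob sol sum.
have mU : measurable (unit_ball R m) := @measurable_eball R m 0 1.
have hD : (morrey_norm (unit_ball R m) p (grad_norm Du) < eps%:E)%E.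
  by apply: le_lt_trans sum; rewrite leeDl// morrey_ge0.
have hO : (morrey_norm (unit_ball R m) p (potential_norm Omega) < eps%:E)%E.
  by apply: le_lt_trans sum; rewrite leeDr// morrey_ge0.
have lu : vlint (cut (unit_ball R m) u).
  by apply: vlint_cut => i; apply: lint_Lp2 => //; have [] := sob i.
have lD i : vlint (cut (unit_ball R m) (Du i)).
  by apply: vlint_cut => k; apply: lint_Lp2 => //; have [_ h _] := sob i.
have wg i : is_weak_gradient (unit_ball R m) (fun x => u x ord0 i) (Du i).
  by have [] := sob i.
have mO i j k : measurable_fun [set: 'rV[R]_m] (fun y => cut (unit_ball R m) (Omega i j) y ord0 k).
  have [mf _] := LOm i j k; have := (measurable_restrictT _ mU).1 mf.
  by congr (measurable_fun _ _); apply/funext => y; rewrite mxE.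
have [al0 al1] := log_exponent th0 th1.
apply: (interior_decay_holder lu _ al0 al1) => [x Ux|d d0]; first by rewrite cut_in.
apply: (osc_power m0 p1' q1 pq eps0 lu lD mO wg dOm sol hD hO) => //.
apply: le_trans Ceps; rewrite /A le_eqVlt; apply/orP; left; apply/eqP; ring.
Qed.
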